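(* Let $\mathscr X=[0,1]$, let $\eta=(\eta_x)_{x\in[0,1]}$ be the collection of Laplace functionals of the cluster processes $(S_x)_{x\in[0,1]}$ of a linear graphon Hawkes birth-death process with parameters $\lambda_\infty,h,W,B$ and lifetimes $(J_x)_{x\in[0,1]}$, as described in the context, and fix $t\in\mathbb R_+$. For any $\xi^{(0)}\in\mathbb L^{[0,1]}$, the sequence of iterates $\xi^{(n)}=\Phi(\xi^{(n-1)})$, $n\in\mathbb N$, of the operator $\Phi$ defined in the context converges pointwise to the unique fixed point $\eta$ in $\mathbb L^{[0,1]}$ of $\Phi$. More specifically, for any $u\le t$ and $f\in\mathrm{BM}_+[0,1]$, $$\xi^{(n)}(f,u)\to\eta(f,u),\qquad n\to\infty,$$ i.e. $\xi^{(n)}_x(f,u)\to\eta_x(f,u)$ for each $x\in[0,1]$.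
   Context: Parameters: $\lambda_\infty:[0,1]\to\mathbb R_+$ in $L^\infty[0,1]$; $h:\mathbb R_+\to\mathbb R_+$ in $L^1(\mathbb R_+)$; $W:[0,1]^2\to\mathbb R_+$ measurable; $B=(B_{xy})$ a nonnegative stochastic process on $[0,1]^2$, separable with respect to the open subsets of $[0,1]^2$; there are constants $C_W,C_B\geq 0$ with $W(x,y)\le C_W$ and $\mathbb E[B_{xy}]\le C_B$ for all $x,y\in[0,1]$. $J=(J_x)_{x\in[0,1]}$ is an $\mathbb R_+$-valued stochastic process on $[0,1]$, separable with respect to the open subsets of $[0,1]$; put $\mathscr J_x(u)=\mathbb P(J_x>u)$, $\bar{\mathscr J}_x(u)=1-\mathscr J_x(u)$. Cluster $S_x$: start with one event at location $x$ at time $0$; every event at time $s$ and location $y$ carries an independent realization $B(s)$ of $B$ and generates offspring according to a Poisson process on $[s,\infty)\times[0,1]$ with intensity $B_{zy}(s)W(z,y)h(t-s)\,\mathrm dt\,\mathrm dz$; each event at location $y$ has a lifetime distributed as $J_y$, independent of everything else (death does not affect offspring). $S_x(u)$ is the collection of events (ancestor included) born by time $u$ whose lifetime has not expired at time $u$. Laplace functionals: $\mathrm{BM}_+[0,1]$ is the set of bounded measurable functions $f:[0,1]\to\mathbb R_+$. For a point or birth-death process $Z$ with locations in $[0,1]$, $\mathcal L_Z(f,t)=\mathbb E[\exp(-\sum_{x_i\in Z(t)}f(x_i))]$, where $Z(t)$ registers the locations of events that have occurred and not expired by time $t$. For a family $Z=(Z_x)_{x\in[0,1]}$ of such processes, $\mathcal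 L_Z(f,t)=(\mathcal L_{Z_x}(f,t))_{x\in[0,1]}$; $\mathbb L^{[0,1]}$ is the set of all such transforms $\mathcal L_Z$. $\eta_x=\mathcal L_{S_x}$. Operator: let $\beta_x$ be the Laplace functional of $B_{\cdot x}$, $\beta_x(g)=\mathbb E[\exp(-\int_0^1g(y)B_{yx}\,\mathrm dy)]$, and $\gamma_x(f,u)=\bar{\mathscr J}_x(u)+\mathscr J_x(u)e^{-f(x)}$. For $\xi\in\mathbb L^{[0,1]}$, $f\in\mathrm{BM}_+[0,1]$, $u\ge0$, $$\Phi_x(\xi)(f,u):=\gamma_x(f,u)\,\beta_x\Big(y\mapsto\int_0^u\big(1-\xi_y(f,u-s)\big)W(y,x)h(s)\,\mathrm ds\Big),\qquad\Phi(\xi)=(\Phi_x(\xi))_{x\in[0,1]}.$$ *)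

(* Defs.v *)
From HB Require Import structures.
From mathcomp Require Import all_boot all_order all_algebra.
From mathcomp Require Import all_classical all_reals all_analysis.
(* Not exported by all_analysis; declares the measurable structure of \bar R. *)
From mathcomp Require Import measurable_realfun.
Set Implicit Arguments.
Unset Strict Implicit.
Unset Printing Implicit Defensive.
Import Order.TTheory GRing.Theory Num.Theory.
Import numFieldNormedType.Exports.
Local Open Scope classical_set_scope.
Local Open Scope ring_scope.

(* Doob separability of the process X indexed by D: a countable separating set
   C and a single null set N serve all (relatively) open G and all closed F. *)
Definition separable_process {R : realType} {d} {T : measurableType d}
    (P : probability T R) {U : topologicalType} (D : set U) (X : U -> T -> R) :=
  exists C : set U, [/\ countable C, C `<=` D, D `<=` closure C &
    exists N : set T, P.-negligible N /\
      forall (G : set U) (F : set R), open G -> closed F ->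
        [set w | forall t, (G `&` C) t -> F (X t w)] `\`
        [set w | forall t, (G `&` D) t -> F (X t w)] `<=` N].

(* A birth-death process, as an enumeration of its events by I.
   birth i w = +oo means that the event i does not occur; life i w = +oo means
   that it never expires, so a point process has all its lifetimes equal to +oo. *)
Record bd_process (R : realType) (T : Type) (I : Type) := BDProcess {
  birth : I -> T -> \bar R;
  loc : I -> T -> R;
  life : I -> T -> \bar R }.

Section birth_death.
Context {R : realType} {d : measure_display} {T : measurableType d}.
Variables (P : probability T R) (I : choiceType).
Implicit Type Z : bd_process R T I.

Record bd_measurable Z : Prop := {
  birth_meas : forall i, measurable_fun setT (birth Z i);
  birth_ge0 : forall i w, (0 <= birth Z i w)%E;
  loc_meas : forall i, measurable_fun setT (loc Z i);
  loc_01 : forall i w, loc Z i w \in `[0, 1];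
  life_meas : forall i, measurable_fun setT (life Z i);
  life_ge0 : forall i w, (0 <= life Z i w)%E }.

Definition locally_finite Z :=
  {ae P, forall w, forall t : R, finite_set [set i | (birth Z i w <= t%:E)%E]}.

(* The events that make up Z(t). *)
Definition alive Z (t : R) (w : T) : set I :=
  [set i | (birth Z i w <= t%:E)%E /\ (t%:E < birth Z i w + life Z i w)%E].

Definition laplace Z (f : R -> R) (t : R) : R :=
  fine (\int[P]_w
    expeR (- (\esum_(i in alive Z t w) (f (loc Z i w))%:E)))%E.

End birth_death.

Definition BMplus {R : realType} (f : R -> R) :=
  [/\ measurable_fun (`[0, 1] : set R) f,
      forall (x : R), x \in `[0, 1] -> 0 <= f x &
      exists C, forall (x : R), x \in `[0, 1] -> f x <= C].

(* Only the values at x in [0,1], f in BM_+[0,1] and u >= 0 are meaningful. *)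
Definition functional (R : realType) := R -> (R -> R) -> R -> R.

Definition functional_eq {R : realType} (xi zeta : functional R) :=
  forall x f u, x \in `[0, 1] -> BMplus f -> 0 <= u -> xi x f u = zeta x f u.

(* The [0,1]-power of the set of Laplace functionals.  A Laplace functional only
   depends on the law of the process, so each Z_x may live on its own space.  *)
Definition laplace_family {R : realType} (xi : functional R) :=
  forall (x : R), x \in `[0, 1] ->
    exists (d : measure_display) (T : measurableType d) (P : probability T R)
           (I : countType) (Z : bd_process R T I),
      [/\ bd_measurable Z, locally_finite P Z &
        forall f u, BMplus f -> 0 <= u -> xi x f u = laplace P Z f u].

Section conditional_poisson.
Context {R : realType} {d : measure_display} {T : measurableType d}.
Variable P : probability T R.

(* The library's poisson_pmf takes the value 1 everywhere at rate 0. *)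
Definition poisson_mass (l : \bar R) (n : nat) : R :=
  if l is r%:E then expR (- r) * r ^+ n / n`!%:R else 0.

(* Conditionally on the sigma-algebra G, the random counting measure N is
   Poisson with the (G-measurable, random) intensity measure Lam. *)
Definition conditionally_poisson (G : set (set T))
    (N Lam : set (R * R) -> T -> \bar R) :=
  forall (m : nat) (A : 'I_m -> set (R * R)) (n : 'I_m -> nat) (E : set T),
    (forall j, measurable (A j)) -> trivIset setT A -> G E ->
    (P (E `&` [set w | forall j, N (A j) w = (n j)%:R%:E]) =
     \int[P]_(w in E) (\prod_(j < m) poisson_mass (Lam (A j) w) (n j))%:E)%E.

End conditional_poisson.

Definition survival {R : realType} {d} {T : measurableType d}
    (P : probability T R) (J : R -> T -> R) (x u : R) : R :=
  fine (P [set w | J x w > u]).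

Section cluster.
Context {R : realType} {dB dJ d : measure_display}.
Context {OB : measurableType dB} {OJ : measurableType dJ}.
Context {T : measurableType d}.
Variables (h : R -> R) (W : R -> R -> R).
Variables (PB : probability OB R) (B : R -> R -> OB -> R).
Variables (PJ : probability OJ R) (J : R -> OJ -> R).
Variable P : probability T R.
(* Events carry Ulam-Harris labels: the root is [::] and the children of v are
   the rcons v i.  The realization of B carried by v is B _ _ (M v w), where the
   mark M v is a random point of the probability space on which B is defined. *)
Variables (S : bd_process R T (seq nat)) (M : seq nat -> T -> OB).

Definition offspring (v : seq nat) (A : set (R * R)) (w : T) : \bar R :=
  (\esum_(i in [set i | exists t : R, birth S (rcons v i) w = t%:E /\
                                      A (t, loc S (rcons v i) w)]) 1)%E.

(* Points are (t, z) = (birth time, location). *)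
Definition offspring_intensity (v : seq nat) (A : set (R * R)) (w : T) : \bar R :=
  if birth S v w is s%:E then
    (\int[lebesgue_measure \x lebesgue_measure]_(p in
        A `&` (`[s, +oo[ `*` `[0%R, 1%R]))
      (B p.2 (loc S v w) (M v w) * W p.2 (loc S v w) * h (p.1 - s))%:E)%E
  else 0%E.

(* The sigma-algebra generated by the births and locations of the events in
   K1, the marks of those in K2 and the lifetimes of those in K3. *)
Definition cluster_sigma (K1 K2 K3 : set (seq nat)) : set (set T) :=
  <<s (\bigcup_(v in K1) (preimage_set_system setT (birth S v) measurable `|`
                          preimage_set_system setT (loc S v) measurable)) `|`
      (\bigcup_(v in K2) preimage_set_system setT (M v) measurable) `|`
      (\bigcup_(v in K3) preimage_set_system setT (life S v) measurable) >>.

Definition not_below (v : seq nat) : set (seq nat) :=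
  [set w | ~~ prefix v w].
Definition not_strictly_below (v : seq nat) : set (seq nat) :=
  [set w | ~~ (prefix v w && (w != v))].

(* The labels of events that do not occur are imposed the same mark and lifetime
   laws, which is immaterial; their offspring has intensity 0. *)
Record is_cluster (x : R) : Prop := {
  cluster_meas : bd_measurable S;
  cluster_mark_meas : forall v, measurable_fun setT (M v);
  cluster_root : forall w, birth S [::] w = 0%E /\ loc S [::] w = x;
  cluster_mark : forall v (E : set T) (C : set OB),
    cluster_sigma (not_strictly_below v) (not_below v) (not_below v) E ->
    measurable C -> (P (E `&` M v @^-1` C) = P E * PB C)%E;
  cluster_offspring : forall v,
    conditionally_poisson P
      (cluster_sigma (not_strictly_below v) (not_strictly_below v) (not_below v))
      (offspring v) (offspring_intensity v);
  cluster_life : forall v (E : set T) (r : R),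
    cluster_sigma setT setT [set~ v] E -> 0 <= r ->
    (P (E `&` [set w | r%:E < life S v w]) =
     \int[P]_(w in E) (survival PJ J (loc S v w) r)%:E)%E }.

End cluster.

Section operator.
Context {R : realType} {dB dJ : measure_display}.
Context {OB : measurableType dB} {OJ : measurableType dJ}.
Variables (h : R -> R) (W : R -> R -> R).
Variables (PB : probability OB R) (B : R -> R -> OB -> R).
Variables (PJ : probability OJ R) (J : R -> OJ -> R).

Definition beta (x : R) (g : R -> R) : R :=
  fine (\int[PB]_e
    expeR (- \int[lebesgue_measure]_(y in `[0%R, 1%R]) (g y * B y x e)%:E))%E.

Definition gamma (x : R) (f : R -> R) (u : R) : R :=
  (1 - survival PJ J x u) + survival PJ J x u * expR (- f x).

(* No measurability of y |-> xi y f u is imposed: for a non-measurable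
   nonnegative integrand, the integral is the lower one. *)
Definition Phi (xi : functional R) : functional R := fun x f u =>
  gamma x f u *
  beta x (fun y => \int[lebesgue_measure]_(s in `[0, u])
                     ((1 - xi y f (u - s)) * W y x * h s)).

End operator.

(* Main.v *)
(* Fix f and u.  Write q (s, y) for the Laplace transform at time u of the progeny of an event
   born at time s and location y, with q = 1 for s > u.  One application of Phi corresponds to
   q |-> g * E[exp(- int (1 - q) kap)], where g integrates out the lifetime of the event and
   kap is the intensity of its offspring.

   Convergence: Phi is monotone and all Laplace transforms lie between 0 and 1, so every
   sequence of iterates is squeezed between those started at 0 and at 1.  Their distance,
   weighted by exp(-theta (u - s)), is halved at each step once theta is so large that
   CB CW int exp(-theta r) h(r) dr <= 1/2.

   Identification: the iterates started at 1 are the Laplace transforms of the cluster cut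
   after n generations.  Conditioning a family tree on its first generation replaces the
   subtrees of the children by their weights q, then the lifetime, the Poisson offspring
   and the mark of the parent are integrated out in this order.  Letting n tend to infinity
   gives the transform of the cluster itself, which is therefore the common limit; it is a
   fixed point because it stays between the two extreme sequences.

   Local finiteness: charging a cost c for every event born before k in the same recursion
   gives E[exp(- c N_k)] >= 1 - 2 c exp(theta k), so N_k is finite almost surely on letting
   c tend to 0. *)
Require Import Defs.
From HB Require Import structures.
From mathcomp Require Import all_boot all_order all_algebra finmap.
From mathcomp Require Import all_classical all_reals all_analysis.
From mathcomp Require Import measurable_realfun ring lra.
Set Implicit Arguments.
Unset Strict Implicit.
Unset Printing Implicit Defensive.
Import Order.TTheory GRing.Theory Num.Theory.
Import numFieldNormedType.Exports.
Local Open Scope classical_set_scope.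
Local Open Scope ring_scope.

(** * The function exp(-a) on extended reals *)

(** The components of a family in [laplace_family] are unrelated, so a start of the iteration need
    not be measurable in the location. The integral in [Phi] is then a lower integral, monotone but
    not additive, and two iterates cannot be subtracted under it. This is why arbitrary functionals
    are compared by order only, and the contraction estimate is made between the starts 0 and 1,
    whose iterates are measurable. No subcriticality CB CW int h < 1 is available. The exponential
    weight replaces it: a child comes a delay r after its parent, which gains a factor exp(-theta
    r). The conditional laws are identities over the sets of sigma-algebras indexed by labels. Every
    step therefore integrates against a bounded multiplier X measurable for such an algebra, and the
    induction on the tree carries X along. A weight in [0,1] is exp(-c) for a cost c in [0,+oo]. The
    tree recursion is proved for an abstract cost and used twice, for the Laplace functional and for
    local finiteness. *)

Section expN.
Context {R : realType}.
Local Open Scope ereal_scope.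
Implicit Types a b : \bar R.

(** Extended values let an infinite cost have the exponential 0, so that vanishing weights and
    divergent sums need no separate treatment. *)
Definition expN a : \bar R := expeR (- a).

Lemma expN0 : expN 0 = 1. Proof. by rewrite /expN oppe0 expeR0. Qed.

Lemma expN_ge0 a : 0 <= expN a. Proof. exact: expeR_ge0. Qed.

Lemma le_expN a b : a <= b -> expN b <= expN a.
Proof. by move=> ab; rewrite /expN lee_expeR leeN2. Qed.

Lemma expN_le1 a : 0 <= a -> expN a <= 1.
Proof. by move=> a0; rewrite -expN0; exact: le_expN. Qed.

Lemma expND a b : 0 <= a -> 0 <= b -> expN (a + b) = expN a * expN b.
Proof. by move=> a0 b0; rewrite /expN oppeD ?ge0_adde_def// ?inE// expeRD. Qed.

Lemma expN_fin a : 0 <= a -> expN a \is a fin_num.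
Proof.
move=> a0; rewrite ge0_fin_numE ?expN_ge0//.
by apply: (le_lt_trans (expN_le1 a0)); rewrite ltry.
Qed.

Lemma expNE (r : R) : expN r%:E = (expR (- r))%:E. Proof. by []. Qed.

Lemma expNy : expN +oo = 0. Proof. by []. Qed.

(** Holds at [a = 0] too, where [- lne a] is +oo: every weight in [0,1] is the exponential of a
    nonnegative cost. *)
Lemma expN_lneN a : 0 <= a -> expN (- lne a) = a.
Proof. by move=> a0; rewrite /expN oppeK; apply/eqP; rewrite lneK_eq. Qed.

Lemma oppe_lne_ge0 a : a <= 1 -> 0 <= - lne a.
Proof. by move=> a1; rewrite oppe_ge0 lne_le0. Qed.

Lemma expN_cvg (u : (\bar R)^nat) a : (forall n, 0 <= u n) ->
  u @ \oo --> a -> (expN \o u) @ \oo --> expN a.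
Proof.
move=> u0 ua.
have a0 : 0 <= a by apply: (cvge_to_ge ua); apply: nearW => n; exact: u0.
case: a a0 ua => [r r0|_|//] ua.
- move/fine_cvgP : ua => [ufin ur].
  apply/fine_cvgP; split.
    by apply: nearW => n; exact: expN_fin.
  have H : (expR (- fine (u n)))%R @[n --> \oo] --> expR (- r).
    by apply: continuous_cvg; [exact: continuous_expR|exact: cvgN].
  apply: cvg_trans H; apply: near_eq_cvg.
  by near=> n => /=; rewrite -[u n in RHS]fineK//; near: n.
- rewrite expNy; apply/fine_cvgP; split.
    by apply: nearW => n; exact: expN_fin.
  apply/cvgrPdist_le => e e0.
  move/cvgeyPge/(_ (- ln e)%R) : ua => [N _ NP]; exists N => // n Nn.
  have := le_expN (NP n Nn).
  rewrite expNE opprK lnK ?posrE// => {}NP.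
  rewrite sub0r normrN ger0_norm; last by rewrite fine_ge0 ?expN_ge0.
  by rewrite -lee_fin fineK ?expN_fin.
Unshelve. all: by end_near. Qed.

(** Combines 1 - exp(-c) <= c with exp(-a) <= 1. It is stated as a sum because [c] may be infinite.
    This linear bound is what makes the recursion contract. *)
Lemma expN_sub a c : 0 <= a -> 0 <= c -> expN a <= expN (a + c) + c.
Proof.
move=> a0 c0; rewrite expND//.
have [->|cy] := eqVneq c +oo.
  by rewrite addey ?leey// gt_eqF// (lt_le_trans _ (mule_ge0 _ _))// ?expN_ge0// ltNy0.
case: c c0 cy => // c c0 _.
have afin := expN_fin a0.
have := expN_ge0 a; have := expN_le1 a0.
rewrite -(fineK afin) expNE -EFinM -EFinD !lee_fin => l1 l0.
have := expR_ge1Dx (- c); set e := expR _ => ec.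
rewrite lee_fin in c0.
rewrite -lerBlDl -{1}[fine _]mulr1 -mulrBr.
apply: (@le_trans _ _ (fine (expN a) * c)%R); last by rewrite ler_piMl.
by rewrite ler_wpM2l// lerBlDl -lerBlDr.
Qed.

Lemma oneB_expN01 a : 0 <= a -> 0 <= 1 - expN a <= 1.
Proof.
move=> a0; rewrite sube_ge0 ?expN_fin// expN_le1//=.
by rewrite leeBlDr ?expN_fin// -[leLHS]adde0 leeD2l// expN_ge0.
Qed.

End expN.

Section measurable_expN.
Context {R : realType} d (T : measurableType d).
Local Open Scope ereal_scope.

Lemma measurable_expeR : measurable_fun setT (@expeR R).
Proof.
apply: (@measurability _ _ _ _ _ _ (@ErealGenOInfty.G R)).
  exact: ErealGenOInfty.measurableE.
move=> _ [_ [r ->] <-]; rewrite setTI.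
have [r0|r0] := ltP r 0%R.
  rewrite (_ : _ @^-1` _ = setT)//; apply/seteqP; split => // x _ /=.
  by rewrite in_itv/= andbT (lt_le_trans _ (expeR_ge0 x))// lte_fin.
have [y <-] : exists y, expeR y = r%:E by apply: expeR_total; rewrite lee_fin.
rewrite (_ : _ @^-1` _ = `]y, +oo[%classic); first exact: emeasurable_itv.
by apply/seteqP; split => x /=; rewrite !in_itv/= !andbT lte_expeR.
Qed.

Lemma measurable_expN (f : T -> \bar R) : measurable_fun setT f ->
  measurable_fun setT (fun x => expN (f x)).
Proof.
move=> mf; apply: (measurableT_comp measurable_expeR).
exact: measurableT_comp.
Qed.

Lemma measurable_lne : measurable_fun setT (@lne R).
Proof.
apply: (@measurability _ _ _ _ _ _ (@ErealGenOInfty.G R)).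
  exact: ErealGenOInfty.measurableE.
move=> _ [_ [r ->] <-]; rewrite setTI.
rewrite (_ : _ @^-1` _ = `](expR r)%:E, +oo[%classic); first exact: emeasurable_itv.
apply/seteqP; split => x /=; rewrite !in_itv/= !andbT => rx.
- rewrite ltNge; apply/negP => xr.
  have [x0|x0] := leP x 0; first by move: rx; rewrite le0_lneNy.
  move: rx; rewrite -lte_expeR lneK ?in_itv/= ?leey ?andbT ?(ltW x0)//=.
  by rewrite ltNge xr.
- rewrite -lte_expeR lneK//= in_itv/= leey andbT.
  by apply: ltW; apply: le_lt_trans rx; rewrite lee_fin expR_ge0.
Qed.

End measurable_expN.

Lemma cvg_series_exp_coeff {R : realType} (x : R) :
  series (exp_coeff x) @ \oo --> expR x.
Proof. exact: is_cvg_series_exp_coeff. Qed.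

(** * Poisson generating functions *)

Section poisson_generating_function.
Context {R : realType}.
Local Open Scope ereal_scope.

Lemma poisson_mass_ge0 (l : \bar R) n : 0 <= l -> (0 <= poisson_mass l n)%R.
Proof.
case: l => [r| |]//= r0; rewrite divr_ge0// mulr_ge0 ?expR_ge0 ?exprn_ge0//.
Qed.

(** The strict bound on [q] makes the case [l = +oo] true: there all masses vanish, and the right
    side is exp(-oo) = 0, whereas [q = 1] would give exp(0). *)
Lemma nneseries_poisson_mass (l : \bar R) (q : R) : 0 <= l -> (0 <= q < 1)%R ->
  \sum_(n <oo) ((q ^+ n * poisson_mass l n)%:E) = expN (l * (1 - q)%:E).
Proof.
move=> l0 /andP[q0 q1]; case: l l0 => [r r0|_|//]; last first.
  rewrite mulyr gtr0_sg ?subr_gt0// mul1e expNy.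
  by rewrite eseries0// => n _ _; rewrite mulr0.
rewrite -EFinM expNE.
apply/cvg_lim => //.
rewrite (_ : (fun n => _) =
  EFin \o (fun n => expR (- r) * series (exp_coeff (r * q)) n)%R); last first.
  apply/funext => n /=; rewrite /series/= sumEFin mulr_sumr; congr (_%:E).
  apply: eq_bigr => i _; rewrite /exp_coeff/= exprMn.
  by rewrite mulrCA !mulrA; congr (_ / _)%R; rewrite mulrC !mulrA.
apply/cvg_EFin; first exact: nearW.
have -> : expR (- (r * (1 - q))) = (expR (- r) * expR (r * q))%R.
  by rewrite -expRD; congr expR; ring.
by apply: cvgM; [exact: cvg_cst|exact: cvg_series_exp_coeff].
Qed.

Lemma measurable_poisson_mass n : measurable_fun setT (poisson_mass ^~ n : \bar R -> R).
Proof.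
rewrite (_ : poisson_mass ^~ n = fun l : \bar R => if l \is a fin_num then
  (expR (- fine l) * fine l ^+ n / n`!%:R)%R else 0%R); last first.
  by apply/funext => -[].
apply: measurable_fun_ifT => //.
  apply: (@measurable_fun_bool _ _ _ _ true); rewrite setTI.
  by rewrite -[X in measurable X]setTI; exact: emeasurable_fin_num.
have mf : measurable_fun setT (@fine R) by exact: fine_measurable.
apply: measurable_funM => //; apply: measurable_funM.
  by apply: measurableT_comp => //; exact: measurableT_comp.
exact: measurable_funX.
Qed.

End poisson_generating_function.

(** * From the sets of a sub-sigma-algebra to measurable multipliers *)

Section measurable_lift.
Context {R : realType} d (T : measurableType d) (P : {measure set T -> \bar R}).
Variable (G : set (set T)).
Hypothesis Gsub : <<s G >> `<=` measurable.
Local Open Scope ereal_scope.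
Import HBNNSimple.

Lemma measurable_fun_sub_sigma {d'} {T' : measurableType d'} (X : T -> T') :
  measurable_fun setT (X : g_sigma_algebraType G -> T') -> measurable_fun setT X.
Proof. by move=> mX _ B mB; apply: Gsub; exact: mX. Qed.

(** Does the work of a conditional expectation given [G]. The simple functions that increase to [X]
    are taken measurable for [G], so that their level sets are among the sets [E] of the
    hypothesis. *)
Lemma integral_sub_sigmaM (Y Y' X : T -> \bar R) :
  measurable_fun setT Y -> (forall w, 0 <= Y w <= 1) ->
  measurable_fun setT Y' -> (forall w, 0 <= Y' w <= 1) ->
  (forall E, <<s G >> E -> \int[P]_(w in E) Y w = \int[P]_(w in E) Y' w) ->
  measurable_fun setT (X : g_sigma_algebraType G -> _) -> (forall w, 0 <= X w) ->
  \int[P]_w (X w * Y w) = \int[P]_w (X w * Y' w).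
Proof.
move=> mY Y01 mY' Y'01 YY' mX X0.
pose f := nnsfun_approx measurableT mX.
have key (Z : T -> \bar R) : measurable_fun setT Z -> (forall w, 0 <= Z w <= 1) ->
    \int[P]_w (X w * Z w) = limn (fun n => \sum_(y \in range (f n))
      y%:E * \int[P]_(w in f n @^-1` [set y]) Z w).
  move=> mZ Z01.
  have Z0 w : 0 <= Z w by have /andP[] := Z01 w.
  have mfn n : measurable_fun setT (fun w : T => (f n w)%:E).
    by apply: measurable_fun_sub_sigma; exact/measurable_EFinP.
  have mfny n y : measurable (f n @^-1` [set y] : set T).
    by apply: Gsub; rewrite -[X in <<s _ >> X]setTI; exact: (measurable_funP (f n)).
  transitivity (limn (fun n => \int[P]_w ((f n w)%:E * Z w))).
    rewrite -monotone_convergence//.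
    - apply: eq_integral => w _; apply/esym/cvg_lim => //.
      have H : EFin (f n w) @[n --> \oo] --> X w by exact: cvg_nnsfun_approx.
      apply: cvgeZr => //; have /andP[z0 z1] := Z01 w.
      by rewrite ge0_fin_numE// (le_lt_trans z1)// ltry.
    - by move=> n; exact: emeasurable_funM.
    - by move=> n w _; rewrite mule_ge0// lee_fin.
    - move=> w _ m n mn; rewrite lee_wpmul2r// lee_fin.
      by move/lefP: (nd_nnsfun_approx measurableT mX mn).
  congr (limn _); apply/funext => n.
  transitivity (\int[P]_w \sum_(y \in range (f n))
      ((y * \1_(f n @^-1` [set y]) w)%:E * Z w)).
    apply: eq_integral => w _; rewrite -ge0_mule_fsuml; last first.
      by move=> y; exact: nnfun_muleindic_ge0.
    by congr (_ * _); rewrite fsumEFin// -fimfunE.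
  rewrite ge0_integral_fsum//; last 2 first.
  - move=> y; apply: emeasurable_funM => //; apply/measurable_EFinP.
    by apply: measurable_funM => //; exact: measurable_indic.
  - by move=> y w _; rewrite mule_ge0// nnfun_muleindic_ge0.
  apply: eq_fsbigr => y _.
  have [y0|y0] := leP 0%R y.
    rewrite [in RHS]integral_mkcond -ge0_integralZl_EFin//; last 2 first.
    - by move=> w _; exact: erestrict_ge0.
    - exact/(measurable_restrictT _ _).1/measurable_funTS.
    apply: eq_integral => w _; rewrite EFinM -muleA; congr (_ * _).
    by rewrite /patch indicE; case: ifPn => _; rewrite ?mul1e ?mul0e.
  rewrite preimage_nnfun0// integral_set0 mule0.
  by rewrite integral0_eq// => w _; rewrite indic0 mulr0 mul0e.
by rewrite !key//; congr (limn _); apply/funext => n; apply: eq_fsbigr => y _;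
  rewrite YY'//; exact: (measurable_funPTI (f n)).
Qed.

End measurable_lift.

(** * Integration *)

Section bounded_convergence.
Context {R : realType} d (T : measurableType d) (P : probability T R).
Local Open Scope ereal_scope.

Lemma cvg_integral_le1 (D : set T) (f_ : (T -> \bar R)^nat) (f : T -> \bar R) :
  measurable D -> (forall n, measurable_fun setT (f_ n)) ->
  (forall n w, 0 <= f_ n w <= 1) ->
  (forall w, f_ n w @[n --> \oo] --> f w) ->
  \int[P]_(w in D) f_ n w @[n --> \oo] --> \int[P]_(w in D) f w.
Proof.
move=> mD mf_ f01 f_f.
have mf : measurable_fun setT f by apply: (emeasurable_fun_cvg f_) => // w _; exact: f_f.
have H1 : {ae P, forall w, D w -> f_ n w @[n --> \oo] --> f w}.
  by apply: aeW => w _; exact: f_f.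
have H2 : {ae P, forall w n, D w -> `|f_ n w| <= cst 1 w}.
  by apply: aeW => w n _; have /andP[f0 f1] := f01 n w; rewrite gee0_abs.
by have [] := dominated_convergence mD (fun n => measurable_funTS (mf_ n))
  (measurable_funTS mf) H1 (finite_measure_integrable_cst _ _ mD) H2.
Qed.

Lemma integral_le1 (f : T -> \bar R) : measurable_fun setT f ->
  (forall w, 0 <= f w <= 1) -> 0 <= \int[P]_w f w <= 1.
Proof.
move=> mf f01; apply/andP; split.
  by apply: integral_ge0 => w _; have /andP[] := f01 w.
apply: (@le_trans _ _ (\int[P]_w cst 1 w)).
  by apply: ge0_le_integral => // w _; have /andP[] := f01 w.
by rewrite integral_cst// mul1e probability_le1.
Qed.

End bounded_convergence.

Section translation.
Context {R : realType}.
Local Notation mu := (@lebesgue_measure R).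
Local Open Scope ereal_scope.

Lemma measurable_addr (s : R) : measurable_fun setT (+%R s : R -> R).
Proof. exact: measurable_funD. Qed.

(** Translation invariance comes from the uniqueness of Lebesgue measure, which only requires the
    lengths of half-open intervals. *)
Lemma ge0_integral_translate (s : R) (f : R -> \bar R) : measurable_fun setT f ->
  (forall r, 0 <= f r) -> \int[mu]_r f (s + r)%R = \int[mu]_r f r.
Proof.
move=> mf f0.
pose phi : R -> measurableTypeR R := +%R s.
have mphi : measurable_fun setT phi by exact: measurable_addr.
transitivity (\int[pushforward mu phi]_r f r).
  by rewrite ge0_integral_pushforward.
apply: eq_measure_integral => A mA _.
pose mphi_mixin := isMeasurableFun.Build _ _ _ _ _ mphi.
pose mphi_pack : {mfun _ >-> _} := HB.pack phi mphi_mixin.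
symmetry; apply: (@lebesgue_measure_unique R (pushforward mu mphi_pack)) => //.
move=> _ [[a b]] _ <-.
change (mu `]a, b] = mu (phi @^-1` `]a, b])).
rewrite (_ : phi @^-1` _ = `](a - s)%R, (b - s)%R]%classic).
  rewrite !lebesgue_measure_itv/= !lte_fin ltrD2r.
  by case: ifPn => // _; congr (_%:E); ring.
by apply/seteqP; split => x /=; rewrite !in_itv/= /phi ltrBlDl lerBrDl.
Qed.

End translation.

Section independent_integral.
Context {R : realType} d (T : measurableType d) (P : probability T R).
Context d' (T' : measurableType d') (Q : probability T' R).
Variables (G : set (set T)) (M : T -> T').
Hypothesis Gsub : <<s G >> `<=` measurable.
Hypothesis mM : measurable_fun setT M.
Local Open Scope ereal_scope.
Hypothesis indep : forall E C, <<s G >> E -> measurable C ->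
  P (E `&` M @^-1` C) = P E * Q C.

(** Independence says that the map from [w] to the pair of [w], seen in the coarser sigma-algebra
    [G], and [M w] has a product law: it suffices to check rectangles. Tonelli then integrates the
    mark with [w] frozen. *)
Lemma integral_indep (F : g_sigma_algebraType G * T' -> \bar R) :
  measurable_fun setT F -> (forall z, 0 <= F z) ->
  \int[P]_w F (w, M w) = \int[P]_w \int[Q]_e F (w, e).
Proof.
move=> mF F0.
pose TG := g_sigma_algebraType G.
pose i : T -> TG := idfun.
have mi : measurable_fun setT i by move=> _ A mA; rewrite setTI; exact: Gsub.
pose i_ : {mfun T >-> TG} := HB.pack i (isMeasurableFun.Build _ _ _ _ _ mi).
pose j : T -> TG * T' := fun w => (w, M w).
have mj : measurable_fun setT j by apply: measurable_fun_pair.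
pose j_ : {mfun T >-> (TG * T')%type} := HB.pack j (isMeasurableFun.Build _ _ _ _ _ mj).
transitivity (\int[distribution P j_]_z F z).
  by rewrite ge0_integral_distribution.
transitivity (\int[distribution P i_ \x Q]_z F z).
  apply: eq_measure_integral => A mA _; symmetry.
  apply: product_measure_unique => // E C mE mC.
rewrite fubini_tonelli1//= ge0_integral_distribution//.
  exact: measurable_fun_fubini_tonelli_F.
by move=> w; apply: integral_ge0.
Qed.

End independent_integral.

Section measurable_integral.
Context {R : realType} d (T : measurableType d).
Local Notation leb := (@lebesgue_measure R).
Local Open Scope ereal_scope.

Lemma measurable_integral_leb (f : T * R -> \bar R) : measurable_fun setT f ->
  (forall z, 0 <= f z) -> measurable_fun setT (fun w => \int[leb]_x f (w, x)).
Proof.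
move=> mf f0.
exact: (@measurable_fun_fubini_tonelli_F _ _ T _ R leb f).
Qed.

End measurable_integral.

Section measurable_integral2.
Context {R : realType} d (T : measurableType d).
Local Notation leb := (@lebesgue_measure R).
Local Open Scope ereal_scope.

Lemma integral_leb2 (f : R * R -> \bar R) : measurable_fun setT f ->
  (forall z, 0 <= f z) -> \int[leb \x leb]_p f p = \int[leb]_x \int[leb]_y f (x, y).
Proof. by move=> mf f0; rewrite fubini_tonelli1. Qed.

Lemma measurable_integral_leb2 (f : T * (R * R) -> \bar R) : measurable_fun setT f ->
  (forall z, 0 <= f z) -> measurable_fun setT (fun w => \int[leb \x leb]_p f (w, p)).
Proof.
move=> mf f0.
rewrite (_ : (fun w => _) = fun w => \int[leb]_x \int[leb]_y f (w, (x, y))); last first.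
  apply/funext => w; apply: (@integral_leb2 (fun p => f (w, p))) => //.
  exact: measurableT_comp.
apply: (@measurable_integral_leb _ _ _ (fun z => \int[leb]_y f (z.1, (z.2, y)))).
  apply: (@measurable_integral_leb _ _ _ (fun z : (T * R) * R => f (z.1.1, (z.1.2, z.2)))) => //.
  apply: (measurableT_comp mf); apply: measurable_fun_pair => /=.
    exact: (measurableT_comp measurable_fst).
  apply: measurable_fun_pair => //.
  exact: (measurableT_comp measurable_snd).
by move=> z; apply: integral_ge0.
Qed.

End measurable_integral2.

(** * The Laplace functional of a conditionally Poisson process *)

Lemma emeasurable_prod {R : realType} d (T : measurableType d) I (s : seq I)
    (f : I -> T -> \bar R) : (forall i, measurable_fun setT (f i)) ->
  measurable_fun setT (fun w => \prod_(i <- s) f i w)%E.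
Proof.
move=> mf; elim: s => [|i s IH].
  by rewrite (_ : (fun _ => _) = cst 1%E)//; apply/funext => w; rewrite big_nil.
rewrite (_ : (fun _ => _) = (fun w => f i w * \prod_(j <- s) f j w)%E).
  exact: emeasurable_funM.
by apply/funext => w; rewrite big_cons.
Qed.

(** Seen as an integral for the counting measure, the series also admits [x = +oo]. *)
Lemma nneseries_mull {R : realType} (x : \bar R) (f : nat -> \bar R) :
  (0 <= x)%E -> (forall n, 0 <= f n)%E ->
  (\sum_(n <oo) (x * f n) = x * \sum_(n <oo) f n)%E.
Proof.
move=> x0 f0; rewrite -!ge0_integral_count//; last by move=> n; rewrite mule_ge0.
by rewrite ge0_integralZl.
Qed.

Section generating_functions.
Context {R : realType} d (T : measurableType d) (P : {measure set T -> \bar R}).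
Local Open Scope ereal_scope.

(** A joint law of counts determines the mixed generating functions. The series are expanded one at
    a time, by induction on the number of factors; [U] and [U'] hold the terms already selected,
    which is why the statement carries them. *)
Lemma integral_prod_nneseries (E : set T) (m : nat) (a : 'I_m -> nat -> R)
    (F F' : 'I_m -> nat -> T -> \bar R) (U U' : T -> \bar R) :
  measurable E -> (forall j n, (0 <= a j n)%R) ->
  (forall j n, measurable_fun setT (F j n)) -> (forall j n w, 0 <= F j n w) ->
  (forall j n, measurable_fun setT (F' j n)) -> (forall j n w, 0 <= F' j n w) ->
  measurable_fun setT U -> (forall w, 0 <= U w) ->
  measurable_fun setT U' -> (forall w, 0 <= U' w) ->
  (forall n : 'I_m -> nat, \int[P]_(w in E) (U w * \prod_(j < m) F j (n j) w) =
                           \int[P]_(w in E) (U' w * \prod_(j < m) F' j (n j) w)) ->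
  \int[P]_(w in E) (U w * \prod_(j < m) \sum_(n <oo) ((a j n)%:E * F j n w)) =
  \int[P]_(w in E) (U' w * \prod_(j < m) \sum_(n <oo) ((a j n)%:E * F' j n w)).
Proof.
move=> mE; elim: m a F F' U U' => [|m IH] a F F' U U' a0 mF F0 mF' F'0 mU U0 mU' U'0 H.
  have := H (fun=> 0%N); under eq_integral do rewrite big_ord0.
  under [in X in _ = X]eq_integral do rewrite big_ord0.
  by move=> H'; under eq_integral do rewrite big_ord0; rewrite H';
    under [in RHS]eq_integral do rewrite big_ord0.
have key V (K : 'I_m.+1 -> nat -> T -> \bar R) :
    (forall j n, measurable_fun setT (K j n)) -> (forall j n w, 0 <= K j n w) ->
    measurable_fun setT V -> (forall w, 0 <= V w) ->
    \int[P]_(w in E) (V w * \prod_(j < m.+1) \sum_(n <oo) ((a j n)%:E * K j n w)) =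
    \sum_(n <oo) ((a ord0 n)%:E * \int[P]_(w in E) ((V w * K ord0 n w) *
      \prod_(j < m) \sum_(n <oo) ((a (lift ord0 j) n)%:E * K (lift ord0 j) n w))).
  move=> mK K0 mV V0.
  have mS j : measurable_fun setT (fun w => \sum_(n <oo) ((a j n)%:E * K j n w)).
    apply: ge0_emeasurable_sum => [n w _ _|n _]; first by rewrite mule_ge0// lee_fin.
    exact: emeasurable_funM.
  have S0 j w : 0 <= \sum_(n <oo) ((a j n)%:E * K j n w).
    by apply: nneseries_ge0 => n _ _; rewrite mule_ge0// lee_fin.
  pose tl w := \prod_(j < m) \sum_(n <oo)
    ((a (lift ord0 j) n)%:E * K (lift ord0 j) n w).
  have mtl : measurable_fun setT tl by apply: emeasurable_prod => j; exact: mS.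
  have tl0 w : 0 <= tl w by apply: prode_ge0 => j _; exact: S0.
  transitivity (\int[P]_(w in E) \sum_(n <oo)
      ((a ord0 n)%:E * ((V w * K ord0 n w) * tl w))).
    apply: eq_integral => w _; rewrite big_ord_recl -/(tl w) muleCA.
    rewrite muleC -nneseries_mull ?mule_ge0//; last first.
      by move=> n; rewrite mule_ge0// lee_fin.
    apply: eq_eseriesr => n _; rewrite [LHS]muleCA; congr (_ * _).
    by rewrite muleAC.
  rewrite integral_nneseries//; last 2 first.
  - move=> n; apply: measurable_funTS; apply: emeasurable_funM => //.
    by apply: emeasurable_funM => //; apply: emeasurable_funM.
  - by move=> n w _; rewrite mule_ge0 ?lee_fin// mule_ge0// mule_ge0.
  apply: eq_eseriesr => n _; rewrite ge0_integralZl_EFin//.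
  - by move=> w _; rewrite mule_ge0// mule_ge0.
  - apply: measurable_funTS; apply: emeasurable_funM => //.
    by apply: emeasurable_funM.
rewrite (key U F mF F0 mU U0) (key U' F' mF' F'0 mU' U'0).
apply: eq_eseriesr => n _; congr (_ * _).
apply: (IH (fun j => a (lift ord0 j)) (fun j => F (lift ord0 j)) (fun j => F' (lift ord0 j))) => //.
- exact: emeasurable_funM.
- by move=> w; rewrite mule_ge0.
- exact: emeasurable_funM.
- by move=> w; rewrite mule_ge0.
- move=> n'.
  have := H (fun i => if unlift ord0 i is Some j then n' j else n).
  under eq_integral do rewrite big_ord_recl unlift_none muleA.
  under [in X in _ = X]eq_integral do rewrite big_ord_recl unlift_none muleA.
  move=> H'.
  transitivity (\int[P]_(w in E) (U w * F ord0 n w * \prod_(i < m)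
       F (lift ord0 i) (if unlift ord0 (lift ord0 i) is Some j then n' j else n) w)).
    apply: eq_integral => w _; congr (_ * _); apply: eq_bigr => i _.
    by rewrite liftK.
  rewrite H'; apply: eq_integral => w _; congr (_ * _); apply: eq_bigr => i _.
  by rewrite liftK.
Qed.

End generating_functions.

Section simple_function_sum.
Context {R : realType} d (X : measurableType d).
Import HBNNSimple.

(** The value 0 is left out because its level set may contain infinitely many points, while the
    power series of [expN_point_count] needs a positive coefficient. *)
Definition nz_values (f : {nnsfun X >-> R}) : seq R :=
  [seq y <- fset_set (range f) | y != 0].

Lemma nz_values_gt0 f y : y \in nz_values f -> 0 < y.
Proof.
rewrite mem_filter => /andP[y0 ys].
have : y \in fset_set (range f) by exact: ys.
rewrite in_fset_set// inE => -[x _ fxy].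
by rewrite lt_neqAle eq_sym y0 -fxy/= fun_ge0.
Qed.

(** Needed for two functions [g]: the identity, on the side of the points, and 1 - exp(-y), on the
    side of the intensity. *)
Lemma sum_nz_values (f : {nnsfun X >-> R}) (g : R -> R) x : g 0 = 0 ->
  g (f x) = \sum_(j < size (nz_values f))
    g (nz_values f)`_j * \1_(f @^-1` [set (nz_values f)`_j]) x.
Proof.
move=> g0; rewrite -(big_mkord xpredT (fun j => g (nz_values f)`_j *
   \1_(f @^-1` [set (nz_values f)`_j]) x)).
rewrite -(big_nth 0 xpredT (fun y => g y * \1_(f @^-1` [set y]) x)).
have [fx0|fx0] := eqVneq (f x) 0.
  rewrite fx0 g0 big_seq big1// => y /nz_values_gt0 y0.
  by rewrite indicE memNset ?mulr0//= fx0 => y0'; move: y0; rewrite -y0' ltxx.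
have fxs : f x \in nz_values f.
  rewrite mem_filter fx0/=.
  have : f x \in fset_set (range f) by rewrite in_fset_set// inE; exists x.
  by [].
rewrite (bigD1_seq (f x))//=; last by rewrite filter_uniq// fset_uniq.
rewrite indicE mem_set// mulr1 big1 ?addr0// => y yfx.
by rewrite indicE memNset ?mulr0//= => fxy; rewrite fxy eqxx in yfx.
Qed.

Lemma trivIset_nz_values (f : {nnsfun X >-> R}) : trivIset setT
  (fun j : 'I_(size (nz_values f)) => f @^-1` [set (nz_values f)`_j]).
Proof.
apply/trivIsetP => i j _ _ ij; apply/seteqP; split => // x [/= -> /eqP].
rewrite nth_uniq//; last by rewrite filter_uniq// fset_uniq.
by move=> /eqP/val_inj/eqP; rewrite (negbTE ij).
Qed.

End simple_function_sum.

Lemma expN_sum {R : realType} (m : nat) (x : 'I_m -> \bar R) : (forall j, 0 <= x j)%E ->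
  expN (\sum_(j < m) x j)%E = (\prod_(j < m) expN (x j))%E.
Proof.
elim: m x => [|m IH] x x0; first by rewrite !big_ord0 expN0.
by rewrite !big_ord_recl expND// ?sume_ge0// IH.
Qed.

Section poisson_functional.
Context {R : realType} d (T : measurableType d) (P : probability T R).
Variable G : set (set T).
Hypothesis Gsub : <<s G >> `<=` measurable.
Variables (tau : nat -> T -> \bar R) (zeta : nat -> T -> R).
Hypothesis mtau : forall i, measurable_fun setT (tau i).
Hypothesis mzeta : forall i, measurable_fun setT (zeta i).
Variable k : T * (R * R) -> R.
Hypothesis mk : measurable_fun setT k.
Hypothesis k0 : forall z, 0 <= k z.
Local Open Scope ereal_scope.
Local Notation leb2 := (@lebesgue_measure R \x @lebesgue_measure R).

Definition point_val (phi : R * R -> \bar R) i w : \bar R :=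
  if tau i w is t%:E then phi (t, zeta i w) else 0.

Definition point_sum phi w := \sum_(i <oo) point_val phi i w.

Definition point_count (A : set (R * R)) w : \bar R :=
  \esum_(i in [set i | exists t : R, tau i w = t%:E /\ A (t, zeta i w)]) 1.

Lemma point_val_ge0 phi i w : (forall p, 0 <= phi p) -> 0 <= point_val phi i w.
Proof. by move=> phi0; rewrite /point_val; case: (tau i w). Qed.

Lemma measurable_point_val phi i : measurable_fun setT phi ->
  measurable_fun setT (point_val phi i).
Proof.
move=> mphi.
rewrite (_ : point_val phi i = fun w => if tau i w \is a fin_num then
  phi (fine (tau i w), zeta i w) else 0); last first.
  by apply/funext => w; rewrite /point_val; case: (tau i w).
apply: measurable_fun_ifT => //.
  apply: (@measurable_fun_bool _ _ _ _ true); rewrite setTI.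
  by rewrite -[X in measurable X]setTI; exact: emeasurable_fin_num.
apply: (measurableT_comp mphi); apply: measurable_fun_pair => //.
by apply: measurableT_comp => //; exact: fine_measurable.
Qed.

Lemma measurable_point_sum phi : measurable_fun setT phi -> (forall p, 0 <= phi p) ->
  measurable_fun setT (point_sum phi).
Proof.
move=> mphi phi0; apply: ge0_emeasurable_sum => [n w _ _|n _].
  exact: point_val_ge0.
exact: measurable_point_val.
Qed.

Lemma point_sum_ge0 phi w : (forall p, 0 <= phi p) -> 0 <= point_sum phi w.
Proof. by move=> phi0; apply: nneseries_ge0 => n _ _; exact: point_val_ge0. Qed.

Lemma point_countE A w : point_count A w = point_sum (fun p => (\1_A p)%:E) w.
Proof.
rewrite /point_count esum_mkcond /point_sum nneseries_esumT; last first.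
  by move=> n; apply: point_val_ge0 => p; rewrite lee_fin.
apply: eq_esum => i _; rewrite /point_val; case: ifPn.
  by rewrite inE => -[t [-> At]]; rewrite indicE mem_set.
rewrite notin_setE => nA; case E : (tau i w) => [t| |]//.
rewrite indicE memNset// => At; apply: nA; by exists t.
Qed.

Lemma point_count_nat A w : point_count A w = +oo \/
  exists n : nat, point_count A w = n%:R%:E.
Proof.
rewrite /point_count; set S := [set i | _].
have [finS|infS] := pselect (finite_set S).
  by right; exists (size (enum_fset (fset_set S))); exact: finite_card_sum.
left; rewrite -(infinite_card_dirac R infS).
by apply: eq_esum => i Si; rewrite /dirac indicE mem_set.
Qed.

Lemma nneseries_single (a : nat -> \bar R) n : (forall i, 0 <= a i) ->
  (forall i, i != n -> a i = 0) -> \sum_(i <oo) a i = a n.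
Proof.
move=> a0 an; rewrite (nneseries_split 0 n.+1)// add0n.
rewrite eseries0 => [|i /= + _]; last by move=> ni; rewrite an// gt_eqF.
rewrite adde0 big_nat_recr//= big_nat big1 ?add0e// => i /andP[_ ni].
by rewrite an// lt_eqF.
Qed.

Lemma point_count_ge0 A w : 0 <= point_count A w.
Proof. exact: esum_ge0. Qed.

Definition indic_count A n w : \bar R := (\1_[set w | point_count A w = n%:R%:E] w)%:E.

(** An infinite count makes both sides 0, again because [c] is positive. *)
Lemma expN_point_count A (c : R) w : (0 < c)%R ->
  expN (c%:E * point_count A w) =
  \sum_(n <oo) ((expR (- c) ^+ n)%:E * indic_count A n w).
Proof.
move=> c0; rewrite /indic_count; have [Ny|[n nE]] := point_count_nat A w.
  rewrite Ny mulry gtr0_sg// mul1e expNy eseries0// => n _ _.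
  by rewrite indicE memNset ?mule0//= Ny.
rewrite (@nneseries_single _ n).
- by rewrite indicE mem_set// mule1 nE -EFinM expNE -expRM_natl; congr (expR _)%:E; ring.
- by move=> i; rewrite mule_ge0 ?lee_fin ?exprn_ge0 ?expR_ge0.
move=> i ni; rewrite indicE memNset ?mule0//= nE => -[] /eqP.
by rewrite eqr_nat eq_sym (negbTE ni).
Qed.


Lemma measurable_point_count A : measurable A -> measurable_fun setT (point_count A).
Proof.
move=> mA; rewrite (_ : point_count A = point_sum (fun p => (\1_A p)%:E)); last first.
  by apply/funext => w; exact: point_countE.
apply: measurable_point_sum => [|p]; last by rewrite lee_fin.
by apply/measurable_EFinP; exact: measurable_indic.
Qed.

Lemma measurable_indic_count A n : measurable A ->
  measurable_fun setT (indic_count A n).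
Proof.
move=> mA; apply/measurable_EFinP/measurable_indic.
rewrite -[X in measurable X]setTI.
exact: (measurable_point_count mA measurableT (emeasurable_set1 _)).
Qed.

Definition intensity_integral (psi : R * R -> \bar R) w : \bar R :=
  \int[leb2]_p (psi p * (k (w, p))%:E).

Let mkw w : measurable_fun setT (fun p => (k (w, p))%:E).
Proof. by apply/measurable_EFinP; exact: measurableT_comp. Qed.

Lemma measurable_intensity_integral psi : measurable_fun setT psi ->
  (forall p, 0 <= psi p) -> measurable_fun setT (intensity_integral psi).
Proof.
move=> mpsi psi0.
apply: (@measurable_integral_leb2 _ _ _ (fun z : T * (R * R) => psi z.2 * (k z)%:E)) => /=.
  apply: emeasurable_funM; last exact/measurable_EFinP.
  exact: (measurableT_comp mpsi).
by move=> z; rewrite mule_ge0// lee_fin.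
Qed.

Lemma intensity_integral_ge0 psi w : (forall p, 0 <= psi p) ->
  0 <= intensity_integral psi w.
Proof. by move=> psi0; apply: integral_ge0 => p _; rewrite mule_ge0// lee_fin. Qed.

Hypothesis cpoisson : conditionally_poisson P <<s G>> point_count
  (fun A w => \int[leb2]_(p in A) (k (w, p))%:E).

Import HBNNSimple.

(** Over the disjoint level sets A_j of [phi], with values s_j, the left integrand is the product of
    the powers of exp(-s_j) with exponents N(A_j). Expanding it in the values of the counts,
    inserting their joint conditional law and resumming each Poisson series gives the right side. *)
Let laplace_nnsfun (phi : {nnsfun (R * R)%type >-> R}) E : <<s G >> E ->
  \int[P]_(w in E) expN (point_sum (EFin \o phi) w) =
  \int[P]_(w in E) expN (intensity_integral (fun p => 1 - expN (phi p)%:E) w).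
Proof.
move=> GE.
set s := nz_values phi; set m := size s.
pose A (j : 'I_m) : set (R * R) := phi @^-1` [set s`_j].
pose a (j : 'I_m) (n : nat) : R := (expR (- s`_j) ^+ n)%R.
have s0 (j : 'I_m) : (0 < s`_j)%R by apply: (@nz_values_gt0 _ _ _ phi); exact: mem_nth.
have s0' (j : 'I_m) : 0 <= (s`_j)%:E by rewrite lee_fin ltW.
have mA j : measurable (A j) by apply: (measurable_funPTI phi).
pose Lam j w := \int[leb2]_(p in A j) (k (w, p))%:E.
have Lam0 j w : 0 <= Lam j w by apply: integral_ge0 => p _; rewrite lee_fin.
have LamE j w : Lam j w = intensity_integral (fun p => (\1_(A j) p)%:E) w.
  rewrite /Lam integral_mkcond; apply: eq_integral => p _.
  by rewrite patchE indicE; case: ifPn => _; rewrite ?mul1e ?mul0e.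
have mLam j : measurable_fun setT (Lam j).
  rewrite (_ : Lam j = intensity_integral (fun p => (\1_(A j) p)%:E)); last first.
    by apply/funext => w.
  apply: measurable_intensity_integral => [|p]; last by rewrite lee_fin.
  by apply/measurable_EFinP; exact: measurable_indic.
pose F j n := indic_count (A j) n.
pose F' j n w := (poisson_mass (Lam j w) n)%:E.
have mF' j n : measurable_fun setT (F' j n).
  apply/measurable_EFinP.
  exact: (measurableT_comp (measurable_poisson_mass n)).
have F'0 j n w : 0 <= F' j n w by rewrite lee_fin poisson_mass_ge0.
have mF j n : measurable_fun setT (F j n) by exact: measurable_indic_count.
have F0 j n w : 0 <= F j n w by rewrite lee_fin.
have mE : measurable E by exact: Gsub.
transitivity (\int[P]_(w in E) (cst 1 w * \prod_(j < m) \sum_(n <oo) ((a j n)%:E * F j n w))).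
  apply: eq_integral => w _; rewrite mul1e.
  under eq_bigr do rewrite -expN_point_count//.
  rewrite -expN_sum; last by move=> j; rewrite mule_ge0// point_count_ge0.
  congr expN.
  under eq_bigr => j _.
    rewrite point_countE -nneseries_mull//; last first.
      by move=> i; apply: point_val_ge0 => p; rewrite lee_fin.
    over.
  rewrite -nneseries_sum; last first.
    move=> j i _; rewrite mule_ge0//.
    by apply: point_val_ge0 => p; rewrite lee_fin.
  apply: eq_eseriesr => i _; rewrite /point_val; case: (tau i w) => [t| |].
  - rewrite /= (@sum_nz_values _ _ _ phi id)// -sumEFin.
    by apply: eq_bigr => j _; rewrite EFinM.
  - by rewrite big1// => j _; rewrite mule0.
  - by rewrite big1// => j _; rewrite mule0.
rewrite (@integral_prod_nneseries _ _ _ P E m a F F' (cst 1) (cst 1))//.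
- apply: eq_integral => w _; rewrite mul1e.
  under eq_bigr => j _.
    under eq_eseriesr do rewrite -EFinM.
    rewrite nneseries_poisson_mass//; last first.
      by rewrite expR_ge0/= expR_lt1 oppr_lt0.
    over.
  rewrite -expN_sum; last first.
    by move=> j; rewrite mule_ge0// lee_fin subr_ge0 expR_le1 oppr_le0 ltW.
  congr expN.
  have q1 (j : 'I_m) : (0 <= 1 - expR (- s`_j))%R.
    by rewrite subr_ge0 expR_le1 oppr_le0 ltW.
  have mindk j : measurable_fun setT (fun p => (\1_(A j) p)%:E * (k (w, p))%:E).
    by apply: emeasurable_funM => //; apply/measurable_EFinP; exact: measurable_indic.
  transitivity (\sum_(j < m) \int[leb2]_p
      ((1 - expR (- s`_j))%:E * ((\1_(A j) p)%:E * (k (w, p))%:E))).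
    apply: eq_bigr => j _; rewrite ge0_integralZl_EFin//.
    - by rewrite muleC LamE.
    - by move=> p _; rewrite mule_ge0// lee_fin.
    - exact: mindk.
  transitivity (\int[leb2]_p \sum_(j < m)
      ((1 - expR (- s`_j))%:E * ((\1_(A j) p)%:E * (k (w, p))%:E))).
    apply/esym; apply: ge0_integral_sum => //.
    + by move=> j; apply: emeasurable_funM => //; exact: mindk.
    + by move=> j p _; rewrite !mule_ge0// lee_fin.
  apply: eq_integral => p _; rewrite expNE -EFinB.
  have q0 : (1 - expR (- 0) = 0 :> R)%R by rewrite oppr0 expR0 subrr.
  have -> : (1 - expR (- phi p) =
      \sum_(j < m) (1 - expR (- s`_j)) * \1_(A j) p)%R.
    exact: (@sum_nz_values _ _ _ phi (fun y => 1 - expR (- y))%R p q0).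
  rewrite -EFinM mulr_suml -sumEFin.
  by apply: eq_bigr => j _; rewrite -!EFinM mulrA.
- by move=> j n; rewrite exprn_ge0 ?expR_ge0.
move=> n; under eq_integral do rewrite mul1e.
under [in RHS]eq_integral do rewrite mul1e prodEFin.
rewrite -cpoisson//; last exact: trivIset_nz_values.
set B := [set w | _].
have BE w : \1_B w = (\prod_(j < m) \1_[set w | point_count (A j) w = (n j)%:R%:E] w)%R :> R.
  rewrite indicE; have [wB|wB] := boolP (w \in B).
    by rewrite big1// => j _; rewrite indicE mem_set//=; move: wB; rewrite inE; exact.
  move: wB; rewrite notin_setE => /existsNP[j wj].
  by rewrite (bigD1 j)//= indicE memNset ?mul0r.
have mB : measurable B.
  apply/(@measurable_indicP _ _ R); rewrite (funext BE).
  apply: measurable_prod => j _; apply/measurable_EFinP.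
  exact: (measurable_indic_count (n j) (mA j)).
rewrite setIC -integral_indic//.
by apply: eq_integral => w _; rewrite BE prodEFin.
Qed.

Lemma point_sum_cvg (psi_ : (R * R -> \bar R)^nat) (psi : R * R -> \bar R) w :
  (forall n p, 0 <= psi_ n p) -> (forall p, nondecreasing_seq (psi_ ^~ p)) ->
  (forall p, psi_ n p @[n --> \oo] --> psi p) ->
  point_sum (psi_ n) w @[n --> \oo] --> point_sum psi w.
Proof.
move=> psi0 ndpsi psicvg.
have psi'0 p : 0 <= psi p.
  by apply: (cvge_to_ge (psicvg p)); apply: nearW => n; exact: psi0.
have cE phi : (forall p, 0 <= phi p) ->
    point_sum phi w = \int[counting]_i point_val phi i w.
  by move=> phi0; rewrite ge0_integral_count// => i; exact: point_val_ge0.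
under eq_fun do rewrite cE//.
rewrite cE//.
have -> : \int[counting]_i point_val psi i w =
    \int[counting]_i limn (fun n => point_val (psi_ n) i w).
  apply: eq_integral => i _; apply/esym/cvg_lim => //.
  rewrite /point_val; case: (tau i w) => [t| |]; [exact: psicvg|exact: cvg_cst|exact: cvg_cst].
apply: cvg_monotone_convergence => //.
- by move=> n i _; exact: point_val_ge0.
- move=> i _ m n mn; rewrite /point_val; case: (tau i w) => [t| |]//.
  exact: ndpsi.
Qed.

Lemma intensity_integral_cvg (psi_ : (R * R -> \bar R)^nat) (psi : R * R -> \bar R) w :
  (forall n, measurable_fun setT (psi_ n)) ->
  (forall n p, 0 <= psi_ n p) -> (forall p, nondecreasing_seq (psi_ ^~ p)) ->
  (forall p, psi_ n p @[n --> \oo] --> psi p) ->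
  intensity_integral (psi_ n) w @[n --> \oo] --> intensity_integral psi w.
Proof.
move=> mpsi psi0 ndpsi psicvg; rewrite /intensity_integral.
have -> : \int[leb2]_p (psi p * (k (w, p))%:E) =
    \int[leb2]_p limn (fun n => psi_ n p * (k (w, p))%:E).
  apply: eq_integral => p _; apply/esym/cvg_lim => //.
  by apply: cvgeZr => //; exact: psicvg.
apply: cvg_monotone_convergence => //.
- by move=> n; apply: emeasurable_funM; [exact: mpsi|exact: mkw].
- by move=> n p _; rewrite mule_ge0// lee_fin.
- by move=> p _ m n mn; rewrite lee_wpmul2r ?lee_fin//; exact: ndpsi.
Qed.

(** Simple functions increase to [phi]; the sums over points and the intensity integrals converge
    monotonically, and their exponentials stay in [0,1], so the limit passes under [P] on each set
    of [G]. [integral_sub_sigmaM] then admits the multiplier [X]. The value +oo of [phi] is allowed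
    and stands for weight 0. *)
Lemma poisson_functional phi (X : T -> \bar R) :
  measurable_fun setT phi -> (forall p, 0 <= phi p) ->
  measurable_fun setT (X : g_sigma_algebraType G -> _) -> (forall w, 0 <= X w) ->
  \int[P]_w (X w * expN (point_sum phi w)) =
  \int[P]_w (X w * expN (intensity_integral (fun p => 1 - expN (phi p)) w)).
Proof.
move=> mphi phi0 mX X0.
have c01 p := oneB_expN01 (phi0 p).
have c0 p : 0 <= 1 - expN (phi p) by have /andP[] := c01 p.
have mc : measurable_fun setT (fun p => 1 - expN (phi p)).
  by apply: emeasurable_funB => //; exact: measurable_expN.
apply: (integral_sub_sigmaM Gsub) => //.
- by apply: measurable_expN; exact: measurable_point_sum.
- by move=> w; rewrite expN_ge0 expN_le1// point_sum_ge0.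
- by apply: measurable_expN; exact: measurable_intensity_integral.
- by move=> w; rewrite expN_ge0 expN_le1// intensity_integral_ge0.
move=> E GE.
have mE : measurable E by exact: Gsub.
pose f := nnsfun_approx measurableT mphi.
have f0 n p : 0 <= (f n p)%:E by rewrite lee_fin.
have ndf p : nondecreasing_seq (fun n => (f n p)%:E).
  by move=> m n mn; rewrite lee_fin; move/lefP: (nd_nnsfun_approx measurableT mphi mn).
have fcvg p : (f n p)%:E @[n --> \oo] --> phi p by exact: cvg_nnsfun_approx.
have mf n : measurable_fun setT (fun p => (f n p)%:E) by exact/measurable_EFinP.
have fc01 n p := oneB_expN01 (f0 n p).
have fc0 n p : 0 <= 1 - expN (f n p)%:E by have /andP[] := fc01 n p.
have mfc n : measurable_fun setT (fun p => 1 - expN (f n p)%:E).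
  by apply: emeasurable_funB => //; exact: measurable_expN.
have lhs : \int[P]_(w in E) expN (point_sum (EFin \o f n) w) @[n --> \oo] -->
    \int[P]_(w in E) expN (point_sum phi w).
  apply: cvg_integral_le1 => //.
  - by move=> n; apply: measurable_expN; exact: (measurable_point_sum (mf n) (f0 n)).
  - by move=> n w; rewrite expN_ge0 expN_le1//; exact: (point_sum_ge0 _ (f0 n)).
  - move=> w; apply: expN_cvg => [n|]; first exact: (point_sum_ge0 _ (f0 n)).
    exact: point_sum_cvg.
have rhs : \int[P]_(w in E) expN (intensity_integral (fun p => 1 - expN (f n p)%:E) w)
     @[n --> \oo] -->
    \int[P]_(w in E) expN (intensity_integral (fun p => 1 - expN (phi p)) w).
  apply: cvg_integral_le1 => //.
  - by move=> n; apply: measurable_expN; exact: measurable_intensity_integral.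
  - by move=> n w; rewrite expN_ge0 expN_le1// intensity_integral_ge0.
  - move=> w; apply: expN_cvg => [n|]; first exact: intensity_integral_ge0.
    apply: intensity_integral_cvg => //.
    + by move=> p m n mn; rewrite leeB// le_expN//; exact: ndf.
    + move=> p; apply: cvgeB; [|exact: cvg_cst|].
      * by rewrite fin_num_adde_defr.
      * exact: (expN_cvg (f0 ^~ p)).
move: lhs; under eq_fun do rewrite laplace_nnsfun//.
by move=> lhs; exact: cvg_unique lhs rhs.
Qed.

End poisson_functional.

(** * Lifetimes *)

Section grid.
Context {R : realType}.
Local Open Scope ereal_scope.

(** The approximation comes from above because P(J > r) and the indicator of r < a are
    right-continuous in r. It takes countably many values, so that a law known at each fixed r can
    be applied at a random one. *)
Definition grid_above (k : nat) (r : R) : R :=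
  ((Num.truncn (r * k.+1%:R)).+1%:R / k.+1%:R)%R.

Definition grid_cell (k j : nat) : set R :=
  [set r | (j%:R <= r * k.+1%:R < j.+1%:R)%R].

Lemma measurable_grid_cell k j : measurable (grid_cell k j).
Proof.
rewrite (_ : grid_cell k j = `[(j%:R / k.+1%:R)%R, (j.+1%:R / k.+1%:R)%R[%classic)//.
by apply/seteqP; split => r /=; rewrite in_itv/= ler_pdivrMr// ltr_pdivlMr.
Qed.

Lemma grid_cellE k j r : (0 <= r)%R -> grid_cell k j r <-> Num.truncn (r * k.+1%:R) = j.
Proof.
move=> r0; have rk0 : (0 <= r * k.+1%:R)%R by rewrite mulr_ge0.
have := truncn_itv rk0 => tr; split => [rj|<-//].
by apply/eqP; rewrite truncn_eq.
Qed.

Lemma grid_above_gt k r : (0 <= r)%R -> (r < grid_above k r)%R.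
Proof.
move=> r0; rewrite /grid_above ltr_pdivlMr//.
by have /andP[] := truncn_itv (mulr_ge0 r0 (ler0n _ k.+1)).
Qed.

Lemma grid_above_le k r : (0 <= r)%R -> (grid_above k r <= r + k.+1%:R^-1)%R.
Proof.
move=> r0; rewrite /grid_above ler_pdivrMr// mulrDl mulVf// -natr1 lerD2r.
by have /andP[] := truncn_itv (mulr_ge0 r0 (ler0n _ k.+1)).
Qed.

Lemma cvg_grid_above r : (0 <= r)%R -> grid_above k r @[k --> \oo] --> r.
Proof.
move=> r0; apply: (@squeeze_cvgr _ _ _ _ (cst r) (fun k => r + k.+1%:R^-1)%R).
- by apply: nearW => k; rewrite /= ltW ?grid_above_gt//= grid_above_le.
- exact: cvg_cst.
- rewrite -[X in _ --> X]addr0; apply: cvgD; first exact: cvg_cst.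
  exact: cvg_harmonic.
Qed.

Lemma nneseries_grid (F : R -> \bar R) k r : (forall r, 0 <= F r) -> (0 <= r)%R ->
  \sum_(j <oo) ((\1_(grid_cell k j) r)%:E * F (j.+1%:R / k.+1%:R)%R) =
  F (grid_above k r).
Proof.
move=> F0 r0; rewrite (@nneseries_single _ _ (Num.truncn (r * k.+1%:R))).
- by rewrite indicE mem_set ?mul1e//; exact/grid_cellE.
- by move=> j; rewrite mule_ge0// lee_fin.
- move=> j /eqP jr; rewrite indicE memNset ?mul0e// => /grid_cellE rj.
  by apply: jr; rewrite rj.
Qed.

Lemma cvg_indic_grid_above (a : \bar R) (r : R) : (0 <= r)%R ->
  (\1_[set x : R | (x%:E < a)%E] (grid_above k r))%:E @[k --> \oo] -->
  (\1_[set x : R | (x%:E < a)%E] r : R)%:E.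
Proof.
move=> r0; have [ra|ar] := ltP r%:E a.
  rewrite (_ : \1__ r = 1%R); last by rewrite indicE mem_set.
  apply: cvg_near_cst; case: a ra => [a ra|_|//]; last first.
    by apply: nearW => k; rewrite indicE mem_set//= ltry.
  near=> k; rewrite indicE mem_set//= lte_fin; near: k.
  by apply: (cvgr_lt _ (cvg_grid_above r0)); rewrite -lte_fin.
rewrite (_ : \1__ r = 0%R); last by rewrite indicE memNset//=; apply/negP; rewrite -leNgt.
under eq_fun => k.
  rewrite indicE memNset/=; last first.
    by apply/negP; rewrite -leNgt (le_trans ar)// lee_fin ltW// grid_above_gt.
  over.
exact: cvg_cst.
Unshelve. all: by end_near. Qed.

End grid.

Section survival.
Context {R : realType} {dJ : measure_display} {OJ : measurableType dJ}.
Variables (PJ : probability OJ R) (J : R -> OJ -> R).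
Hypothesis J_meas : forall x : R, x \in `[0, 1] -> measurable_fun setT (J x).
Hypothesis J_survival_meas : forall r : R, 0 <= r ->
  measurable_fun (`[0, 1] : set R) (fun x => survival PJ J x r).
Local Open Scope ereal_scope.

Let mJr x r : x \in `[0%R, 1%R] -> measurable [set e | (r < J x e)%R].
Proof.
move=> x01; rewrite -[X in measurable X]setTI.
have -> : [set e | (r < J x e)%R] = J x @^-1` `]r, +oo[.
  by apply/seteqP; split => e /=; rewrite in_itv/= andbT.
by apply: J_meas => //; exact: measurable_itv.
Qed.

Lemma survivalE x r : x \in `[0%R, 1%R] ->
  (survival PJ J x r)%:E = \int[PJ]_e (\1_[set e | (r < J x e)%R] e)%:E.
Proof.
move=> x01; rewrite integral_indic ?setIT//; last exact: mJr.
by rewrite /survival fineK// fin_num_measure//; exact: mJr.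
Qed.

Lemma survival01 x r : x \in `[0%R, 1%R] -> (0 <= survival PJ J x r <= 1)%R.
Proof.
move=> x01; rewrite -!lee_fin survivalE//; apply: integral_le1.
  by apply/measurable_EFinP/measurable_indic; exact: mJr.
by move=> e; rewrite !lee_fin indicE; case: (_ \in _); rewrite ?ler01 ?lexx.
Qed.

Lemma survival_cvg x r : x \in `[0%R, 1%R] -> (0 <= r)%R ->
  (survival PJ J x (grid_above k r))%:E @[k --> \oo] --> (survival PJ J x r)%:E.
Proof.
move=> x01 r0; rewrite survivalE//; under eq_fun do rewrite survivalE//.
apply: cvg_integral_le1 => //.
- by move=> n; apply/measurable_EFinP/measurable_indic; exact: mJr.
- by move=> n w; rewrite !lee_fin indicE; case: (_ \in _); rewrite ?ler01 ?lexx.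
move=> e.
have E x0 : (\1_[set e | (x0 < J x e)%R] e = \1_[set r : R | (r%:E < (J x e)%:E)%E] x0 :> R)%R.
  by rewrite !indicE; congr (_%:R); apply/idP/idP; rewrite !inE/= lte_fin.
by rewrite E; under eq_fun do rewrite E; exact: cvg_indic_grid_above.
Qed.

(** The default 0 at negative [p.2] matters: with [p.2] equal to u - s, it gives an event born after
    u the weight 1. *)
Definition survival_ext (p : R * R) : R :=
  if (p.1 \in `[0%R, 1%R]) && (0 <= p.2)%R then survival PJ J p.1 p.2 else 0%R.

Lemma survival_ext01 p : (0 <= survival_ext p <= 1)%R.
Proof.
rewrite /survival_ext; case: ifPn => [/andP[? _]|_]; last by rewrite lexx ler01.
exact: survival01.
Qed.

(* Measurability in x at each r becomes joint, as survival is right-continuous in r. *)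
Lemma measurable_survival_ext : measurable_fun setT survival_ext.
Proof.
pose F k (p : R * R) : \bar R :=
  \sum_(j <oo) ((\1_(grid_cell k j) p.2)%:E * (survival_ext (p.1, (j.+1%:R / k.+1%:R)%R))%:E).
pose G k (p : R * R) : \bar R := if (0 <= p.2)%R then F k p else 0.
have ext0 p : 0 <= (survival_ext p)%:E by rewrite lee_fin; have /andP[] := survival_ext01 p.
have mext r : (0 <= r)%R -> measurable_fun setT (fun x => survival_ext (x, r)).
  move=> r0.
  rewrite (_ : (fun x => _) = (fun x => survival PJ J x r) \_ `[0%R, 1%R]%classic).
    by apply/(measurable_restrictT _ _).1 => //; exact: J_survival_meas.
  apply/funext => x; rewrite /survival_ext patchE/= r0 andbT.
  by congr (if _ then _ else _); rewrite mem_setE.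
have m0 : measurable_fun setT (fun p : R * R => (0 <= p.2)%R).
  by apply: measurable_fun_ler.
have mF k : measurable_fun setT (F k).
  apply: ge0_emeasurable_sum => [j p _ _|j _]; first by rewrite mule_ge0// lee_fin.
  apply: emeasurable_funM; apply/measurable_EFinP.
    have mi := @measurable_indic _ _ R setT _ (measurable_grid_cell k j).
    exact: (measurableT_comp (mi R) measurable_snd).
  have mj := mext (j.+1%:R / k.+1%:R)%R (divr_ge0 (ler0n _ _) (ler0n _ _)).
  exact: (measurableT_comp mj measurable_fst).
have mG k : measurable_fun setT (G k).
  by apply: measurable_fun_ifT => //; apply: measurable_cst.
apply/measurable_EFinP; apply: (emeasurable_fun_cvg G) => // -[x r] _.
rewrite /G/=; have [r0|r0] := leP 0%R r; last first.
  by rewrite /survival_ext/= leNgt r0 andbF/=; exact: cvg_cst.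
under eq_fun do rewrite /F (nneseries_grid (F := fun r => (survival_ext (x, r))%:E))//.
rewrite /survival_ext/=; case: (boolP (x \in _)) => [x01|_]/=; last first.
  exact: cvg_cst.
rewrite r0; under eq_fun do rewrite (ltW (le_lt_trans r0 (grid_above_gt _ r0))).
exact: survival_cvg.
Qed.

End survival.

(** * Integrating out one lifetime *)

Section life_factor.
Context {R : realType} d (T : measurableType d) (P : probability T R).
Variable G : set (set T).
Hypothesis Gsub : <<s G >> `<=` measurable.
Context {dJ : measure_display} {OJ : measurableType dJ}.
Variables (PJ : probability OJ R) (J : R -> OJ -> R).
Hypothesis J_meas : forall x : R, x \in `[0, 1] -> measurable_fun setT (J x).
Hypothesis J_survival_meas : forall r : R, 0 <= r ->
  measurable_fun (`[0, 1] : set R) (fun x => survival PJ J x r).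
Variables (birth life : T -> \bar R) (loc : T -> R).
Hypothesis mbirth : measurable_fun setT (birth : g_sigma_algebraType G -> \bar R).
Hypothesis mloc : measurable_fun setT (loc : g_sigma_algebraType G -> R).
Hypothesis mlife : measurable_fun setT life.
Hypothesis birth_ge0 : forall w, (0 <= birth w)%E.
Hypothesis loc01 : forall w, loc w \in `[0, 1].
Hypothesis life_law : forall E r, <<s G >> E -> 0 <= r ->
  (P (E `&` [set w | r%:E < life w]) = \int[P]_(w in E) (survival PJ J (loc w) r)%:E)%E.
Variable u : R.
Local Open Scope ereal_scope.

(** The time left until the horizon. It is only used under the indicator of [D], where the birth
    time is finite. *)
Let rho w := (u - fine (birth w))%R.
Let D := [set w | birth w <= u%:E].
Let ext := survival_ext PJ J.

Let rho_ge0 w : D w -> (0 <= rho w)%R.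
Proof.
rewrite /D /rho/= subr_ge0 => Dw.
have := birth_ge0 w; case: (birth w) Dw => //= r; by rewrite lee_fin.
Qed.

Let mrhoG : measurable_fun setT (rho : g_sigma_algebraType G -> R).
Proof.
by apply: measurable_funB => //; apply: measurableT_comp => //; exact: fine_measurable.
Qed.

Let GD : <<s G >> D.
Proof.
rewrite -[X in <<s _ >> X]setTI.
have -> : D = birth @^-1` `]-oo, u%:E].
  by apply/seteqP; split => w; rewrite /= in_itv.
by apply: mbirth => //; exact: emeasurable_itv.
Qed.

Let cellD k j := D `&` rho @^-1` grid_cell k j.

Let G_cellD k j : <<s G >> (cellD k j).
Proof.
have H : (G.-sigma).-measurable (D : set (g_sigma_algebraType G)) by exact: GD.
apply: (measurableI _ _ H); rewrite -[X in _ X]setTI.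
by apply: mrhoG => //; exact: measurable_grid_cell.
Qed.

Let gridE (H : T -> R -> \bar R) k w : (forall w x, 0 <= H w x) ->
  (\1_D w)%:E * H w (grid_above k (rho w)) =
  \sum_(j <oo) ((\1_(cellD k j) w)%:E * H w (j.+1%:R / k.+1%:R)%R).
Proof.
move=> H0; have [wD|wD] := boolP (w \in D).
  rewrite indicE wD mul1e -(nneseries_grid (F := H w))//; last by apply: rho_ge0; rewrite inE in wD.
  apply: eq_eseriesr => j _; congr (_%:E * _); rewrite /cellD !indicE; congr (_%:R).
  by rewrite in_setI wD.
rewrite indicE (negbTE wD) mul0e eseries0// => j _ _.
by rewrite /cellD indicE in_setI (negbTE wD) mul0e.
Qed.

Let mgrid (H : T -> R -> \bar R) k : (forall w x, 0 <= H w x) ->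
  (forall x, (0 <= x)%R -> measurable_fun setT (H ^~ x)) ->
  measurable_fun setT (fun w => (\1_D w)%:E * H w (grid_above k (rho w))).
Proof.
move=> H0 mH; rewrite (_ : (fun w => _) = fun w =>
  \sum_(j <oo) ((\1_(cellD k j) w)%:E * H w (j.+1%:R / k.+1%:R)%R)).
  apply: ge0_emeasurable_sum => [j w _ _|j _]; first by rewrite mule_ge0// lee_fin.
  apply: emeasurable_funM; last by apply: mH; rewrite divr_ge0.
  apply/measurable_EFinP/measurable_indic; exact: Gsub.
by apply/funext => w; exact: gridE.
Qed.

Let integral_grid (H : T -> R -> \bar R) k E : <<s G >> E -> (forall w x, 0 <= H w x) ->
  (forall x, (0 <= x)%R -> measurable_fun setT (H ^~ x)) ->
  \int[P]_(w in E) ((\1_D w)%:E * H w (grid_above k (rho w))) =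
  \sum_(j <oo) \int[P]_(w in E `&` cellD k j) H w (j.+1%:R / k.+1%:R)%R.
Proof.
move=> GE H0 mH; under eq_integral do rewrite gridE//.
rewrite integral_nneseries//.
- apply: eq_eseriesr => j _; rewrite [in RHS]integral_mkcondr.
  apply: eq_integral => w _; rewrite patchE indicE.
  by case: ifPn => _; rewrite ?mul1e ?mul0e.
- exact: Gsub.
- move=> j; apply: measurable_funTS.
  apply: emeasurable_funM; last by apply: mH; rewrite divr_ge0.
  apply/measurable_EFinP/measurable_indic; exact: Gsub.
- by move=> j w _; rewrite mule_ge0// lee_fin.
Qed.

Let ind w (x : R) : \bar R := (\1_[set x : R | (x%:E < life w)%E] x)%:E.
Let ext_loc w (x : R) : \bar R := (ext (loc w, x))%:E.

Let mlt x : measurable [set w | x%:E < life w].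
Proof. by rewrite -[X in measurable X]setTI; exact: emeasurable_fun_o_infty. Qed.

Let indE x w : ind w x = (\1_[set w | (x%:E < life w)%E] w)%:E.
Proof. by rewrite /ind !indicE; congr (_%:R%:E); apply/idP/idP; rewrite !inE. Qed.

Let mind x : measurable_fun setT (ind ^~ x).
Proof.
rewrite (_ : ind ^~ x = fun w => (\1_[set w | (x%:E < life w)%E] w)%:E).
  by apply/measurable_EFinP/measurable_indic.
by apply/funext => w; exact: indE.
Qed.

Let mext_loc x : measurable_fun setT (ext_loc ^~ x).
Proof.
apply/measurable_EFinP; apply: (measurableT_comp (measurable_survival_ext J_meas J_survival_meas)).
apply: measurable_fun_pair => //; exact: (measurable_fun_sub_sigma Gsub mloc).
Qed.

Let ext_loc01 x w : 0 <= ext_loc w x <= 1.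
Proof. by rewrite /ext_loc !lee_fin; exact: survival_ext01. Qed.

Let ind01 x w : 0 <= ind w x <= 1.
Proof. by rewrite /ind !lee_fin indicE; case: (_ \in _); rewrite ?lexx ler01. Qed.

Let indD01 (H : T -> R -> \bar R) w x : (0 <= H w x <= 1) ->
  0 <= (\1_D w)%:E * H w x <= 1.
Proof.
by move=> H01; rewrite indicE; case: (_ \in _); rewrite ?mul1e// mul0e lexx lee01.
Qed.

(** The law of the lifetime is given at deterministic times, whereas the time left is random, though
    measurable for [G]. On each cell of the grid the time left is replaced by a constant, where
    [life_law] applies; the mesh then tends to 0. *)
Lemma life_factor_set E : <<s G >> E ->
  \int[P]_(w in E) ((\1_D w)%:E * ind w (rho w)) =
  \int[P]_(w in E) ((\1_D w)%:E * ext_loc w (rho w)).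
Proof.
move=> GE; have mE : measurable E by exact: Gsub.
have ind0 w x : 0 <= ind w x by have /andP[] := ind01 x w.
have ext0 w x : 0 <= ext_loc w x by have /andP[] := ext_loc01 x w.
have step k : \int[P]_(w in E) ((\1_D w)%:E * ind w (grid_above k (rho w))) =
    \int[P]_(w in E) ((\1_D w)%:E * ext_loc w (grid_above k (rho w))).
  rewrite (integral_grid k GE ind0 (fun x _ => mind x)).
  rewrite (integral_grid k GE ext0 (fun x _ => mext_loc x)).
  apply: eq_eseriesr => j _.
  set x := (_ / _)%R; have x0 : (0 <= x)%R by rewrite divr_ge0.
  have GEj : <<s G >> (E `&` cellD k j).
    have H : (G.-sigma).-measurable (E : set (g_sigma_algebraType G)) by [].
    exact: (measurableI _ _ H (G_cellD k j)).
  under eq_integral do rewrite indE.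
  rewrite integral_indic//; last exact: Gsub.
  transitivity (\int[P]_(w in E `&` cellD k j) (survival PJ J (loc w) x)%:E).
    by rewrite -(life_law GEj x0) (setIC _ [set w | x%:E < life w]).
  apply: eq_integral => w _.
  by rewrite /ext_loc /ext /survival_ext/= loc01 x0.
have lhs : \int[P]_(w in E) ((\1_D w)%:E * ind w (grid_above k (rho w))) @[k --> \oo]
    --> \int[P]_(w in E) ((\1_D w)%:E * ind w (rho w)).
  apply: cvg_integral_le1 => //.
  - by move=> k; exact: mgrid.
  - by move=> k w; apply: indD01.
  - move=> w; have [wD|wD] := boolP (w \in D); rewrite indicE ?wD ?(negbTE wD).
      rewrite mul1e; under eq_fun do rewrite mul1e.
      by apply: cvg_indic_grid_above; apply: rho_ge0; rewrite inE in wD.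
    by rewrite mul0e; under eq_fun do rewrite mul0e; exact: cvg_cst.
have rhs : \int[P]_(w in E) ((\1_D w)%:E * ext_loc w (grid_above k (rho w))) @[k --> \oo]
    --> \int[P]_(w in E) ((\1_D w)%:E * ext_loc w (rho w)).
  apply: cvg_integral_le1 => //.
  - by move=> k; exact: mgrid.
  - by move=> k w; apply: indD01.
  - move=> w; have [wD|wD] := boolP (w \in D); rewrite indicE ?wD ?(negbTE wD).
      have r0 : (0 <= rho w)%R by apply: rho_ge0; rewrite inE in wD.
      rewrite mul1e; under eq_fun do rewrite mul1e.
      rewrite /ext_loc /ext /survival_ext/= loc01 r0.
      under eq_fun do rewrite (ltW (le_lt_trans r0 (grid_above_gt _ r0))).
      exact: survival_cvg.
    by rewrite mul0e; under eq_fun do rewrite mul0e; exact: cvg_cst.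
move: lhs; under eq_fun do rewrite step.
by move=> lhs; exact: cvg_unique lhs rhs.
Qed.

Variable f : R -> R.
Hypothesis mf : measurable_fun setT f.
Hypothesis f_ge0 : forall x, (0 <= f x)%R.

Definition life_cost w : \bar R :=
  if (birth w <= u%:E) && (u%:E < birth w + life w) then (f (loc w))%:E else 0.

(** This is [gamma] with the time u - s left, written as 1 minus the expected loss so that it equals
    1 after the horizon. *)
Definition life_weight (p : R * R) : \bar R :=
  (1 - ext (p.2, u - p.1) * (1 - expR (- f p.2)))%:E.

Let c (w : T) : \bar R := (1 - expR (- f (loc w)))%:E.

Let c01 w : 0 <= c w <= 1.
Proof.
rewrite /c !lee_fin subr_ge0 expR_le1 oppr_le0 f_ge0/= lerBlDl lerDr.
exact: expR_ge0.
Qed.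

Let Y w := (\1_D w)%:E * ind w (rho w).
Let Y' w := (\1_D w)%:E * ext_loc w (rho w).
Let weight w : \bar R := if birth w is s%:E then life_weight (s, loc w) else 1.

Let memD w : (w \in D) = (birth w <= u%:E).
Proof. by apply/idP/idP; rewrite /D inE. Qed.

Let birth_fin w : birth w <= u%:E -> birth w = (fine (birth w))%:E.
Proof.
move=> bu; rewrite fineK// ge0_fin_numE//; apply: le_lt_trans bu _; exact: ltry.
Qed.

Let costE w : expN (life_cost w) + Y w * c w = 1.
Proof.
rewrite /life_cost /Y /ind !indicE memD.
have -> : (rho w \in [set x : R | (x%:E < life w)%E]) = ((rho w)%:E < life w).
  by apply/idP/idP; rewrite inE.
have [bu|bu]/= := leP (birth w) u%:E; last by rewrite !mul0e expN0 adde0.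
rewrite -lteBlDl; last by rewrite birth_fin.
rewrite [X in u%:E - X]birth_fin// -EFinB -/(rho w).
case: ifPn => _; last by rewrite mule0 mul0e expN0 adde0.
by rewrite !mul1e expNE /c -EFinD; congr (_%:E); ring.
Qed.

Let weightE w : weight w + Y' w * c w = 1.
Proof.
rewrite /weight /Y' indicE memD.
have [bu|bu]/= := leP (birth w) u%:E.
  have bE := birth_fin bu; rewrite mul1e.
  have -> : (if birth w is s%:E then life_weight (s, loc w) else 1) =
      life_weight (fine (birth w), loc w) by rewrite bE.
  by rewrite /life_weight /ext_loc /c/= -EFinM -EFinD; congr (_%:E); rewrite -/(rho w); ring.
rewrite !mul0e adde0; case E : (birth w) bu => [s| |]//; rewrite lte_fin => us.
by rewrite /life_weight /ext /survival_ext/= subr_ge0 leNgt us andbF mul0r subr0.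
Qed.

Let ext0 w x : 0 <= ext_loc w x.
Proof. by have /andP[] := ext_loc01 x w. Qed.

Let ind0 w x : 0 <= ind w x.
Proof. by have /andP[] := ind01 x w. Qed.

Let Y01 w : 0 <= Y w <= 1. Proof. by apply: indD01; exact: ind01. Qed.

Let Y'01 w : 0 <= Y' w <= 1. Proof. by apply: indD01; exact: ext_loc01. Qed.

Let mY' : measurable_fun setT Y'.
Proof.
apply: (emeasurable_fun_cvg (fun k w => (\1_D w)%:E * ext_loc w (grid_above k (rho w)))).
  by move=> k; exact: mgrid.
move=> w _; have [wD|wD] := boolP (w \in D); rewrite /Y' indicE ?wD ?(negbTE wD).
  have r0 : (0 <= rho w)%R by apply: rho_ge0; rewrite inE in wD.
  rewrite mul1e; under eq_fun do rewrite mul1e.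
  rewrite /ext_loc /ext /survival_ext/= loc01 r0.
  under eq_fun do rewrite (ltW (le_lt_trans r0 (grid_above_gt _ r0))).
  exact: survival_cvg.
by rewrite mul0e; under eq_fun do rewrite mul0e; exact: cvg_cst.
Qed.

Let mY : measurable_fun setT Y.
Proof.
apply: (emeasurable_fun_cvg (fun k w => (\1_D w)%:E * ind w (grid_above k (rho w)))).
  by move=> k; exact: mgrid.
move=> w _; have [wD|wD] := boolP (w \in D); rewrite /Y indicE ?wD ?(negbTE wD).
  rewrite mul1e; under eq_fun do rewrite mul1e.
  by apply: cvg_indic_grid_above; apply: rho_ge0; rewrite inE in wD.
by rewrite mul0e; under eq_fun do rewrite mul0e; exact: cvg_cst.
Qed.

Let mcG : measurable_fun setT (c : g_sigma_algebraType G -> \bar R).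
Proof.
apply/measurable_EFinP; apply: measurable_funB => //.
apply: (measurableT_comp (@measurable_expR R)).
exact: measurable_funN (measurableT_comp mf mloc).
Qed.

Let mc : measurable_fun setT c.
Proof. exact: (measurable_fun_sub_sigma Gsub mcG). Qed.

(** Both the exponential of the cost and the weight are 1 minus a multiple of the same loss [c]: the
    factor is the indicator [Y] of being alive at u for the first, the survival probability [Y'] for
    the second. The claim thus reduces to [life_factor_set], lifted to the multiplier [X c]. *)
Lemma life_factor (X : T -> \bar R) :
  measurable_fun setT (X : g_sigma_algebraType G -> \bar R) ->
  (forall w, 0 <= X w <= 1) ->
  \int[P]_w (X w * expN (life_cost w)) = \int[P]_w (X w * weight w).
Proof.
move=> mXG X01; have mX := measurable_fun_sub_sigma Gsub mXG.
have X0 w : 0 <= X w by have /andP[] := X01 w.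
have c0 w : 0 <= c w by have /andP[] := c01 w.
have lift : \int[P]_w ((X w * c w) * Y w) = \int[P]_w ((X w * c w) * Y' w).
  apply: (integral_sub_sigmaM Gsub) => //.
  - by move=> E GE; exact: life_factor_set.
  - exact: (emeasurable_funM mXG mcG).
  - by move=> w; rewrite mule_ge0.
(* The subtraction is legitimate because all factors lie in [0,1] and the integrals are finite. *)
have split (V Z : T -> \bar R) : measurable_fun setT Z -> (forall w, 0 <= Z w <= 1) ->
    (forall w, V w + Z w * c w = 1) ->
    \int[P]_w (X w * V w) = \int[P]_w X w - \int[P]_w ((X w * c w) * Z w).
  move=> mZ Z01 VZ.
  have Z0 w : 0 <= Z w by have /andP[] := Z01 w.
  have Zc01 w : 0 <= Z w * c w <= 1.
    rewrite mule_ge0//= -[leRHS]mule1; apply: lee_pmul => //.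
    - by have /andP[] := Z01 w.
    - by have /andP[] := c01 w.
  have fin w : Z w * c w \is a fin_num.
    have /andP[z0 z1] := Zc01 w; rewrite ge0_fin_numE//; apply: le_lt_trans z1 _; exact: ltry.
  have VE w : V w = 1 - Z w * c w by rewrite -(VZ w) addeK.
  have V01 w : 0 <= V w <= 1.
    rewrite VE sube_ge0 ?fin// leeBlDr ?fin//.
    by have /andP[z0 ->] := Zc01 w; rewrite -[leLHS]adde0 leeD2l.
  have V0 w : 0 <= V w by have /andP[] := V01 w.
  have mV : measurable_fun setT V.
    rewrite (_ : V = fun w => 1 - Z w * c w); last exact/funext.
    by apply: emeasurable_funB => //; exact: emeasurable_funM.
  have I01 : 0 <= \int[P]_w ((X w * c w) * Z w) <= 1.
    apply: integral_le1.
      by apply: emeasurable_funM => //; exact: emeasurable_funM.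
    move=> w; rewrite !mule_ge0//= -[leRHS]mule1 -muleA [c w * _]muleC; apply: lee_pmul => //.
    - by rewrite mule_ge0.
    - by have /andP[] := X01 w.
    - by have /andP[] := Zc01 w.
  have -> : \int[P]_w X w =
      \int[P]_w (X w * V w) + \int[P]_w ((X w * c w) * Z w).
    rewrite -ge0_integralD//.
    - apply: eq_integral => w _; rewrite -muleA -ge0_muleDr ?mule_ge0//.
      by rewrite [c w * _]muleC VZ mule1.
    - by move=> w _; rewrite mule_ge0.
    - exact: emeasurable_funM.
    - by move=> w _; rewrite !mule_ge0.
    - by apply: emeasurable_funM => //; exact: emeasurable_funM.
  rewrite addeK// ge0_fin_numE; last by have /andP[] := I01.
  by apply: (@le_lt_trans _ _ 1); [have /andP[] := I01|exact: ltry].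
by rewrite (split _ Y mY Y01 costE) (split _ Y' mY' Y'01 weightE) lift.
Qed.

End life_factor.

(** * The branching recursion along the tree *)

Lemma sub_measurable_fun {R : realType} d d' (T : measurableType d) (T' : measurableType d')
    (G G' : set (set T)) (X : T -> T') : <<s G >> `<=` <<s G' >> ->
  measurable_fun setT (X : g_sigma_algebraType G -> T') ->
  measurable_fun setT (X : g_sigma_algebraType G' -> T').
Proof. by move=> GG' mX _ B mB; apply: GG'; exact: mX. Qed.

(** * The operator of one generation *)

Section offspring_operator.
Context {R : realType} {dB : measure_display} {OB : measurableType dB}.
Variable PB : probability OB R.
Variable kap : R -> R -> OB -> R -> R.
Hypothesis mkap : measurable_fun setT
  (fun p : ((R * R) * OB) * R => kap p.1.1.1 p.1.1.2 p.1.2 p.2).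
Hypothesis kap_ge0 : forall z y e r, 0 <= kap z y e r.
Local Open Scope ereal_scope.
Local Notation leb2 := (@lebesgue_measure R \x @lebesgue_measure R).

(** The integral runs over the whole plane: the kernel used later vanishes at negative delays and
    outside the unit square. *)
Definition expected_offspring (c : R * R -> \bar R) (s y : R) (e : OB) : \bar R :=
  \int[leb2]_p (c p * (kap p.2 y e (p.1 - s))%:E).

Definition mark_laplace (c : R * R -> \bar R) (p : R * R) : \bar R :=
  \int[PB]_e expN (expected_offspring c p.1 p.2 e).

Lemma expected_offspring_ge0 c s y e : (forall p, 0 <= c p) ->
  0 <= expected_offspring c s y e.
Proof. by move=> c0; apply: integral_ge0 => p _; rewrite mule_ge0// lee_fin. Qed.

Lemma measurable_kap_comp d (T : measurableType d) (z y r : T -> R) (e : T -> OB) :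
  measurable_fun setT z -> measurable_fun setT y -> measurable_fun setT e ->
  measurable_fun setT r -> measurable_fun setT (fun w => kap (z w) (y w) (e w) (r w)).
Proof.
move=> mz my me mr.
have mt : measurable_fun setT (fun w => (((z w, y w), e w), r w)); last first.
  exact: (measurableT_comp mkap mt).
by apply: measurable_fun_pair => //; apply: measurable_fun_pair => //; apply: measurable_fun_pair.
Qed.

Lemma measurable_expected_offspring c : measurable_fun setT c -> (forall p, 0 <= c p) ->
  measurable_fun setT (fun p : (R * R) * OB => expected_offspring c p.1.1 p.1.2 p.2).
Proof.
move=> mc c0.
apply: (@measurable_integral_leb2 _ _ _ (fun z : ((R * R) * OB) * (R * R) =>
  c z.2 * (kap z.2.2 z.1.1.2 z.1.2 (z.2.1 - z.1.1.1))%:E)).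
  apply: emeasurable_funM; first exact: measurableT_comp.
  apply/measurable_EFinP; apply: measurable_kap_comp.
  - exact: (measurableT_comp measurable_snd).
  - by apply: (measurableT_comp measurable_snd); exact: (measurableT_comp measurable_fst).
  - exact: (measurableT_comp measurable_snd).
  - apply: measurable_funB; first exact: (measurableT_comp measurable_fst).
    by apply: (measurableT_comp measurable_fst); exact: (measurableT_comp measurable_fst).
by move=> z; rewrite mule_ge0// lee_fin.
Qed.

Lemma measurable_mark_laplace c : measurable_fun setT c -> (forall p, 0 <= c p) ->
  measurable_fun setT (mark_laplace c).
Proof.
move=> mc c0; apply: (@measurable_fun_fubini_tonelli_F _ _ _ _ R PB
  (fun p : (R * R) * OB => expN (expected_offspring c p.1.1 p.1.2 p.2))).
  by apply: measurable_expN; exact: measurable_expected_offspring.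
by move=> p; exact: expN_ge0.
Qed.

Lemma mark_laplace01 c p : measurable_fun setT c -> (forall p, 0 <= c p) ->
  0 <= mark_laplace c p <= 1.
Proof.
move=> mc c0; apply: integral_le1.
  apply: measurable_expN.
  have mp : measurable_fun setT (fun e : OB => (p, e)) by exact: measurable_fun_pair.
  exact: (measurableT_comp (measurable_expected_offspring mc c0) mp).
by move=> e; rewrite expN_ge0 expN_le1// expected_offspring_ge0.
Qed.

Variable g : R * R -> \bar R.
Hypothesis mg : measurable_fun setT g.
Hypothesis g01 : forall p, 0 <= g p <= 1.

Definition branching (q : R * R -> \bar R) (p : R * R) : \bar R :=
  g p * mark_laplace (fun p => 1 - q p) p.

Definition unit_valued (q : R * R -> \bar R) :=
  measurable_fun setT q /\ forall p, 0 <= q p <= 1.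

Lemma oneB_unit_valued q : unit_valued q -> unit_valued (fun p => 1 - q p).
Proof.
move=> [mq q01]; split; first exact: emeasurable_funB.
move=> p; have /andP[q0 q1] := q01 p.
have qf : q p \is a fin_num by rewrite ge0_fin_numE// (le_lt_trans q1)// ltry.
apply/andP; split; first by rewrite sube_ge0 ?qf.
by rewrite leeBlDr// -[leLHS]adde0 leeD2l.
Qed.

Lemma branching_unit_valued q : unit_valued q -> unit_valued (branching q).
Proof.
move=> /oneB_unit_valued[mc c01].
have c0 p : 0 <= 1 - q p by have /andP[] := c01 p.
split; first by apply: emeasurable_funM => //; exact: measurable_mark_laplace.
move=> p; have /andP[m0 m1] := mark_laplace01 p mc c0.
have /andP[g0 g1] := g01 p.
by rewrite mule_ge0//= -[leRHS]mule1 lee_pmul.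
Qed.

Lemma iter_branching_unit_valued n q : unit_valued q -> unit_valued (iter n branching q).
Proof. by move=> q01; elim: n => //= n; exact: branching_unit_valued. Qed.

End offspring_operator.

(** * Conditioning along the family tree *)

Section cluster_recursion.
Context {R : realType} {dB d : measure_display}.
Context {OB : measurableType dB} {T : measurableType d}.
Variables (PB : probability OB R) (P : probability T R).
Variables (S : bd_process R T (seq nat)) (M : seq nat -> T -> OB).
Hypothesis SM : bd_measurable S.
Hypothesis mM : forall v, measurable_fun setT (M v).
Local Open Scope ereal_scope.
Local Notation leb2 := (@lebesgue_measure R \x @lebesgue_measure R).

(** The generators of [cluster_sigma], kept apart from their closure so that [g_sigma_algebraType]
    can turn them into a measurable type. *)
Definition cluster_gens (K1 K2 K3 : set (seq nat)) : set (set T) :=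
  (\bigcup_(v in K1) (preimage_set_system setT (birth S v) measurable `|`
                      preimage_set_system setT (loc S v) measurable)) `|`
  (\bigcup_(v in K2) preimage_set_system setT (M v) measurable) `|`
  (\bigcup_(v in K3) preimage_set_system setT (life S v) measurable).

Local Notation cmeasurable K1 K2 K3 X :=
  (measurable_fun setT (X : g_sigma_algebraType (cluster_gens K1 K2 K3) -> _)).

Lemma cluster_gens_sub K1 K2 K3 : <<s cluster_gens K1 K2 K3 >> `<=` measurable.
Proof.
apply: smallest_sub; first exact: sigma_algebra_measurable.
move=> A [[[v _ [[B mB <-]|[B mB <-]]]|[v _ [B mB <-]]]|[v _ [B mB <-]]].
- exact: birth_meas.
- exact: loc_meas.
- exact: mM.
- exact: life_meas.
Qed.

Lemma cmeasurable_mono K1 K2 K3 K1' K2' K3' d' (T' : measurableType d') (X : T -> T') :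
  K1 `<=` K1' -> K2 `<=` K2' -> K3 `<=` K3' -> cmeasurable K1 K2 K3 X ->
  cmeasurable K1' K2' K3' X.
Proof.
move=> s1 s2 s3; apply: sub_measurable_fun => //.
apply: sub_smallest2r => //.
move=> A [[[v Kv HA]|[v Kv HA]]|[v Kv HA]].
- by left; left; exists v => //; exact: s1.
- by left; right; exists v => //; exact: s2.
- by right; exists v => //; exact: s3.
Qed.

Lemma cmeasurable_birth K1 K2 K3 v : K1 v -> cmeasurable K1 K2 K3 (birth S v).
Proof.
move=> Kv _ B mB; apply: sub_sigma_algebra; left; left; exists v => //.
by left; exists B.
Qed.

Lemma cmeasurable_loc K1 K2 K3 v : K1 v -> cmeasurable K1 K2 K3 (loc S v).
Proof.
move=> Kv _ B mB; apply: sub_sigma_algebra; left; left; exists v => //.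
by right; exists B.
Qed.

Lemma cmeasurable_life K1 K2 K3 v : K3 v -> cmeasurable K1 K2 K3 (life S v).
Proof.
by move=> Kv _ B mB; apply: sub_sigma_algebra; right; exists v => //; exists B.
Qed.

(** The default [x] is the value at an event that does not occur: 1 for a weight, 0 for a cost. *)
Definition at_vertex (x : \bar R) (q : R * R -> \bar R) (v : seq nat) (w : T) : \bar R :=
  if birth S v w is s%:E then q (s, loc S v w) else x.

Lemma cmeasurable_at_vertex K1 K2 K3 x q v : K1 v -> measurable_fun setT q ->
  cmeasurable K1 K2 K3 (at_vertex x q v).
Proof.
move=> Kv mq; have mb := @cmeasurable_birth K1 K2 K3 v Kv.
rewrite (_ : at_vertex x q v = fun w => if birth S v w \is a fin_num then
  q (fine (birth S v w), loc S v w) else x); last first.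
  by apply/funext => w; rewrite /at_vertex; case: (birth S v w).
apply: measurable_fun_ifT => //.
  apply: (@measurable_fun_bool _ _ _ _ true); rewrite setTI.
  by rewrite -[X in measurable X]setTI; exact: emeasurable_fin_num.
apply: (measurableT_comp mq); apply: measurable_fun_pair; last exact: cmeasurable_loc.
by apply: measurableT_comp => //; exact: fine_measurable.
Qed.

Lemma at_vertex_ge0 x q v w : 0 <= x -> (forall p, 0 <= q p) -> 0 <= at_vertex x q v w.
Proof. by move=> x0 q0; rewrite /at_vertex; case: (birth S v w). Qed.

Lemma at_vertex01 q v w : (forall p, 0 <= q p <= 1) -> 0 <= at_vertex 1 q v w <= 1.
Proof.
by move=> q01; rewrite /at_vertex; case: (birth S v w) => *; rewrite ?lee01 ?lexx.
Qed.

Lemma expN_at_vertex q v w : (forall p, 0 <= q p) ->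
  expN (at_vertex 0 (fun p => - lne (q p)) v w) = at_vertex 1 q v w.
Proof.
by move=> q0; rewrite /at_vertex; case: (birth S v w) => *; rewrite ?expN_lneN ?expN0.
Qed.

Variable kap : R -> R -> OB -> R -> R.
Hypothesis mkap : measurable_fun setT
  (fun p : ((R * R) * OB) * R => kap p.1.1.1 p.1.1.2 p.1.2 p.2).
Hypothesis kap_ge0 : forall z y e r, (0 <= kap z y e r)%R.

Definition offspring_density v (z : T * (R * R)) : R :=
  if birth S v z.1 is s%:E then kap z.2.2 (loc S v z.1) (M v z.1) (z.2.1 - s) else 0.

Hypothesis mark_indep : forall v (E : set T) (C : set OB),
  <<s cluster_gens (not_strictly_below v) (not_below v) (not_below v) >> E ->
  measurable C -> P (E `&` M v @^-1` C) = P E * PB C.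
Hypothesis offspring_poisson : forall v, conditionally_poisson P
  <<s cluster_gens (not_strictly_below v) (not_strictly_below v) (not_below v) >>
  (offspring S v) (fun A w => \int[leb2]_(p in A) (offspring_density v (w, p))%:E).

Variable g : R * R -> \bar R.
Hypothesis mg : measurable_fun setT g.
Hypothesis g01 : forall p, 0 <= g p <= 1.
Variable cost : seq nat -> T -> \bar R.
Hypothesis cost_ge0 : forall v w, 0 <= cost v w.
Hypothesis cost_meas : forall (K1 K2 K3 : set (seq nat)) v, K1 v -> K3 v ->
  cmeasurable K1 K2 K3 (cost v).
Hypothesis cost_factor : forall v (X : T -> \bar R),
  cmeasurable setT setT [set~ v] X -> (forall w, 0 <= X w <= 1) ->
  \int[P]_w (X w * expN (cost v w)) = \int[P]_w (X w * at_vertex 1 g v w).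

Local Notation branch := (branching PB kap g).

Fixpoint tree_cost (n : nat) (v : seq nat) (w : T) : \bar R :=
  if n is m.+1 then cost v w + \sum_(i <oo) tree_cost m (rcons v i) w else 0.

Lemma tree_cost_ge0 n v w : 0 <= tree_cost n v w.
Proof.
elim: n v => [|n IH] v //=.
by rewrite adde_ge0// nneseries_ge0.
Qed.

Lemma cmeasurable_tree_cost K1 K2 K3 n v :
  (forall v', prefix v v' -> K1 v' /\ K3 v') -> cmeasurable K1 K2 K3 (tree_cost n v).
Proof.
elim: n v => [|n IH] v vK /=; first exact: measurable_cst.
apply: emeasurable_funD.
  by have [? ?] := vK v (prefix_refl v); exact: cost_meas.
apply: ge0_emeasurable_sum => [i w _ _|i _]; first exact: tree_cost_ge0.
apply: IH => v' vv'; apply: vK; apply: prefix_trans vv'; exact: prefix_rcons.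
Qed.

(** Turns a weight into a cost, infinite where the weight vanishes. Applied to it, the Poisson
    functional produces 1 - q, the integrand of [branching]. *)
Definition neglog (q : R * R -> \bar R) (p : R * R) : \bar R := - lne (q p).

Lemma neglog_ge0 q p : (forall p, 0 <= q p <= 1) -> 0 <= neglog q p.
Proof. by move=> q01; apply: oppe_lne_ge0; have /andP[] := q01 p. Qed.

Lemma measurable_neglog q : measurable_fun setT q -> measurable_fun setT (neglog q).
Proof.
move=> mq; apply: measurableT_comp => //; apply: measurableT_comp => //.
exact: measurable_lne.
Qed.

Lemma measurable_offspring_density v : measurable_fun setT (offspring_density v).
Proof.
have mb : measurable_fun setT (fun z : T * (R * R) => birth S v z.1).
  exact: (measurableT_comp (birth_meas SM v)).
rewrite (_ : offspring_density v = fun z => if birth S v z.1 \is a fin_num then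
  kap z.2.2 (loc S v z.1) (M v z.1) (z.2.1 - fine (birth S v z.1)) else 0%R); last first.
  by apply/funext => z; rewrite /offspring_density; case: (birth S v z.1).
apply: measurable_fun_ifT => //.
  apply: (@measurable_fun_bool _ _ _ _ true); rewrite setTI.
  by rewrite -[X in measurable X]setTI; exact: (emeasurable_fin_num _ mb).
apply: (measurable_kap_comp mkap).
- exact: (measurableT_comp measurable_snd).
- exact: (measurableT_comp (loc_meas SM v)).
- exact: (measurableT_comp (mM v)).
- apply: measurable_funB; first exact: (measurableT_comp measurable_fst).
  by apply: measurableT_comp => //; exact: fine_measurable.
Qed.

Lemma offspring_density_ge0 v z : (0 <= offspring_density v z)%R.
Proof. by rewrite /offspring_density; case: (birth S v z.1). Qed.

Let mulX01 (a b : \bar R) : 0 <= a <= 1 -> 0 <= b <= 1 -> 0 <= a * b <= 1.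
Proof.
by move=> /andP[a0 a1] /andP[b0 b1]; rewrite mule_ge0//= -[leRHS]mule1 lee_pmul.
Qed.

Let expN01 (a : \bar R) : 0 <= a -> 0 <= expN a <= 1.
Proof. by move=> a0; rewrite expN_ge0 expN_le1. Qed.

(** The order of integration is forced by the sigma-algebras. The law of the lifetime of [v] is
    given relative to all births and marks, those of the children included; the law of the children
    relative to what lies outside the progeny of [v], with the mark of [v] but not its lifetime; the
    law of the mark relative to neither. Each step leaves an integrand measurable for the next. *)
Lemma one_generation v q (X : T -> \bar R) : unit_valued q ->
  cmeasurable (not_strictly_below v) (not_below v) (not_below v) X ->
  (forall w, 0 <= X w <= 1) ->
  \int[P]_w (X w * expN (cost v w) *
             expN (\sum_(i <oo) at_vertex 0 (neglog q) (rcons v i) w)) =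
  \int[P]_w (X w * at_vertex 1 (branch q) v w).
Proof.
move=> uq mX X01; have [mq q01] := uq; have [mc c01] := oneB_unit_valued uq.
have q0 p : 0 <= q p by have /andP[] := q01 p.
have c0 p : 0 <= 1 - q p by have /andP[] := c01 p.
have nq0 p : 0 <= neglog q p by exact: neglog_ge0.
have X0 w : 0 <= X w by have /andP[] := X01 w.
pose C w := expN (\sum_(i <oo) at_vertex 0 (neglog q) (rcons v i) w).
have C01 w : 0 <= C w <= 1.
  by apply: expN01; apply: nneseries_ge0 => i _ _; exact: at_vertex_ge0.
have mC K1 K2 K3 : (forall i, K1 (rcons v i)) -> cmeasurable K1 K2 K3 C.
  move=> K1v; apply: measurable_expN.
  apply: ge0_emeasurable_sum => [i w _ _|i _]; first exact: at_vertex_ge0.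
  by apply: cmeasurable_at_vertex => //; exact: measurable_neglog.
have nsbv : not_strictly_below v v by rewrite /not_strictly_below/= eqxx andbF.
pose Y w := X w * at_vertex 1 g v w.
have Y01 w : 0 <= Y w <= 1 by apply: mulX01 => //; exact: at_vertex01.
have Y0 w : 0 <= Y w by have /andP[] := Y01 w.
have mY : cmeasurable (not_strictly_below v) (not_below v) (not_below v) Y.
  by apply: (emeasurable_funM mX); exact: cmeasurable_at_vertex.
have mY' : cmeasurable (not_strictly_below v) (not_strictly_below v) (not_below v) Y.
  apply: cmeasurable_mono mY => // v'; rewrite /not_below /not_strictly_below/=.
  by apply: contra => /andP[].
transitivity (\int[P]_w (X w * C w * expN (cost v w))).
  by apply: eq_integral => w _; rewrite muleAC.
rewrite cost_factor; last 2 first.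
- apply: emeasurable_funM; last exact: mC.
  apply: cmeasurable_mono mX => // v'; rewrite /not_below/= => vv' v'v.
  by rewrite v'v prefix_refl in vv'.
- by move=> w; exact: mulX01.
transitivity (\int[P]_w (Y w * C w)).
  by apply: eq_integral => w _; rewrite muleAC.
transitivity (\int[P]_w (Y w * expN (\int[leb2]_p ((1 - q p) * (offspring_density v (w, p))%:E)))).
  have := @poisson_functional _ _ _ P _ (@cluster_gens_sub _ _ _)
    (fun i => birth S (rcons v i)) (fun i => loc S (rcons v i))
    (fun i => birth_meas SM _) (fun i => loc_meas SM _)
    _ (measurable_offspring_density v) (offspring_density_ge0 v)
    (@offspring_poisson v) (neglog q) Y.
  move=> H; apply: (etrans (H (measurable_neglog mq) nq0 mY' Y0)).
  apply: eq_integral => w _; congr (_ * expN _); apply: eq_integral => p _.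
  by rewrite /neglog expN_lneN.
pose TG := g_sigma_algebraType
  (cluster_gens (not_strictly_below v) (not_below v) (not_below v)).
(* The outside information and the mark become two separate variables, as [integral_indep]
   requires. *)
pose EO (z : TG * OB) := if birth S v z.1 is s%:E then
  expected_offspring kap (fun p => 1 - q p) s (loc S v z.1) z.2 else 0.
have mb : measurable_fun setT (fun z : TG * OB => birth S v z.1).
  have H : cmeasurable (not_strictly_below v) (not_below v) (not_below v) (birth S v).
    exact: cmeasurable_birth.
  exact: (measurableT_comp H).
have mEO : measurable_fun setT EO.
  rewrite (_ : EO = fun z => if birth S v z.1 \is a fin_num then
    expected_offspring kap (fun p => 1 - q p) (fine (birth S v z.1)) (loc S v z.1) z.2
    else 0); last first.
    by apply/funext => z; rewrite /EO; case: (birth S v z.1).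
  apply: measurable_fun_ifT => //.
    apply: (@measurable_fun_bool _ _ _ _ true); rewrite setTI.
    by rewrite -[X in measurable X]setTI; exact: (emeasurable_fin_num _ mb).
  have mt : measurable_fun setT
      (fun z : TG * OB => ((fine (birth S v z.1), loc S v z.1), z.2)).
    apply: measurable_fun_pair => //; apply: measurable_fun_pair.
      by apply: measurableT_comp => //; exact: fine_measurable.
    have H : cmeasurable (not_strictly_below v) (not_below v) (not_below v) (loc S v).
      exact: cmeasurable_loc.
    exact: (measurableT_comp H).
  exact: (measurableT_comp (measurable_expected_offspring mkap kap_ge0 mc c0) mt).
pose F (z : TG * OB) := Y z.1 * expN (EO z).
have mF : measurable_fun setT F.
  apply: emeasurable_funM; last exact: measurable_expN.
  exact: (measurableT_comp mY).
have F0 z : 0 <= F z by rewrite mule_ge0// expN_ge0.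
transitivity (\int[P]_w F (w, M v w)).
  apply: eq_integral => w _; rewrite /F /EO/=; congr (_ * expN _).
  rewrite /offspring_density/=; case: (birth S v w) => [s| |]//.
  - by rewrite integral0_eq// => p _; rewrite mule0.
  - by rewrite integral0_eq// => p _; rewrite mule0.
rewrite (integral_indep (@cluster_gens_sub _ _ _) (mM v) (mark_indep (v := v)))//.
apply: eq_integral => w _.
have mEw : measurable_fun setT (fun e => expN (EO (w, e))).
  have mp : measurable_fun setT (fun e : OB => (w : TG, e)) by exact: measurable_fun_pair.
  by apply: measurable_expN; exact: (measurableT_comp mEO mp).
rewrite /F/= ge0_integralZl//; last by move=> e _; exact: expN_ge0.
rewrite /Y -muleA; congr (_ * _).
(* If [v] does not occur, its offspring integral is 0 and the exponential is 1, the default of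
   [at_vertex]. *)
have P1 : \int[PB]__ expN 0 = 1 :> \bar R.
  by rewrite expN0 integral_cst// mul1e; exact: probability_setT.
by rewrite /at_vertex /EO/=; case: (birth S v w) => [s| |]//; rewrite P1 mul1e.
Qed.

Let q_ n := iter n branch (cst 1).

Let unit_valued1 : unit_valued (cst 1 : R * R -> \bar R).
Proof. by split => // p; rewrite /= lee01 lexx. Qed.

Let uq n : unit_valued (q_ n).
Proof. exact: iter_branching_unit_valued. Qed.

Let not_below_rcons v i : not_below v `<=` not_below (rcons v i).
Proof.
move=> v'; rewrite /not_below/=; apply: contra => vv'.
by apply: prefix_trans vv'; exact: prefix_rcons.
Qed.

Let not_strictly_below_rcons v i : not_strictly_below v `<=` not_below (rcons v i).
Proof.
move=> v'; rewrite /not_strictly_below /not_below/=; apply: contra => vv'.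
rewrite (prefix_trans (prefix_rcons v i) vv')/=; apply/eqP => v'v.
by move: (size_prefix vv'); rewrite v'v size_rcons ltnn.
Qed.

Let not_below_sub v : not_below v `<=` not_strictly_below v.
Proof. by move=> v'; apply: contra => /andP[]. Qed.

Let not_below_prefix v i j v' : i != j -> prefix (rcons v j) v' -> not_below (rcons v i) v'.
Proof.
move=> ij jv'; rewrite /not_below/=; apply/negP => iv'.
move: iv' jv'; rewrite !prefixE !size_rcons => /eqP -> /eqP /rcons_inj[] /eqP.
by rewrite (negbTE ij).
Qed.

(** The multiplier [X] is what makes the induction work: when the subtree of one child is exchanged
    for its weight, the cost of [v] and the contributions of the siblings move into [X]. This is
    allowed because the labels below distinct siblings are disjoint, so these factors are measurable
    outside the subtree. *)
Lemma tree_laplace n v (X : T -> \bar R) :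
  cmeasurable (not_strictly_below v) (not_below v) (not_below v) X ->
  (forall w, 0 <= X w <= 1) ->
  \int[P]_w (X w * expN (tree_cost n v w)) = \int[P]_w (X w * at_vertex 1 (q_ n) v w).
Proof.
elim: n v X => [|n IH] v X mX X01.
  apply: eq_integral => w _; congr (_ * _).
  by rewrite /= expN0 /at_vertex; case: (birth S v w).
have [mq q01] := uq n.
have q0 p : 0 <= q_ n p by have /andP[] := q01 p.
have nq0 p : 0 <= neglog (q_ n) p by exact: neglog_ge0.
pose av i w := at_vertex 0 (neglog (q_ n)) (rcons v i) w.
pose tc i w := tree_cost n (rcons v i) w.
have av0 i w : 0 <= av i w by exact: at_vertex_ge0.
have tc0 i w : 0 <= tc i w by exact: tree_cost_ge0.
pose Y w := X w * expN (cost v w).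
have Y01 w : 0 <= Y w <= 1 by apply: mulX01 => //; exact: expN01.
have nsbv : not_strictly_below v v by rewrite /not_strictly_below/= eqxx andbF.
have mY i : cmeasurable (not_strictly_below (rcons v i)) (not_below (rcons v i))
    (not_below (rcons v i)) Y.
  apply: emeasurable_funM; last first.
    apply: measurable_expN; apply: cost_meas; last exact: not_strictly_below_rcons.
    by apply: not_below_sub; exact: not_strictly_below_rcons.
  apply: cmeasurable_mono mX; [|exact: not_below_rcons|exact: not_below_rcons].
  by apply: subset_trans (@not_below_sub _); exact: not_strictly_below_rcons.
have mterm i j : i != j -> forall b : bool,
    cmeasurable (not_strictly_below (rcons v j)) (not_below (rcons v j))
    (not_below (rcons v j)) (fun w => if b then av i w else tc i w).
  move=> ij [].
    apply: cmeasurable_at_vertex; last exact: measurable_neglog.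
    apply: not_below_sub; apply: not_below_prefix (prefix_refl _).
    by rewrite eq_sym.
  apply: cmeasurable_tree_cost => v' vv'.
  have nbv' : not_below (rcons v j) v' by apply: not_below_prefix vv'; rewrite eq_sym.
  by split => //; exact: not_below_sub.
(* The subtrees of the first m children are exchanged for their weights one at a time. *)
have swap m : \int[P]_w (Y w * expN (\sum_(i < m) tc i w)) =
              \int[P]_w (Y w * expN (\sum_(i < m) av i w)).
  pose mix j w := \sum_(i < m) (if (i < j)%N then av i w else tc i w).
  have step j : (j < m)%N ->
      \int[P]_w (Y w * expN (mix j w)) = \int[P]_w (Y w * expN (mix j.+1 w)).
    move=> jm.
    pose rest w := \sum_(i < m)
      (if i == j :> nat then 0 else if (i < j)%N then av i w else tc i w).
    have rest0 w : 0 <= rest w.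
      by apply: sume_ge0 => i _; case: ifP => // _; case: ifP.
    have ord_neq (i : 'I_m) : i != Ordinal jm -> (i == j :> nat) = false.
      by move=> ij; apply: contraNF ij => /eqP ij; apply/eqP/val_inj.
    have mixE w : mix j w = tc j w + rest w.
      rewrite /mix /rest (bigD1 (Ordinal jm))//= ltnn; congr (_ + _).
      rewrite [RHS](bigD1 (Ordinal jm))//= eqxx add0e; apply: eq_bigr => i ij.
      by rewrite ord_neq.
    have mixSE w : mix j.+1 w = av j w + rest w.
      rewrite /mix /rest (bigD1 (Ordinal jm))//= ltnSn; congr (_ + _).
      rewrite [RHS](bigD1 (Ordinal jm))//= eqxx add0e; apply: eq_bigr => i ij.
      by rewrite ltnS leq_eqVlt ord_neq.
    pose X' w := Y w * expN (rest w).
    have X'01 w : 0 <= X' w <= 1 by apply: mulX01 => //; exact: expN01.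
    have mX' : cmeasurable (not_strictly_below (rcons v j)) (not_below (rcons v j))
        (not_below (rcons v j)) X'.
      apply: emeasurable_funM; first exact: mY.
      apply: measurable_expN; apply: emeasurable_sum => i.
      have [_|ij] := eqVneq (i : nat) j; first exact: measurable_cst.
      exact: mterm.
    transitivity (\int[P]_w (X' w * expN (tc j w))).
      by apply: eq_integral => w _; rewrite mixE expND// muleA muleAC.
    rewrite IH//; apply: eq_integral => w _.
    by rewrite mixSE expND// -expN_at_vertex// /X' -muleA; congr (_ * _); rewrite muleC.
  have chain j : (j <= m)%N ->
      \int[P]_w (Y w * expN (mix 0%N w)) = \int[P]_w (Y w * expN (mix j w)).
    by elim: j => // j IHj jm; rewrite IHj ?(ltnW jm)// step.
  transitivity (\int[P]_w (Y w * expN (mix 0%N w))); first exact: eq_integral.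
  rewrite (chain m)//; apply: eq_integral => w _; congr (_ * expN _).
  by apply: eq_bigr => i _; rewrite ltn_ord.
have mYT : measurable_fun setT Y.
  exact: (measurable_fun_sub_sigma (@cluster_gens_sub _ _ _) (mY 0%N)).
(* Only finitely many children can be exchanged; the remaining ones are reached by letting m tend to
   infinity, with integrands in [0,1]. *)
have limit (z : nat -> T -> \bar R) : (forall i w, 0 <= z i w) ->
    (forall i, measurable_fun setT (z i)) ->
    \int[P]_w (Y w * expN (\sum_(i < m) z i w)) @[m --> \oo] -->
    \int[P]_w (Y w * expN (\sum_(i <oo) z i w)).
  move=> z0 mz; apply: cvg_integral_le1 => //.
  - move=> m; apply: emeasurable_funM => //; apply: measurable_expN.
    by apply: emeasurable_sum => i.
  - by move=> m w; apply: mulX01 => //; apply: expN01; apply: sume_ge0 => i _.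
  - move=> w; apply: cvgeZl.
      have /andP[y0 y1] := Y01 w; rewrite ge0_fin_numE//; apply: le_lt_trans y1 _.
      exact: ltry.
    apply: (@expN_cvg _ (fun m => \sum_(i < m) z i w)) => [m|]; first exact: sume_ge0.
    under eq_fun do rewrite -(big_mkord xpredT (fun i => z i w)).
    by apply: is_cvg_nneseries.
have mtc i : measurable_fun setT (tc i).
  apply: (measurable_fun_sub_sigma (@cluster_gens_sub setT setT setT)).
  exact: cmeasurable_tree_cost.
have mav i : measurable_fun setT (av i).
  apply: (measurable_fun_sub_sigma (@cluster_gens_sub setT setT setT)).
  by apply: cmeasurable_at_vertex => //; exact: measurable_neglog.
transitivity (\int[P]_w (Y w * expN (\sum_(i <oo) tc i w))).
  apply: eq_integral => w _; rewrite [tree_cost _ _ _]/= expND//.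
    by rewrite muleA.
  by apply: nneseries_ge0 => i _ _; exact: tc0.
rewrite -(one_generation (uq n) mX X01).
have lim_tc := limit tc tc0 mtc; have lim_av := limit av av0 mav.
move: lim_tc; under eq_fun do rewrite swap.
by move=> lim_tc; exact: cvg_unique lim_tc lim_av.
Qed.

End cluster_recursion.

(** * The total cost as a limit over generations *)

Section tree_cost_limit.
Context {R : realType} {d} {T : measurableType d}.
Variable cost : seq nat -> T -> \bar R.
Local Open Scope ereal_scope.
Hypothesis cost_ge0 : forall v w, 0 <= cost v w.

(** A nonempty label of length at most n is a first letter followed by a label of length less than
    n, which matches the recursion of [tree_cost]. *)
Lemma tree_costE n v w : tree_cost cost n v w =
  \esum_(v' in [set v' | (size v' < n)%N]) cost (v ++ v') w.
Proof.
elim: n v => [|n IH] v /=.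
  by rewrite (_ : [set _ | _] = set0) ?esum_set0//; apply/seteqP; split.
rewrite (esumID [set [::]]); last by move=> v' _; exact: cost_ge0.
rewrite (_ : _ `&` [set [::]] = [set [::]]); last first.
  by apply/seteqP; split => [v' []//|v' ->].
rewrite esum_set1 ?cats0//; congr (_ + _).
rewrite nneseries_esumT; last by move=> i; exact: tree_cost_ge0.
under eq_esum do rewrite IH.
rewrite esum_esum; last by move=> i v' _ _; exact: cost_ge0.
rewrite (reindex_esum (setT `*`` (fun=> [set v' | (size v' < n)%N])) _
  (fun k => k.1 :: k.2)).
  by apply: eq_esum => -[i v'] _ /=; rewrite cat_rcons.
split.
- by move=> [i v'] [_ /=] v'n; split.
- by move=> [i v'] [j v''] _ _ /= [-> ->].
- by move=> [|i v'] [/= v'n v'0]//; exists (i, v').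
Qed.

(** A finite set of labels has bounded length, so each finite partial sum is already below the cost
    of some generation cut. *)
Lemma cvg_tree_cost w :
  tree_cost cost n [::] w @[n --> \oo] --> \esum_(v in setT) cost v w.
Proof.
have nd : nondecreasing_seq (fun n => tree_cost cost n [::] w).
  move=> m n mn; rewrite !tree_costE.
  apply: ge_ereal_sup => _ [X [finX Xm] <-]; apply: ereal_sup_ubound.
  by exists X => //; split => // v /Xm/= /leq_trans; exact.
rewrite (_ : \esum_(v in setT) cost v w =
  ereal_sup (range (fun n => tree_cost cost n [::] w))).
  exact: ereal_nondecreasing_cvgn.
apply/eqP; rewrite eq_le; apply/andP; split; last first.
  apply: ge_ereal_sup => _ [n _ <-]; rewrite tree_costE.
  apply: ge_ereal_sup => _ [X [finX Xm] <-]; apply: ereal_sup_ubound.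
  by exists X.
apply: ge_ereal_sup => _ [X [finX _] <-].
pose n := (\max_(v <- fset_set X) size v).+1.
apply: (@le_trans _ _ (tree_cost cost n [::] w)); last first.
  by apply: ereal_sup_ubound; exists n.
rewrite tree_costE; apply: ereal_sup_ubound; exists X => //; split => // v Xv /=.
rewrite /n ltnS; apply: leq_bigmax_seq => //.
by rewrite in_fset_set// inE.
Qed.

End tree_cost_limit.

(** * A linear bound on the transform of a mark *)

Section mark_laplace_bound.
Context {R : realType} {dB : measure_display} {OB : measurableType dB}.
Variable PB : probability OB R.
Variable kap : R -> R -> OB -> R -> R.
Hypothesis mkap : measurable_fun setT
  (fun p : ((R * R) * OB) * R => kap p.1.1.1 p.1.1.2 p.1.2 p.2).
Hypothesis kap_ge0 : forall z y e r, 0 <= kap z y e r.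
Local Open Scope ereal_scope.
Local Notation leb := (@lebesgue_measure R).
Local Notation leb2 := (leb \x leb).
Local Notation EO := (expected_offspring kap).

Definition mean_offspring (c : R * R -> \bar R) (p : R * R) : \bar R :=
  \int[PB]_e EO c p.1 p.2 e.

Let mkap_p s y : measurable_fun setT (fun z : OB * (R * R) => kap z.2.2 y z.1 (z.2.1 - s)).
Proof.
apply: (measurable_kap_comp mkap) => //.
- exact: (measurableT_comp measurable_snd).
- apply: measurable_funB; last exact: measurable_cst.
  exact: (measurableT_comp measurable_fst).
Qed.

Let mkap_e s y e : measurable_fun setT (fun p : R * R => kap p.2 y e (p.1 - s)).
Proof.
have mt : measurable_fun setT (fun p : R * R => (e, p)) by exact: measurable_fun_pair.
exact: (measurableT_comp (mkap_p s y) mt).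
Qed.

Let mEO c s y : measurable_fun setT c -> (forall p, 0 <= c p) ->
  measurable_fun setT (EO c s y).
Proof.
move=> mc c0.
have mt : measurable_fun setT (fun e : OB => ((s, y), e)) by exact: measurable_fun_pair.
exact: (measurableT_comp (measurable_expected_offspring mkap kap_ge0 mc c0) mt).
Qed.

Lemma expected_offspringD c c' s y e : measurable_fun setT c -> (forall p, 0 <= c p) ->
  measurable_fun setT c' -> (forall p, 0 <= c' p) ->
  EO (fun p => c p + c' p) s y e = EO c s y e + EO c' s y e.
Proof.
move=> mc c0 mc' c'0; rewrite /expected_offspring.
have mk : measurable_fun setT (fun p : R * R => (kap p.2 y e (p.1 - s))%:E).
  by apply/measurable_EFinP; exact: mkap_e.
transitivity (\int[leb2]_p (c p * (kap p.2 y e (p.1 - s))%:E +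
                             c' p * (kap p.2 y e (p.1 - s))%:E)).
  by apply: eq_integral => p _; rewrite ge0_muleDl.
apply: ge0_integralD => //.
- by move=> p _; rewrite mule_ge0// lee_fin.
- by apply: emeasurable_funM; [exact: mc|exact: mk].
- by move=> p _; rewrite mule_ge0// lee_fin.
- by apply: emeasurable_funM; [exact: mc'|exact: mk].
Qed.

(** Apply [expN_sub] for each mark, with increment the offspring integral of q - p, then integrate.
    The result is linear in q - p, so that only the first moment of the marks is involved. *)
Lemma mark_laplace_le (q p : R * R -> \bar R) x : unit_valued q -> unit_valued p ->
  (forall y, p y <= q y) ->
  mark_laplace PB kap (fun y => 1 - q y) x <=
  mark_laplace PB kap (fun y => 1 - p y) x + mean_offspring (fun y => q y - p y) x.
Proof.
move=> uq up pq; have [mq q01] := uq; have [mp p01] := up.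
have [mq' q'01] := oneB_unit_valued uq; have [mp' p'01] := oneB_unit_valued up.
have q'0 y : 0 <= 1 - q y by have /andP[] := q'01 y.
have p'0 y : 0 <= 1 - p y by have /andP[] := p'01 y.
have qf y : q y \is a fin_num.
  have /andP[q0 q1] := q01 y; rewrite ge0_fin_numE//; apply: le_lt_trans q1 _; exact: ltry.
have pf y : p y \is a fin_num.
  have /andP[p0 p1] := p01 y; rewrite ge0_fin_numE//; apply: le_lt_trans p1 _; exact: ltry.
have D0 y : 0 <= q y - p y by rewrite sube_ge0 ?pf.
have mD : measurable_fun setT (fun y => q y - p y) by exact: emeasurable_funB.
rewrite /mark_laplace /mean_offspring -ge0_integralD//.
- apply: ge0_le_integral => //.
  + by move=> e _; exact: expN_ge0.
  + by apply: measurable_expN; exact: mEO.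
  + by apply: emeasurable_funD; [apply: measurable_expN; exact: mEO|exact: mEO].
  move=> e _; have -> : EO (fun y => 1 - p y) x.1 x.2 e =
      EO (fun y => 1 - q y) x.1 x.2 e + EO (fun y => q y - p y) x.1 x.2 e.
    rewrite -expected_offspringD//; congr (EO _ _ _ _); apply/funext => y.
    by rewrite addeA subeK.
  by apply: expN_sub; exact: expected_offspring_ge0.
- by move=> e _; exact: expN_ge0.
- by apply: measurable_expN; exact: mEO.
- by move=> e _; exact: expected_offspring_ge0.
- exact: mEO.
Qed.

(** Tonelli moves the mean over the mark inside, where the bound on E[B] at each pair of locations
    can be used. *)
Lemma mean_offspringE c s y : measurable_fun setT c -> (forall p, 0 <= c p) ->
  mean_offspring c (s, y) =
  \int[leb]_t \int[leb]_z (c (t, z) * \int[PB]_e (kap z y e (t - s))%:E).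
Proof.
move=> mc c0.
pose f (z : OB * (R * R)) := c z.2 * (kap z.2.2 y z.1 (z.2.1 - s))%:E.
have mf : measurable_fun setT f.
  apply: emeasurable_funM; first exact: (measurableT_comp mc).
  by apply/measurable_EFinP; exact: mkap_p.
have f0 z : 0 <= f z by rewrite mule_ge0// lee_fin.
have mf3 : measurable_fun setT (fun z : (OB * R) * R => f (z.1.1, (z.1.2, z.2))).
  apply: (measurableT_comp mf); apply: measurable_fun_pair => /=.
    exact: (measurableT_comp measurable_fst).
  apply: measurable_fun_pair => //.
  exact: (measurableT_comp measurable_snd).
transitivity (\int[PB]_e \int[leb]_t \int[leb]_z f (e, (t, z))).
  apply: eq_integral => e _; apply: (@integral_leb2 _ (fun p => f (e, p))) => //.
  by apply: (measurableT_comp mf); exact: measurable_fun_pair.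
rewrite (@fubini_tonelli _ _ OB _ R PB leb (fun z => \int[leb]_z0 f (z.1, (z.2, z0)))).
- apply: eq_integral => t _.
  rewrite (@fubini_tonelli _ _ OB _ R PB leb (fun z => f (z.1, (t, z.2)))).
  + apply: eq_integral => z _; rewrite /f/= ge0_integralZl//.
    * apply/measurable_EFinP.
      have mt : measurable_fun setT (fun e : OB => (e, (t, z))) by exact: measurable_fun_pair.
      exact: (measurableT_comp (mkap_p s y) mt).
    * by move=> e _; rewrite lee_fin.
  + have mt : measurable_fun setT (fun z : OB * R => ((z.1, t), z.2)).
      by apply: measurable_fun_pair => //; apply: measurable_fun_pair.
    exact: (measurableT_comp mf3 mt).
  + by move=> z; exact: f0.
- exact: (@measurable_integral_leb _ _ _ (fun z : (OB * R) * R => f (z.1.1, (z.1.2, z.2)))).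
- by move=> z; apply: integral_ge0.
Qed.

End mark_laplace_bound.

(* f and g need not be measurable: the integral of a nonnegative function is a lower integral. *)
Lemma ge0_le_lower_integral {R : realType} d (T : measurableType d)
    (mu : {measure set T -> \bar R}) (D : set T) (f g : T -> \bar R) :
  (forall x, D x -> (0 <= f x)%E) -> (forall x, D x -> (f x <= g x)%E) ->
  (\int[mu]_(x in D) f x <= \int[mu]_(x in D) g x)%E.
Proof.
move=> f0 fg.
rewrite integral_mkcond [leRHS]integral_mkcond !ge0_integralTE.
- apply: ge_ereal_sup => _ [h hf <-]; apply: ereal_sup_ubound; exists h => // x.
  apply: le_trans (hf x) _; rewrite !patchE; case: ifPn => // xD.
  by apply: fg; rewrite inE in xD.
- move=> x; rewrite patchE; case: ifPn => // xD; rewrite inE in xD.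
  by apply: le_trans (fg _ xD); exact: f0.
- by move=> x; rewrite patchE; case: ifPn => // xD; rewrite inE in xD; exact: f0.
Qed.

(** * The Hawkes kernel *)

Section hawkes_kernel.
Context {R : realType} {dB : measure_display} {OB : measurableType dB}.
Variables (PB : probability OB R) (h : R -> R) (W : R -> R -> R) (B : R -> R -> OB -> R).
Variables (CW CB : R).
Hypothesis h_ge0 : forall s : R, 0 <= s -> 0 <= h s.
Hypothesis h_L1 : lebesgue_measure.-integrable `[0, +oo[ (EFin \o h).
Hypothesis W_meas : measurable_fun ((`[0, 1] : set R) `*` (`[0, 1] : set R))
  (fun p : R * R => W p.1 p.2).
Hypothesis W_ge0 : forall x y : R, x \in `[0, 1] -> y \in `[0, 1] -> 0 <= W x y.
Hypothesis CW_ge0 : 0 <= CW.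
Hypothesis W_le : forall x y : R, x \in `[0, 1] -> y \in `[0, 1] -> W x y <= CW.
Hypothesis B_meas : measurable_fun (((`[0, 1] : set R) `*` (`[0, 1] : set R)) `*` setT)
  (fun p : (R * R) * OB => B p.1.1 p.1.2 p.2).
Hypothesis B_ge0 : forall (x y : R) e, x \in `[0, 1] -> y \in `[0, 1] -> 0 <= B x y e.
Hypothesis CB_ge0 : 0 <= CB.
Hypothesis B_le : forall x y : R, x \in `[0, 1] -> y \in `[0, 1] ->
  ('E_PB[B x y] <= CB%:E)%E.
Local Notation leb := (@lebesgue_measure R).

Definition in_square (z y : R) : bool := (z \in `[0, 1]) && (y \in `[0, 1]).

Definition h_ext (r : R) : R := if 0 <= r then h r else 0.

(* The intensity of an event at y with mark e at location z and delay r, extended by 0. *)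
Definition hawkes_kernel (z y : R) (e : OB) (r : R) : R :=
  if in_square z y then B z y e * W z y * h_ext r else 0.

Lemma h_ext_ge0 r : 0 <= h_ext r.
Proof. by rewrite /h_ext; case: ifPn => //; exact: h_ge0. Qed.

Lemma h_extE : h_ext = h \_ `[0, +oo[%classic.
Proof.
apply/funext => r; rewrite /h_ext patchE; congr (if _ then _ else _).
by apply/idP/idP; rewrite inE/= in_itv/= andbT.
Qed.

Lemma measurable_h_ext : measurable_fun setT h_ext.
Proof.
rewrite h_extE; apply/(measurable_restrictT _ _).1 => //.
by apply/measurable_EFinP; exact: measurable_int h_L1.
Qed.

Lemma measurable_hawkes_kernel : measurable_fun setT
  (fun p : ((R * R) * OB) * R => hawkes_kernel p.1.1.1 p.1.1.2 p.1.2 p.2).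
Proof.
pose sq := (`[0, 1]%classic : set R) `*` (`[0, 1]%classic : set R).
have msq : measurable sq by apply: measurableX.
have sqE (z y : R) : ((z, y) \in sq) = in_square z y.
  by apply/idP/andP; rewrite inE.
rewrite (_ : (fun p => _) = fun p : ((R * R) * OB) * R =>
  ((fun p : (R * R) * OB => B p.1.1 p.1.2 p.2) \_ (sq `*` setT)) p.1 *
  ((fun p : R * R => W p.1 p.2) \_ sq) p.1.1 * h_ext p.2).
  apply: measurable_funM; last first.
    exact: (measurableT_comp measurable_h_ext measurable_snd).
  apply: measurable_funM.
    have mB := (measurable_restrictT _ (measurableX msq measurableT)).1 B_meas.
    exact: (measurableT_comp mB measurable_fst).
  have mW := (measurable_restrictT _ msq).1 W_meas.
  by apply: (measurableT_comp mW); exact: (measurableT_comp measurable_fst).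
apply/funext => -[[[z y] e] r]; rewrite /hawkes_kernel/= !patchE sqE.
rewrite (_ : ((z, y, e) \in sq `*` setT) = in_square z y).
  by case: ifP => //; rewrite !mul0r.
rewrite -sqE; apply/idP/idP; rewrite !inE => //.
by move=> [].
Qed.

Lemma hawkes_kernel_ge0 z y e r : 0 <= hawkes_kernel z y e r.
Proof.
rewrite /hawkes_kernel; case: ifPn => // /andP[z01 y01].
by rewrite !mulr_ge0 ?B_ge0 ?W_ge0 ?h_ext_ge0.
Qed.

Lemma mean_hawkes_kernel_le z y r :
  (\int[PB]_e (hawkes_kernel z y e r)%:E <=
   (if z \in `[0%R, 1%R] then CB * CW * h_ext r else 0)%:E)%E.
Proof.
rewrite /hawkes_kernel /in_square.
case: ifPn => z01/=; last by rewrite integral0.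
have [y01|y01] := boolP (y \in `[0, 1]); last first.
  by rewrite integral0 lee_fin !mulr_ge0// h_ext_ge0.
have mBzy : measurable_fun setT (B z y).
  have sqzy : ((z, y) \in (`[0, 1]%classic : set R) `*` (`[0, 1]%classic : set R)).
    by rewrite inE.
  rewrite (_ : B z y = fun e => ((fun p : (R * R) * OB => B p.1.1 p.1.2 p.2) \_
    (((`[0, 1]%classic : set R) `*` (`[0, 1]%classic : set R)) `*` setT)) ((z, y), e)).
    have mB := (measurable_restrictT _ (measurableX (measurableX
      (measurable_itv `[0, 1]) (measurable_itv `[0, 1])) measurableT)).1 B_meas.
    have mt : measurable_fun setT (fun e : OB => ((z, y), e)) by exact: measurable_fun_pair.
    exact: (measurableT_comp mB mt).
  by apply/funext => e; rewrite patchE mem_set//=; split => //; rewrite inE in sqzy.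
have Wh0 : 0 <= W z y * h_ext r by rewrite mulr_ge0 ?W_ge0 ?h_ext_ge0.
under eq_integral do rewrite -mulrA mulrC EFinM.
rewrite ge0_integralZl_EFin//; last 2 first.
- by move=> e _; rewrite lee_fin B_ge0.
- exact/measurable_EFinP.
apply: (@le_trans _ _ ((W z y * h_ext r)%:E * CB%:E)%E).
  apply: lee_wpmul2l; first by rewrite lee_fin.
  by have := B_le z01 y01; rewrite unlock.
rewrite -EFinM lee_fin mulrC -mulrA ler_wpM2l// ler_wpM2r ?h_ext_ge0//.
exact: W_le.
Qed.

Lemma integrable_h_ext : leb.-integrable setT (EFin \o h_ext).
Proof.
apply: (@eq_integrable _ _ _ leb setT measurableT ((EFin \o h) \_ `[0, +oo[%classic)).
  by move=> r _; rewrite h_extE /= !patchE; case: ifPn.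
by apply: (iffLR (integrable_mkcond _ _)).
Qed.

(** Dominated convergence with bound [h_ext]. The integrand tends to 0 except possibly at r = 0, a
    null set. This is what lets a large [theta] shrink the offspring mean, whatever the size of int
    h. *)
Lemma cvg_laplace_h_ext :
  (\int[leb]_r (expR (- (n%:R * r)) * h_ext r)%:E @[n --> \oo] --> 0)%E.
Proof.
pose f_ (n : nat) (r : R) : \bar R := (expR (- (n%:R * r)) * h_ext r)%:E.
have mf_ n : measurable_fun setT (f_ n).
  apply/measurable_EFinP; apply: measurable_funM; last exact: measurable_h_ext.
  apply: (measurableT_comp (@measurable_expR R)).
  by apply: measurable_funN; exact: measurable_funM.
have f_cvg : {ae leb, forall r, [set: R] r -> f_ n r @[n --> \oo] --> cst 0%E r}.
  exists [set 0]; split; [exact: measurable_set1|exact: lebesgue_measure_set1|].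
  move=> r /=; apply: contra_notP => r0 _.
  have [rlt|rgt|req] := ltgtP r 0; last by case: r0.
    rewrite /f_ /h_ext leNgt rlt/=; under eq_fun do rewrite mulr0.
    exact: cvg_cst.
  apply/cvg_EFin; first exact: nearW.
  rewrite -[X in _ --> X](mul0r (h_ext r)).
  apply: cvgM; last exact: cvg_cst.
  under eq_fun do rewrite -mulrN expRM_natl.
  apply: cvg_expr; rewrite ger0_norm ?expR_ge0//.
  by rewrite expR_lt1 oppr_lt0.
have f_le : {ae leb, forall r n, [set: R] r -> (`|f_ n r| <= (EFin \o h_ext) r)%E}.
  apply: aeW => r n _; rewrite /f_/= lee_fin normrM (ger0_norm (expR_ge0 _)).
  rewrite (ger0_norm (h_ext_ge0 r)).
  have [r0|r0] := leP 0 r.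
    by rewrite ler_piMl ?h_ext_ge0// expR_le1 oppr_le0 mulr_ge0.
  have -> : h_ext r = 0 by rewrite /h_ext lt_geF.
  by rewrite mulr0.
have [_ _] := @dominated_convergence _ _ R leb setT measurableT f_ (cst 0%E) (EFin \o h_ext)
  mf_ (measurable_cst 0%E) f_cvg integrable_h_ext f_le.
by rewrite integral0.
Qed.

Lemma laplace_h_ext_small : exists2 theta : R, 0 <= theta &
  ((CB * CW)%:E * \int[leb]_r (expR (- (theta * r)) * h_ext r)%:E <= (2^-1)%:E)%E.
Proof.
have H : ((CB * CW)%:E * \int[leb]_r (expR (- (n%:R * r)) * h_ext r)%:E @[n --> \oo]
    --> 0)%E.
  rewrite -[X in _ --> X](mule0 (CB * CW)%:E).
  by apply: cvgeZl => //; exact: cvg_laplace_h_ext.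
have [N _ NP] : \forall n \near \oo,
    ((CB * CW)%:E * \int[leb]_r (expR (- (n%:R * r)) * h_ext r)%:E < (2^-1)%:E)%E.
  have /fine_cvgP[Hfin Hf] := H.
  near=> n; rewrite -[ltLHS]fineK; last by near: n.
  by rewrite lte_fin; near: n; apply: (cvgr_lt _ Hf).
by exists N%:R => //; apply: ltW; exact: (NP N (leqnn N)).
Unshelve. all: by end_near. Qed.

Variable theta : R.
Hypothesis theta_small :
  ((CB * CW)%:E * \int[leb]_r (expR (- (theta * r)) * h_ext r)%:E <= (2^-1)%:E)%E.

(** The weight at t is the weight at s times exp(-theta (t - s)), so after a translation by s the
    bound contains the integral that [theta_small] controls; the factor 1/2 comes from there.
    Locations outside [0,1] need no bound on [c], as the kernel vanishes there, and [0,1] has length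
    1. *)
Lemma mean_offspring_le (c : R * R -> \bar R) (K u s y : R) :
  measurable_fun setT c -> (forall p, 0 <= c p)%E -> 0 <= K ->
  (forall t z : R, z \in `[0, 1] -> (c (t, z) <= (K * expR (theta * (u - t)))%:E)%E) ->
  (mean_offspring PB hawkes_kernel c (s, y) <= (K / 2 * expR (theta * (u - s)))%:E)%E.
Proof.
move=> mc c0 K0 cle.
rewrite (mean_offspringE PB measurable_hawkes_kernel hawkes_kernel_ge0)//.
pose bnd t := K * expR (theta * (u - t)) * (CB * CW * h_ext (t - s)).
have m0 z t : (0 <= \int[PB]_e (hawkes_kernel z y e (t - s))%:E)%E.
  by apply: integral_ge0 => e _; rewrite lee_fin hawkes_kernel_ge0.
apply: (@le_trans _ _ (\int[leb]_t (bnd t)%:E)%E).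
  apply: ge0_le_lower_integral => t _.
    by apply: integral_ge0 => z _; rewrite mule_ge0.
  apply: (@le_trans _ _ (\int[leb]_(z in `[0%R, 1%R]) cst (bnd t)%:E z)%E); last first.
    by rewrite integral_cst//= lebesgue_measure_itv/= lte01 oppr0 adde0 mule1.
  rewrite [leRHS]integral_mkcond; apply: ge0_le_lower_integral => z _.
    by rewrite mule_ge0.
  have := mean_hawkes_kernel_le z y (t - s); rewrite patchE.
  have -> : (z \in `[0, 1]%classic) = (z \in `[0, 1]) by apply/idP/idP => [/set_mem//|/mem_set].
  case: ifPn => z01 mle.
    by rewrite EFinM; apply: lee_pmul => //; exact: cle.
  rewrite (_ : \int[PB]_e _ = 0)%E ?mule0//.
  by apply/eqP; rewrite eq_le m0 mle.
pose b' t := K * expR (theta * (u - s)) * (CB * CW) * (expR (- (theta * t)) * h_ext t).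
have b'0 t : 0 <= b' t by rewrite !mulr_ge0 ?expR_ge0 ?h_ext_ge0.
have mexp : measurable_fun setT (fun r => expR (- (theta * r)) * h_ext r).
  apply: measurable_funM; last exact: measurable_h_ext.
  apply: (measurableT_comp (@measurable_expR R)).
  by apply: measurable_funN; exact: measurable_funM.
have mb' : measurable_fun setT (EFin \o b').
  by apply/measurable_EFinP; apply: measurable_funM.
rewrite (_ : (\int[leb]_t (bnd t)%:E = \int[leb]_t (EFin \o b') (- s + t)%R)%E); last first.
  apply: eq_integral => t _ /=; rewrite /bnd /b' [- s + t]addrC; congr _%:E.
  rewrite (_ : theta * (u - t) = theta * (u - s) + - (theta * (t - s))); last by ring.
  by rewrite expRD; ring.
rewrite (ge0_integral_translate _ mb'); last by move=> r; rewrite lee_fin.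
rewrite /b'/=; under eq_integral do rewrite EFinM.
rewrite ge0_integralZl_EFin//; last 3 first.
- by move=> r _; rewrite lee_fin mulr_ge0 ?expR_ge0 ?h_ext_ge0.
- exact/measurable_EFinP.
- by rewrite !mulr_ge0 ?expR_ge0.
rewrite EFinM -muleA; apply: (@le_trans _ _ ((K * expR (theta * (u - s)))%:E * (2^-1)%:E)%E).
  by apply: lee_wpmul2l => //; rewrite lee_fin mulr_ge0 ?expR_ge0.
by rewrite -EFinM lee_fin [leLHS]mulrAC.
Qed.

End hawkes_kernel.

(** * The operator Phi *)

Section operator_order.
Context {R : realType} {dB dJ : measure_display}.
Context {OB : measurableType dB} {OJ : measurableType dJ}.
Variables (PB : probability OB R) (h : R -> R) (W : R -> R -> R) (B : R -> R -> OB -> R).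
Variables (PJ : probability OJ R) (J : R -> OJ -> R).
Variables CW : R.
Hypothesis h_ge0 : forall s : R, 0 <= s -> 0 <= h s.
Hypothesis h_L1 : lebesgue_measure.-integrable `[0, +oo[ (EFin \o h).
Hypothesis W_ge0 : forall x y : R, x \in `[0, 1] -> y \in `[0, 1] -> 0 <= W x y.
Hypothesis CW_ge0 : 0 <= CW.
Hypothesis W_le : forall x y : R, x \in `[0, 1] -> y \in `[0, 1] -> W x y <= CW.
Hypothesis B_ge0 : forall (x y : R) e, x \in `[0, 1] -> y \in `[0, 1] -> 0 <= B x y e.
Hypothesis J_meas : forall x : R, x \in `[0, 1] -> measurable_fun setT (J x).
Local Notation leb := (@lebesgue_measure R).
Local Notation Phi' := (Phi h W PB B PJ J).


(** The function [g] will come from an arbitrary functional, so no integrand here is known to be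
    measurable. Monotonicity of the lower integral suffices. *)
Lemma beta_fin x g : x \in `[0, 1] -> (forall y : R, y \in `[0, 1] -> 0 <= g y) ->
  (0 <= \int[PB]_e expeR (- \int[leb]_(y in `[0%R, 1%R]) (g y * B y x e)%:E) <= 1)%E.
Proof.
move=> x01 g0.
have I0 e : (0 <= \int[leb]_(y in `[0%R, 1%R]) (g y * B y x e)%:E)%E.
  by apply: integral_ge0 => y y01; rewrite lee_fin mulr_ge0 ?g0 ?B_ge0.
apply/andP; split; first by apply: integral_ge0 => e _; exact: expeR_ge0.
apply: (@le_trans _ _ (\int[PB]_e cst 1 e)%E).
  by apply: ge0_le_lower_integral => e _; [exact: expeR_ge0|exact: expN_le1].
by rewrite integral_cst// mul1e probability_le1.
Qed.

Lemma betaE x g : x \in `[0, 1] -> (forall y : R, y \in `[0, 1] -> 0 <= g y) ->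
  ((beta PB B x g)%:E =
   \int[PB]_e expeR (- \int[leb]_(y in `[0%R, 1%R]) (g y * B y x e)%:E))%E.
Proof.
move=> x01 g0; rewrite /beta fineK//; have /andP[b0 b1] := beta_fin x01 g0.
by rewrite ge0_fin_numE// (le_lt_trans b1)// ltry.
Qed.

Lemma beta01 x g : x \in `[0, 1] -> (forall y : R, y \in `[0, 1] -> 0 <= g y) ->
  0 <= beta PB B x g <= 1.
Proof. by move=> x01 g0; rewrite -!lee_fin (betaE x01 g0); exact: beta_fin. Qed.

Lemma le_beta x g g' : x \in `[0, 1] -> (forall y : R, y \in `[0, 1] -> 0 <= g y <= g' y) ->
  beta PB B x g' <= beta PB B x g.
Proof.
move=> x01 gg'.
have g0 y : y \in `[0, 1] -> 0 <= g y by move=> /gg'/andP[].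
have g'0 y : y \in `[0, 1] -> 0 <= g' y.
  by move=> y01; have /andP[a b] := gg' y y01; rewrite (le_trans a b).
rewrite -lee_fin [X in (X <= _)%E](betaE x01 g'0) [X in (_ <= X)%E](betaE x01 g0).
apply: ge0_le_lower_integral => e _; first exact: expeR_ge0.
rewrite lee_expeR leeN2; apply: ge0_le_lower_integral => y y01.
  by rewrite lee_fin mulr_ge0 ?g0 ?B_ge0.
by rewrite lee_fin ler_wpM2r ?B_ge0//; have /andP[] := gg' y y01.
Qed.

Lemma gamma01 x f u : x \in `[0, 1] -> 0 <= f x -> 0 <= gamma PJ J x f u <= 1.
Proof.
move=> x01 fx0; rewrite /gamma; have /andP[s0 s1] := survival01 PJ J_meas u x01.
have e0 : 0 <= expR (- f x) by exact: expR_ge0.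
have e1 : expR (- f x) <= 1 by rewrite expR_le1 oppr_le0.
by apply/andP; split; nra.
Qed.

Definition unit_functional (xi : functional R) :=
  forall x f u, x \in `[0, 1] -> BMplus f -> 0 <= u -> 0 <= xi x f u <= 1.

Definition functional_le (xi zeta : functional R) :=
  forall x f u, x \in `[0, 1] -> BMplus f -> 0 <= u -> xi x f u <= zeta x f u.

Definition delayed (xi : functional R) (f : R -> R) (u x y : R) : \bar R :=
  (\int[leb]_(s in `[0%R, u]) ((1 - xi y f (u - s)) * W y x * h s)%:E)%E.

(** [Phi] uses the real-valued integral, which sends +oo to 0 and would break monotonicity.
    Finiteness follows from the bound on W and the integrability of h. *)
Lemma delayed_fin xi f u x y : unit_functional xi -> BMplus f ->
  x \in `[0, 1] -> y \in `[0, 1] -> (0 <= delayed xi f u x y < +oo)%E.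
Proof.
move=> xi01 fB x01 y01.
have F0 s : `[0, u]%classic s -> 0 <= (1 - xi y f (u - s)) * W y x * h s.
  rewrite /= in_itv/= => /andP[s0 su].
  have /andP[_ x1] := xi01 y f (u - s) y01 fB (etrans (subr_ge0 _ _) su).
  by rewrite !mulr_ge0 ?W_ge0 ?h_ge0 ?subr_ge0.
apply/andP; split; first by apply: integral_ge0 => s /F0; rewrite lee_fin.
apply: (@le_lt_trans _ _ (\int[leb]_s (CW * h_ext h s)%:E)%E).
  rewrite /delayed integral_mkcond; apply: ge0_le_lower_integral => s _.
    by rewrite patchE; case: ifPn => // /set_mem /F0; rewrite lee_fin.
  rewrite patchE; case: ifPn => [/set_mem su|_]; last first.
    by rewrite lee_fin mulr_ge0// h_ext_ge0.
  have /andP[s0 su'] : (0 <= s <= u) by move: su; rewrite /= in_itv.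
  rewrite lee_fin /h_ext s0 ler_wpM2r ?h_ge0//.
  have /andP[x0 x1] := xi01 y f (u - s) y01 fB (etrans (subr_ge0 _ _) su').
  have W0 := W_ge0 y01 x01; have W1 := W_le y01 x01; nra.
have : leb.-integrable setT (fun s => (CW * h_ext h s)%:E).
  rewrite (_ : (fun s => _) = (fun s => CW%:E * (EFin \o h_ext h) s)%E)//.
  by apply: integrableZl => //; exact: integrable_h_ext.
move=> /integrableP[_]; rewrite (_ : (\int[leb]_s _ = \int[leb]_s `|(CW * h_ext h s)%:E|)%E)//.
by apply: eq_integral => s _; rewrite gee0_abs// lee_fin mulr_ge0// h_ext_ge0.
Qed.

(** Two order reversals cancel: 1 - xi decreases in xi, and [beta] decreases in its argument. *)
Lemma le_Phi xi zeta : unit_functional xi -> unit_functional zeta -> functional_le xi zeta ->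
  functional_le (Phi' xi) (Phi' zeta).
Proof.
move=> xi01 zeta01 le_xi x f u x01 fB u0.
have f0 : 0 <= f x by case: fB => _ f0 _; exact: f0.
have /andP[g0 _] := gamma01 u x01 f0.
rewrite /Phi; apply: (ler_wpM2l g0); apply: (le_beta x01) => y y01.
have /andP[d0 dy] := delayed_fin u zeta01 fB x01 y01.
have /andP[d'0 d'y] := delayed_fin u xi01 fB x01 y01.
rewrite /Rintegral fine_ge0//= fine_le ?ge0_fin_numE//.
apply: ge0_le_lower_integral => s; rewrite /= in_itv/= => /andP[s0 su].
  rewrite lee_fin; have /andP[_ x1] := zeta01 y f (u - s) y01 fB (etrans (subr_ge0 _ _) su).
  by rewrite !mulr_ge0 ?W_ge0 ?h_ge0 ?subr_ge0.
rewrite lee_fin ler_wpM2r ?h_ge0// ler_wpM2r ?W_ge0// lerB//.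
by apply: le_xi => //; rewrite subr_ge0.
Qed.

Lemma Phi_unit xi : unit_functional xi -> unit_functional (Phi' xi).
Proof.
move=> xi01 x f u x01 fB u0.
have f0 : 0 <= f x by case: fB => _ f0 _; exact: f0.
have /andP[g0 g1] := gamma01 u x01 f0.
have [|b0 b1] := andP (@beta01 x (fun y => \int[leb]_(s in `[0, u])
  ((1 - xi y f (u - s)) * W y x * h s)) x01 _).
  by move=> y y01; apply: fine_ge0; have /andP[] := delayed_fin u xi01 fB x01 y01.
by rewrite /Phi mulr_ge0//= mulr_ile1.
Qed.

Lemma iter_Phi_unit n xi : unit_functional xi -> unit_functional (iter n Phi' xi).
Proof. by move=> xi01; elim: n => //= n; exact: Phi_unit. Qed.

Lemma le_iter_Phi n xi zeta : unit_functional xi -> unit_functional zeta ->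
  functional_le xi zeta -> functional_le (iter n Phi' xi) (iter n Phi' zeta).
Proof.
move=> xi01 zeta01 le_xi; elim: n => //= n; apply: le_Phi; exact: iter_Phi_unit.
Qed.

End operator_order.

(** * The operator Phi as a branching operator in absolute time *)

Section operator_branching.
Context {R : realType} {dB dJ : measure_display}.
Context {OB : measurableType dB} {OJ : measurableType dJ}.
Variables (PB : probability OB R) (h : R -> R) (W : R -> R -> R) (B : R -> R -> OB -> R).
Variables (PJ : probability OJ R) (J : R -> OJ -> R).
Variables CW CB : R.
Hypothesis h_ge0 : forall s : R, 0 <= s -> 0 <= h s.
Hypothesis h_L1 : lebesgue_measure.-integrable `[0, +oo[ (EFin \o h).
Hypothesis W_meas : measurable_fun ((`[0, 1] : set R) `*` (`[0, 1] : set R))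
  (fun p : R * R => W p.1 p.2).
Hypothesis W_ge0 : forall x y : R, x \in `[0, 1] -> y \in `[0, 1] -> 0 <= W x y.
Hypothesis CW_ge0 : 0 <= CW.
Hypothesis W_le : forall x y : R, x \in `[0, 1] -> y \in `[0, 1] -> W x y <= CW.
Hypothesis B_meas : measurable_fun (((`[0, 1] : set R) `*` (`[0, 1] : set R)) `*` setT)
  (fun p : (R * R) * OB => B p.1.1 p.1.2 p.2).
Hypothesis B_ge0 : forall (x y : R) e, x \in `[0, 1] -> y \in `[0, 1] -> 0 <= B x y e.
Hypothesis CB_ge0 : 0 <= CB.
Hypothesis B_le : forall x y : R, x \in `[0, 1] -> y \in `[0, 1] ->
  ('E_PB[B x y] <= CB%:E)%E.
Hypothesis J_meas : forall x : R, x \in `[0, 1] -> measurable_fun setT (J x).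
Hypothesis J_survival_meas : forall r : R, 0 <= r ->
  measurable_fun (`[0, 1] : set R) (fun x => survival PJ J x r).
Local Notation leb := (@lebesgue_measure R).
Local Notation Phi' := (Phi h W PB B PJ J).
Local Notation kap := (hawkes_kernel h W B).

Let mkap := measurable_hawkes_kernel h_L1 W_meas B_meas.
Let kap_ge0 := hawkes_kernel_ge0 h_ge0 W_ge0 B_ge0.

Variables (f F : R -> R) (u : R).
Hypothesis fB : BMplus f.
Hypothesis mF : measurable_fun setT F.
Hypothesis F_ge0 : forall x, 0 <= F x.
Hypothesis Ff : forall x : R, x \in `[0, 1] -> F x = f x.
Let g := life_weight PJ J u F.
Local Notation branch := (branching PB kap g).

Lemma measurable_life_weight : measurable_fun setT g.
Proof.
apply/measurable_EFinP; apply: measurable_funB; first exact: measurable_cst.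
apply: measurable_funM.
  have mt : measurable_fun setT (fun p : R * R => (p.2, u - p.1)).
    by apply: measurable_fun_pair => //; exact: measurable_funB.
  exact: (measurableT_comp (measurable_survival_ext J_meas J_survival_meas) mt).
apply: measurable_funB; first exact: measurable_cst.
apply: (measurableT_comp (@measurable_expR R)); apply: measurable_funN.
exact: (measurableT_comp mF).
Qed.

Lemma life_weight01 p : (0 <= g p <= 1)%E.
Proof.
rewrite /g /life_weight !lee_fin.
have /andP[s0 s1] := survival_ext01 PJ J_meas (p.2, u - p.1).
have e0 : 0 <= expR (- F p.2) by exact: expR_ge0.
have e1 : expR (- F p.2) <= 1 by rewrite expR_le1 oppr_le0.
by apply/andP; split; nra.
Qed.

Lemma life_weightE s y : y \in `[0, 1] -> s <= u -> g (s, y) = (gamma PJ J y f (u - s))%:E.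
Proof.
move=> y01 su; rewrite /g /life_weight /survival_ext /gamma/= y01 subr_ge0 su/= Ff//.
by congr _%:E; ring.
Qed.

Lemma life_weight_late s y : u < s -> g (s, y) = 1%E.
Proof.
move=> us; rewrite /g /life_weight /survival_ext/= subr_ge0 leNgt us andbF/=.
by rewrite mul0r subr0.
Qed.

(** Brings the offspring integral into the shape of [Phi]: the location outermost with B factored
    out, and inside it an integral over the delay r instead of the absolute time. *)
Lemma expected_offspring_kernelE c s y e : measurable_fun setT c -> (forall p, 0 <= c p)%E ->
  y \in `[0, 1] ->
  expected_offspring kap c s y e = (\int[leb]_(z in `[0%R, 1%R])
    ((\int[leb]_r (c ((s + r)%R, z) * (W z y * h_ext h r)%:E)) * (B z y e)%:E))%E.
Proof.
move=> mc c0 y01.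
have mk : measurable_fun setT (fun p : R * R => (c p * (kap p.2 y e (p.1 - s))%:E)%E).
  apply: emeasurable_funM => //; apply/measurable_EFinP.
  by apply: (measurable_kap_comp mkap) => //; exact: measurable_funB.
have k0 (p : R * R) : (0 <= c p * (kap p.2 y e (p.1 - s))%:E)%E.
  by rewrite mule_ge0// lee_fin.
rewrite /expected_offspring (integral_leb2 mk k0).
rewrite (@fubini_tonelli _ _ _ _ R leb leb _ mk k0).
rewrite [RHS]integral_mkcond; apply: eq_integral => z _ /=.
rewrite patchE; case: ifPn => [/set_mem z01|z01]; last first.
  apply: integral0_eq => t _; rewrite /hawkes_kernel /in_square.
  by rewrite (_ : z \in `[0, 1] = false) ?mule0//; apply: contraNF z01 => /mem_set.
have z01' : z \in `[0, 1] by [].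
pose G r := (c ((s + r)%R, z) * (W z y * h_ext h r)%:E)%E.
have mc' : measurable_fun setT (fun r => c ((s + r)%R, z)).
  have mt : measurable_fun setT (fun r : R => (s + r, z)).
    by apply: measurable_fun_pair => //; exact: measurable_addr.
  exact: (measurableT_comp mc mt).
have mG : measurable_fun setT G.
  apply: emeasurable_funM => //; apply/measurable_EFinP.
  by apply: measurable_funM => //; exact: measurable_h_ext.
have G0 r : (0 <= G r)%E by rewrite mule_ge0// lee_fin mulr_ge0 ?W_ge0 ?h_ext_ge0.
rewrite -ge0_integralZr//; [|by move=> r _; exact: G0|by rewrite lee_fin B_ge0].
rewrite -(@ge0_integral_translate _ (- s) (fun r => G r * (B z y e)%:E)%E); last 2 first.
- by apply: emeasurable_funM.
- by move=> r; rewrite mule_ge0// lee_fin B_ge0.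
apply: eq_integral => t _; rewrite /G -muleA -EFinM (_ : s + (- s + t) = t); last by ring.
by rewrite /hawkes_kernel /in_square z01' y01/= [- s + t]addrC; congr (_ * _%:E)%E; ring.
Qed.

(* q is indexed by absolute time, xi by the time left until the horizon u; the events born
   after u do not contribute. *)
Definition represents (q : R * R -> \bar R) (xi : functional R) :=
  [/\ unit_valued q, unit_functional xi,
      forall s z, z \in `[0, 1] -> s <= u -> q (s, z) = (xi z f (u - s))%:E &
      forall s z, u < s -> q (s, z) = 1%E].

Lemma represents_branching q xi : represents q xi -> represents (branch q) (Phi' xi).
Proof.
move=> [uq xi01 qxi q1]; have [mc c01] := oneB_unit_valued uq.
have c0 p : (0 <= 1 - q p)%E by have /andP[] := c01 p.
split.
- apply: (branching_unit_valued PB mkap kap_ge0) => //; first exact: measurable_life_weight.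
  exact: life_weight01.
- by move=> x f' v; apply: (Phi_unit PB PJ h_ge0 h_L1 W_ge0 CW_ge0 W_le B_ge0 J_meas xi01).
- move=> s y y01 su; rewrite /branching life_weightE// /Phi EFinM; congr (_ * _)%E.
  rewrite betaE//; last first.
    move=> z z01; apply: fine_ge0.
    by have /andP[] := delayed_fin h_ge0 h_L1 W_ge0 CW_ge0 W_le (u - s) xi01 fB y01 z01.
  apply: eq_integral => e _; rewrite expected_offspring_kernelE//; congr (expN _).
  apply: eq_integral => z /set_mem/= z01; rewrite EFinM; congr (_ * _)%E.
  have /andP[d0 dy] := delayed_fin h_ge0 h_L1 W_ge0 CW_ge0 W_le (u - s) xi01 fB y01 z01.
  rewrite /Rintegral fineK; last by rewrite ge0_fin_numE.
  (* Negative delays are removed by the kernel and delays beyond u - s by q = 1, which leaves the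
     range [0, u - s] of [Phi]. *)
  rewrite [RHS]integral_mkcond; apply: eq_integral => r _ /=.
  rewrite patchE (_ : (r \in `[0, u - s]%classic) = (0 <= r <= u - s)); last first.
    by apply/idP/idP => [/set_mem|]; [|move=> ?; apply/mem_set]; rewrite /= in_itv.
  rewrite /h_ext; have [r0|r0] := leP 0 r; last by rewrite mulr0 mule0.
  have [rs|rs] /= := leP r (u - s).
    rewrite qxi//; last by lra.
    by rewrite -EFinB -EFinM opprD addrA; congr _%:E; ring.
  by rewrite q1 ?subee ?mul0e//; lra.
- move=> s y us; rewrite /branching life_weight_late// mul1e /mark_laplace.
  transitivity (\int[PB]_e cst 1%E e)%E; last first.
    by rewrite integral_cst// mul1e; exact: probability_setT.
  (* There are no children before s, and 1 - q vanishes from s > u on, so the exponent is 0. *)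
  apply: eq_integral => e _; rewrite [X in expN X]integral0_eq ?expN0// => -[t z] _ /=.
  have [ts|st] := ltP t s.
    rewrite /hawkes_kernel /h_ext subr_ge0 leNgt ts/= mulr0.
    by case: ifP; rewrite mule0.
  by rewrite q1 ?subee ?mul0e//; exact: lt_le_trans st.
Qed.

Lemma represents_iter n q xi : represents q xi -> represents (iter n branch q) (iter n Phi' xi).
Proof. by move=> r; elim: n => //= n; exact: represents_branching. Qed.

(** The constant 0 would not represent the functional 0: an event born after u must keep the weight
    1. *)
Definition late : R * R -> \bar R := fun p => (\1_[set s | u < s] p.1)%:E.

Lemma represents1 : represents (cst 1%E) (fun _ _ _ => 1).
Proof.
by split => // [|x h' s _ _ _]; [split => // p; rewrite lee01 lexx|rewrite ler01 lexx].
Qed.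

Lemma represents0 : represents late (fun _ _ _ => 0).
Proof.
split.
- split; last by move=> p; rewrite /late indicE; case: (_ \in _); rewrite ?lee01 ?lexx.
  apply/measurable_EFinP.
  have mi : measurable_fun setT (\1_[set s | u < s] : R -> R).
    apply: measurable_indic; rewrite (_ : [set s | u < s] = `]u, +oo[%classic)//.
    by apply/seteqP; split => s /=; rewrite in_itv/= andbT.
  exact: (measurableT_comp mi measurable_fst).
- by move=> x h' s _ _ _; rewrite lexx ler01.
- by move=> s z _ su; rewrite /late indicE memNset//=; apply/negP; rewrite -leNgt.
- by move=> s z us; rewrite /late indicE mem_set.
Qed.

End operator_branching.

(** * Contraction in the exponentially weighted distance *)

Section branching_contraction.
Context {R : realType} {dB : measure_display} {OB : measurableType dB}.
Variable PB : probability OB R.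
Variable kap : R -> R -> OB -> R -> R.
Hypothesis mkap : measurable_fun setT
  (fun p : ((R * R) * OB) * R => kap p.1.1.1 p.1.1.2 p.1.2 p.2).
Hypothesis kap_ge0 : forall z y e r, 0 <= kap z y e r.
Variable theta : R.
Hypothesis halving : forall (c : R * R -> \bar R) (K u s y : R),
  measurable_fun setT c -> (forall p, 0 <= c p)%E -> 0 <= K ->
  (forall t z : R, z \in `[0, 1] -> (c (t, z) <= (K * expR (theta * (u - t)))%:E)%E) ->
  (mean_offspring PB kap c (s, y) <= (K / 2 * expR (theta * (u - s)))%:E)%E.
Variable g : R * R -> \bar R.
Hypothesis mg : measurable_fun setT g.
Hypothesis g01 : forall p, (0 <= g p <= 1)%E.
Local Notation branch := (branching PB kap g).
Local Notation weight t u := (expR (theta * (u - t))).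

Let unit1 : unit_valued (cst 1%E : R * R -> \bar R).
Proof. by split => // p; rewrite /= lee01 lexx. Qed.

Let unit_fin (q : R * R -> \bar R) p : unit_valued q -> q p \is a fin_num.
Proof.
move=> [_ q01]; have /andP[q0 q1] := q01 p.
by rewrite ge0_fin_numE// (le_lt_trans q1)// ltry.
Qed.

Let unit_iter n q : unit_valued q -> unit_valued (iter n branch q).
Proof. exact: (iter_branching_unit_valued PB mkap kap_ge0 mg g01). Qed.

Lemma le_branching p q : unit_valued p -> unit_valued q -> (forall x, p x <= q x)%E ->
  forall x, (branch p x <= branch q x)%E.
Proof.
move=> up uq pq x; have /andP[g0 _] := g01 x.
have [_ p01] := oneB_unit_valued up; have [_ q01] := oneB_unit_valued uq.
apply: (lee_wpmul2l g0); apply: ge0_le_lower_integral => e _; first exact: expN_ge0.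
apply: le_expN; apply: ge0_le_lower_integral => y _.
  by rewrite mule_ge0 ?lee_fin//; have /andP[] := q01 y.
by apply: lee_wpmul2r; rewrite ?lee_fin//; exact: leeB.
Qed.

Lemma le_iter_branching n p q : unit_valued p -> unit_valued q -> (forall x, p x <= q x)%E ->
  forall x, (iter n branch p x <= iter n branch q x)%E.
Proof.
move=> up uq pq; elim: n => [//|n IH] x; rewrite !iterS.
exact: (le_branching (unit_iter n up) (unit_iter n uq) IH x).
Qed.

(* The weighted sup distance exp(-theta (u - t)) |q - p| is halved by each iteration. *)
Lemma iter_branching_gap n u p q : unit_valued p -> unit_valued q ->
  (forall x, p x <= q x)%E ->
  (forall t z : R, (q (t, z) <= p (t, z) + (weight t u)%:E)%E) ->
  forall t z, (iter n branch q (t, z) <=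
               iter n branch p (t, z) + (2^-1 ^+ n * weight t u)%:E)%E.
Proof.
move=> up uq pq gap0; elim: n => [|n IH] t z; first by rewrite expr0 mul1r; exact: gap0.
have uQ := unit_iter n uq; have uP := unit_iter n up.
have PQ := le_iter_branching n up uq pq.
rewrite /= {1}/branching; have /andP[g0 g1] := g01 (t, z).
apply: le_trans.
  by apply: (lee_wpmul2l g0); exact: (mark_laplace_le PB mkap kap_ge0 _ uQ uP PQ).
have mD : measurable_fun setT (fun y => iter n branch q y - iter n branch p y)%E.
  by apply: emeasurable_funB; [case: uQ|case: uP].
have D0 y : (0 <= iter n branch q y - iter n branch p y)%E.
  by rewrite sube_ge0 ?(unit_fin _ uP)//; exact: PQ.
have mean0 : (0 <= mean_offspring PB kap
    (fun y => iter n branch q y - iter n branch p y) (t, z))%E.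
  by apply: integral_ge0 => e _; exact: expected_offspring_ge0.
rewrite ge0_muleDr//; last by apply: integral_ge0 => e _; exact: expN_ge0.
rewrite leeD2l//; apply: (@le_trans _ _ (mean_offspring PB kap
    (fun y => iter n branch q y - iter n branch p y)%E (t, z))).
  by rewrite -[leRHS]mul1e; exact: lee_wpmul2r.
rewrite exprSr; apply: (halving _ _ mD D0); first by apply: exprn_ge0; rewrite invr_ge0.
by move=> t' z' _; rewrite leeBlDl ?(unit_fin _ uP)// addeC; exact: IH.
Qed.

(** With w equal to K/2 times the weight, one w pays for the event itself through [g], and the
    induction hypothesis with [halving] leaves another w for its progeny. For a, b in [0,1] one has
    ab >= a + b - 1, so the losses add up to 2w, which reproduces the bound. *)
Lemma iter_branching1_ge n (K u : R) : 0 <= K ->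
  (forall t z : R, (1 <= g (t, z) + (K / 2 * weight t u)%:E)%E) ->
  forall t z, (1 <= iter n branch (cst 1) (t, z) + (K * weight t u)%:E)%E.
Proof.
move=> K0 gK; elim: n => [|n IH] t z.
  by rewrite /= leeDl// lee_fin mulr_ge0 ?expR_ge0.
have uQ := unit_iter n unit1; have [mQ Q01] := uQ.
have [mD D01] := oneB_unit_valued uQ.
have D0 y : (0 <= 1 - iter n branch (cst 1) y)%E by have /andP[] := D01 y.
have m1 : (1 <= mark_laplace PB kap (fun y => 1 - iter n branch (cst 1) y) (t, z) +
    (K / 2 * weight t u)%:E)%E.
  apply: (@le_trans _ _ (mark_laplace PB kap (fun y => 1 - iter n branch (cst 1) y)%E (t, z) +
     mean_offspring PB kap (fun y => 1 - iter n branch (cst 1) y)%E (t, z))%E).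
    have := mark_laplace_le PB mkap kap_ge0 (t, z) unit1 uQ.
    rewrite {1}/mark_laplace; have -> : (\int[PB]_e expN (expected_offspring kap
        (fun y : R * R => 1 - cst 1 y) (t, z).1 (t, z).2 e) = 1)%E.
      transitivity (\int[PB]_e cst 1%E e)%E; last first.
        by rewrite integral_cst// mul1e; exact: probability_setT.
      apply: eq_integral => e _; rewrite [X in expN X]integral0_eq ?expN0// => p _.
      by rewrite subee ?mul0e.
    by apply => y; have /andP[] := Q01 y.
  rewrite leeD2l//; apply: halving => // t' z' _.
  by rewrite leeBlDl ?(unit_fin _ uQ)// addeC; exact: IH.
have g1 := gK t z.
have /andP[] := g01 (t, z); have /andP[] := mark_laplace01 PB mkap kap_ge0 (t, z) mD D0.
rewrite /= /branching; move: g1 m1; set w := K / 2 * _.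
rewrite (_ : K * weight t u = w + w); last by rewrite /w; field.
case: (g (t, z)) => // a; case: (mark_laplace _ _ _ _) => // b.
rewrite -!EFinD !lee_fin => a1 b1 b0 b1' a0 a1'.
nra.
Qed.

End branching_contraction.

(** * Clusters *)

Lemma measurable_life_cost {R : realType} d (T : measurableType d) (b l : T -> \bar R)
    (x : T -> R) (u : R) (F : R -> R) :
  measurable_fun setT b -> measurable_fun setT l -> measurable_fun setT x ->
  measurable_fun setT F -> measurable_fun setT (life_cost b l x u F).
Proof.
move=> mb ml mx mF; apply: measurable_fun_ifT => //.
  apply: measurable_and; first exact: measurable_fun_lee.
  by apply: measurable_fun_lte => //; exact: emeasurable_funD.
by apply/measurable_EFinP; exact: (measurableT_comp mF mx).
Qed.

Lemma esum_cst_infinite {R : realType} (T : choiceType) (A : set T) (c : T -> \bar R) (k : R) :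
  infinite_set A -> 0 < k -> (forall i, 0 <= c i)%E -> (forall i, A i -> (k%:E <= c i)%E) ->
  (\esum_(i in setT) c i = +oo)%E.
Proof.
move=> Ainf k0 c0 kc; apply/eqyP => M M0.
have [X XA sX] := infinite_set_fset (Num.truncn (M / k)).+1 Ainf.
apply: esum_ge; exists [set` X]; first by split.
rewrite fsbig_finite// set_fsetK big_seq.
apply: (@le_trans _ _ (\sum_(i <- X | i \in X) k%:E)%E); last first.
  by apply: lee_sum => i iX; apply: kc; exact: XA.
rewrite -big_seq sumEFin big_const_seq count_predT iter_addr_0 lee_fin.
rewrite -mulr_natr mulrC -ler_pdivrMr//.
apply: ltW.
by apply: lt_le_trans (truncnS_gt _) _; rewrite ler_nat.
Qed.

Section cluster_of_graphon_hawkes.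
Context {R : realType} {dB dJ dS : measure_display}.
Context {OB : measurableType dB} {OJ : measurableType dJ} {OS : measurableType dS}.
Variables (PB : probability OB R) (h : R -> R) (W : R -> R -> R) (B : R -> R -> OB -> R).
Variables (PJ : probability OJ R) (J : R -> OJ -> R) (PS : probability OS R).
Hypothesis h_ge0 : forall s : R, 0 <= s -> 0 <= h s.
Hypothesis h_L1 : lebesgue_measure.-integrable `[0, +oo[ (EFin \o h).
Hypothesis W_meas : measurable_fun ((`[0, 1] : set R) `*` (`[0, 1] : set R))
  (fun p : R * R => W p.1 p.2).
Hypothesis W_ge0 : forall x y : R, x \in `[0, 1] -> y \in `[0, 1] -> 0 <= W x y.
Hypothesis B_meas : measurable_fun (((`[0, 1] : set R) `*` (`[0, 1] : set R)) `*` setT)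
  (fun p : (R * R) * OB => B p.1.1 p.1.2 p.2).
Hypothesis B_ge0 : forall (x y : R) e, x \in `[0, 1] -> y \in `[0, 1] -> 0 <= B x y e.
Hypothesis J_meas : forall x : R, x \in `[0, 1] -> measurable_fun setT (J x).
Hypothesis J_survival_meas : forall r : R, 0 <= r ->
  measurable_fun (`[0, 1] : set R) (fun x => survival PJ J x r).
Variables (S : bd_process R OS (seq nat)) (M : seq nat -> OS -> OB) (x : R).
Hypothesis Sx : is_cluster h W PB B PJ J PS S M x.
Local Notation leb := (@lebesgue_measure R).
Local Notation kap := (hawkes_kernel h W B).
Local Notation cmeasurable K1 K2 K3 X :=
  (measurable_fun setT (X : g_sigma_algebraType (cluster_gens S M K1 K2 K3) -> _)).

Let mkap := measurable_hawkes_kernel h_L1 W_meas B_meas.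
Let kap_ge0 := hawkes_kernel_ge0 h_ge0 W_ge0 B_ge0.

(** The restrictions on time and location pass from the domain of integration to the zero extension
    of the kernel. *)
Lemma offspring_intensityE v A w : offspring_intensity h W B S M v A w =
  (\int[(leb \x leb)%E]_(p in A) (offspring_density S M kap v (w, p))%:E)%E.
Proof.
rewrite /offspring_intensity /offspring_density/=.
case: (birth S v w) => [s| |]; rewrite ?integral0//.
rewrite integral_mkcond [RHS]integral_mkcond; apply: eq_integral => p _.
rewrite !patchE /hawkes_kernel /in_square /h_ext (loc_01 (cluster_meas Sx)) andbT subr_ge0.
have -> : (p \in A `&` (`[s, +oo[ `*` `[0, 1]%classic)) =
    [&& p \in A, s <= p.1 & p.2 \in `[0, 1]].
  rewrite in_setI; congr (_ && _); apply/idP/andP => [/set_mem[/=]|[? ?]].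
    by rewrite in_itv/= andbT.
  by apply/mem_set; split; rewrite //= in_itv/= andbT.
case: (p \in A) => //=; case: (leP s p.1) => _ /=; last by case: ifP; rewrite ?mulr0.
by case: ifP.
Qed.

Lemma cluster_tree_laplace (g : R * R -> \bar R) (cost : seq nat -> OS -> \bar R) n :
  measurable_fun setT g -> (forall p, 0 <= g p <= 1)%E ->
  (forall v w, 0 <= cost v w)%E ->
  (forall (K1 K2 K3 : set (seq nat)) v, K1 v -> K3 v -> cmeasurable K1 K2 K3 (cost v)) ->
  (forall v X, cmeasurable setT setT [set~ v] X -> (forall w, 0 <= X w <= 1)%E ->
     \int[PS]_w (X w * expN (cost v w)) = \int[PS]_w (X w * at_vertex S 1 g v w))%E ->
  (\int[PS]_w expN (tree_cost cost n [::] w) = iter n (branching PB kap g) (cst 1) (0%R, x))%E.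
Proof.
move=> mg g01 cost0 mcost cost_factor.
have SM := cluster_meas Sx; have mM := cluster_mark_meas Sx.
have offspring_law v : conditionally_poisson PS
    <<s cluster_gens S M (not_strictly_below v) (not_strictly_below v) (not_below v) >>
    (offspring S v)
    (fun A w => \int[(leb \x leb)%E]_(p in A) (offspring_density S M kap v (w, p))%:E)%E.
  rewrite (_ : (fun A w => _) = offspring_intensity h W B S M v).
    exact: (cluster_offspring Sx).
  by apply/funext => A; apply/funext => w; rewrite offspring_intensityE.
have := @tree_laplace _ _ _ _ _ PB PS S M SM mM kap mkap kap_ge0
  (cluster_mark Sx) offspring_law g mg g01 cost cost0 mcost cost_factor n [::] (cst 1%E).
move=> H; transitivity (\int[PS]_w (cst 1 w * expN (tree_cost cost n [::] w)))%E.
  by apply: eq_integral => w _; rewrite mul1e.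
rewrite H; [|exact: measurable_cst|by move=> w; rewrite /= lee01 lexx].
transitivity (\int[PS]_w cst (iter n (branching PB kap g) (cst 1) (0%R, x)) w)%E.
  apply: eq_integral => w _; rewrite mul1e /at_vertex.
  by have [-> ->] := cluster_root Sx w.
by rewrite integral_cst// -[RHS]mule1; congr (_ * _)%E; exact: probability_setT.
Qed.

(** The cost stays abstract because two are needed: [life_cost] for the Laplace functional, and a
    constant charge per early birth for local finiteness. *)
Lemma cvg_cluster_laplace (g : R * R -> \bar R) (cost : seq nat -> OS -> \bar R) :
  measurable_fun setT g -> (forall p, 0 <= g p <= 1)%E ->
  (forall v w, 0 <= cost v w)%E ->
  (forall (K1 K2 K3 : set (seq nat)) v, K1 v -> K3 v -> cmeasurable K1 K2 K3 (cost v)) ->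
  (forall v X, cmeasurable setT setT [set~ v] X -> (forall w, 0 <= X w <= 1)%E ->
     \int[PS]_w (X w * expN (cost v w)) = \int[PS]_w (X w * at_vertex S 1 g v w))%E ->
  measurable_fun setT (fun w => \esum_(v in setT) cost v w)%E /\
  (iter n (branching PB kap g) (cst 1) (0%R, x) @[n --> \oo] -->
   \int[PS]_w expN (\esum_(v in setT) cost v w))%E.
Proof.
move=> mg g01 cost0 mcost cost_factor.
have mtree n : measurable_fun setT (tree_cost cost n [::]).
  apply: (measurable_fun_sub_sigma (cluster_gens_sub (cluster_meas Sx)
    (cluster_mark_meas Sx) (K1 := setT) (K2 := setT) (K3 := setT))).
  exact: cmeasurable_tree_cost.
have cvg_tree w := cvg_tree_cost cost0 w.
split.
  by apply: (emeasurable_fun_cvg (fun n => tree_cost cost n [::])) => // w _; exact: cvg_tree.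
under eq_fun do rewrite -(cluster_tree_laplace _ mg g01 cost0 mcost cost_factor).
apply: cvg_integral_le1 => //.
- by move=> n; exact: measurable_expN.
- by move=> n w; rewrite expN_ge0 expN_le1// tree_cost_ge0.
- move=> w; apply: (@expN_cvg _ (fun n => tree_cost cost n [::] w)) => //.
  - by move=> n; exact: tree_cost_ge0.
  - exact: cvg_tree.
Qed.


Lemma cvg_laplace_cluster (f F : R -> R) (u : R) : 0 <= u -> BMplus f ->
  measurable_fun setT F -> (forall y, 0 <= F y) ->
  (forall y : R, y \in `[0, 1] -> F y = f y) ->
  fine (iter n (branching PB kap (life_weight PJ J u F)) (cst 1%E) (0, x)) @[n --> \oo] -->
  laplace PS S f u.
Proof.
move=> u0 fB mF F0 Ff; have SM := cluster_meas Sx.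
pose cost v := life_cost (birth S v) (life S v) (loc S v) u F.
have cost0 v w : (0 <= cost v w)%E by rewrite /cost /life_cost; case: ifP; rewrite ?lee_fin.
have mcost (K1 K2 K3 : set (seq nat)) v : K1 v -> K3 v -> cmeasurable K1 K2 K3 (cost v).
  move=> Kv1 Kv3; apply: measurable_life_cost => //.
  - exact: cmeasurable_birth.
  - exact: cmeasurable_life.
  - exact: cmeasurable_loc.
have cost_factor v (X : OS -> \bar R) : cmeasurable setT setT [set~ v] X ->
    (forall w, 0 <= X w <= 1)%E ->
    (\int[PS]_w (X w * expN (cost v w)) =
     \int[PS]_w (X w * at_vertex S 1 (life_weight PJ J u F) v w))%E.
  have mb : cmeasurable setT setT [set~ v] (birth S v) by exact: cmeasurable_birth.
  have ml : cmeasurable setT setT [set~ v] (loc S v) by exact: cmeasurable_loc.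
  have Gsub : <<s cluster_gens S M setT setT [set~ v] >> `<=` measurable.
    exact: (cluster_gens_sub SM (cluster_mark_meas Sx)).
  have H := @life_factor _ _ _ PS _ Gsub _ _ PJ J J_meas J_survival_meas _ (life S v) _
    mb ml (life_meas SM v) (birth_ge0 SM v) (loc_01 SM v) (cluster_life Sx (v := v)) u F mF F0 X.
  exact: H.
have [mc H] := cvg_cluster_laplace (measurable_life_weight J_meas J_survival_meas u mF)
  (life_weight01 PJ J_meas u F0) cost0 mcost cost_factor.
have -> : laplace PS S f u = fine (\int[PS]_w expN (\esum_(v in setT) cost v w))%E.
  congr fine; apply: eq_integral => w _; congr (expN _).
  rewrite esum_mkcond; apply: eq_esum => v _; rewrite /cost /life_cost Ff ?(loc_01 SM)//.
  by congr (if _ then _ else _); apply/idP/andP; rewrite inE.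
have /andP[I0 I1] := integral_le1 PS (measurable_expN mc) (fun w =>
  introT andP (conj (expN_ge0 _) (expN_le1 (esum_ge0 (fun v _ => cost0 v w))))).
apply: fine_cvg; rewrite fineK//.
by rewrite ge0_fin_numE// (le_lt_trans I1)// ltry.
Qed.

Variables (theta : R).
Hypothesis theta_ge0 : 0 <= theta.
Hypothesis halving : forall (c : R * R -> \bar R) (K u s y : R),
  measurable_fun setT c -> (forall p, 0 <= c p)%E -> 0 <= K ->
  (forall t z : R, z \in `[0, 1] -> (c (t, z) <= (K * expR (theta * (u - t)))%:E)%E) ->
  (mean_offspring PB kap c (s, y) <= (K / 2 * expR (theta * (u - s)))%:E)%E.

Lemma locally_finite_cluster : locally_finite PS S.
Proof.
have SM := cluster_meas Sx.
pose cost (k m : nat) v w : \bar R :=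
  (if birth S v w <= k%:R%:E then m.+1%:R^-1%:E else 0)%E.
pose g (k m : nat) (p : R * R) : \bar R :=
  if p.1 <= k%:R then (expR (- m.+1%:R^-1))%:E else 1%E.
have mg k m : measurable_fun setT (g k m).
  by apply: measurable_fun_ifT => //; apply: measurable_fun_ler.
have c0 m : 0 <= m.+1%:R^-1 :> R by rewrite invr_ge0.
have ec m : 0 <= expR (- (m.+1%:R^-1 : R)) <= 1 by rewrite expR_ge0 expR_le1 oppr_le0 c0.
have g01 k m p : (0 <= g k m p <= 1)%E.
  by rewrite /g; case: ifP => _; rewrite ?lee01 ?lexx// !lee_fin ec.
have cost0 k m v w : (0 <= cost k m v w)%E by rewrite /cost; case: ifP; rewrite ?lee_fin.
have mcost k m (K1 K2 K3 : set (seq nat)) v : K1 v -> K3 v -> cmeasurable K1 K2 K3 (cost k m v).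
  move=> Kv1 Kv3; apply: measurable_fun_ifT => //.
  by apply: measurable_fun_lee => //; exact: cmeasurable_birth.
have cost_factor k m v (X : OS -> \bar R) : cmeasurable setT setT [set~ v] X ->
    (forall w, 0 <= X w <= 1)%E ->
    (\int[PS]_w (X w * expN (cost k m v w)) = \int[PS]_w (X w * at_vertex S 1 (g k m) v w))%E.
  move=> _ _; apply: eq_integral => w _; congr (_ * _)%E.
  have := birth_ge0 SM v w; rewrite /cost /at_vertex /g; case: (birth S v w) => [s _| _|//].
    by rewrite lee_fin/=; case: ifP => _; rewrite ?expN0.
  by rewrite leye_eq expN0.
have H k m := cvg_cluster_laplace (mg k m) (g01 k m) (cost0 k m) (mcost k m) (cost_factor k m).
(* For every m this is the event that infinitely many births occur by time k; its probability is
   therefore bounded by a quantity that tends to 0 in m. *)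
pose A k m := [set w | \esum_(v in setT) cost k m v w = +oo]%E.
have mA k m : measurable (A k m).
  by have [mc _] := H k m; rewrite -[A k m]setTI; exact: (mc measurableT [set +oo%E]).
pose C k : R := 2 * expR (theta * k%:R).
have PA k m : (PS (A k m) <= (C k * m.+1%:R^-1)%:E)%E.
  have [mc Hcvg] := H k m.
  have lb : (1 <= \int[PS]_w expN (\esum_(v in setT) cost k m v w) + (C k * m.+1%:R^-1)%:E)%E.
    rewrite -leeBlDr//; apply: (cvge_to_ge Hcvg); apply: nearW => n.
    rewrite leeBlDr//.
    (* With K twice the charge, the loss 1 - exp(-c) <= c at an event born by time k fits into K/2
       times the weight, which is at least 1 there. The constant [C k] is K at the root, at time 0,
       divided by the charge. *)
    have K0 : 0 <= 2 * m.+1%:R^-1 :> R by rewrite mulr_ge0.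
    have gK (t z : R) :
        (1 <= g k m (t, z) + (2 * m.+1%:R^-1 / 2 * expR (theta * (k%:R - t)))%:E)%E.
      rewrite [2 / _ / 2]mulrAC divff ?mul1r// /g/=; case: ifPn => [tk|_]; last first.
        by rewrite leeDl// lee_fin mulr_ge0 ?expR_ge0.
      rewrite -EFinD lee_fin.
      have e1 : 1 <= expR (theta * (k%:R - t)).
        by rewrite -[leLHS]expR0 ler_expR mulr_ge0// subr_ge0.
      have e2 := expR_ge1Dx (- (m.+1%:R^-1 : R)); have e3 := ler_peMr (c0 m) e1.
      by apply: le_trans (lerD e2 e3); rewrite subrK.
    have := iter_branching1_ge mkap kap_ge0 halving (mg k m) (g01 k m) n K0 gK 0 x.
    rewrite subr0 (_ : 2 / m.+1%:R * _ = C k * m.+1%:R^-1)//.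
    by rewrite /C mulrAC.
  (* The exponential vanishes where the cost is infinite and is at most 1 elsewhere. *)
  have ub : (\int[PS]_w expN (\esum_(v in setT) cost k m v w) <= PS (~` A k m))%E.
    rewrite -[PS (~` A k m)]mul1e -integral_cst; last exact: measurableC.
    rewrite integral_mkcond; apply: ge0_le_lower_integral => w _; first exact: expN_ge0.
    rewrite patchE; case: ifPn => [_|]; first by rewrite expN_le1// esum_ge0.
    by rewrite notin_setE/= => /contrapT ->; rewrite expNy.
  have Pf : PS (A k m) \is a fin_num by exact: fin_num_measure.
  rewrite probability_setC// in ub.
  move: ub lb Pf; case: (PS (A k m)) => [p| |]//; case: (\int[PS]_w _)%E => [a| |]//.
  move: (C k / _) => c.
  by rewrite -EFinB -EFinD !lee_fin => ub lb _; lra.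
have negligible_A k : PS.-negligible (\bigcap_m A k m).
  have mAk : measurable (\bigcap_m A k m) by exact: bigcapT_measurable.
  exists (\bigcap_m A k m); split => //.
  apply/eqP; rewrite eq_le measure_ge0 andbT; apply/lee_addgt0Pr => e e0; rewrite add0e.
  pose m := Num.truncn (C k / e).
  apply: (@le_trans _ _ (PS (A k m))).
    by apply: le_measure; rewrite ?inE//; exact: bigcap_inf.
  apply: le_trans (PA k m) _; rewrite lee_fin ler_pdivrMr// mulrC -ler_pdivrMr//.
  by rewrite ltW// truncnS_gt.
apply: negligibleS (negligible_bigcup negligible_A).
(* A real time with infinitely many births before it is replaced by an integer beyond it. *)
move=> w /= /existsNP[t Nfin]; pose k := (Num.truncn t).+1; exists k => // m _.
rewrite /A/=; apply: (@esum_cst_infinite _ _ [set v | birth S v w <= k%:R%:E]%E _ m.+1%:R^-1).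
- apply: contra_not Nfin; apply: sub_finite_set => v /= vt.
  by apply: le_trans vt _; rewrite lee_fin ltW// truncnS_gt.
- by rewrite invr_gt0.
- by move=> v; exact: cost0.
- by move=> v /= vk; rewrite /cost vk.
Qed.

End cluster_of_graphon_hawkes.

Lemma laplace_family_unit {R : realType} (xi : functional R) :
  laplace_family xi -> unit_functional xi.
Proof.
move=> xiL x f u x01 fB u0; have [d [T [P [I [Z [SZ _ xiE]]]]]] := xiL x x01.
rewrite xiE// /laplace.
have F0 w : (0 <= \esum_(i in alive Z u w) (f (loc Z i w))%:E)%E.
  by apply: esum_ge0 => i _; case: fB => _ f0 _; rewrite lee_fin f0// (loc_01 SZ).
set I' := (\int[P]_w _)%E.
have I0 : (0 <= I')%E by apply: integral_ge0 => w _; exact: expeR_ge0.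
have I1 : (I' <= 1)%E.
  apply: (@le_trans _ _ (\int[P]_w cst 1%E w)%E).
    by apply: ge0_le_lower_integral => w _; [exact: expeR_ge0|exact: expN_le1].
  by rewrite integral_cst// mul1e probability_le1.
by rewrite fine_ge0//= -lee_fin fineK// ge0_fin_numE// (le_lt_trans I1)// ltry.
Qed.

(** * Squeeze, fixed point and uniqueness *)

Theorem theorem9 (R : realType)
  (dB dJ dS : measure_display)
  (OB : measurableType dB) (OJ : measurableType dJ) (OS : measurableType dS)
  (PB : probability OB R) (PJ : probability OJ R) (PS : probability OS R)
  (lambda h : R -> R) (W : R -> R -> R)
  (B : R -> R -> OB -> R) (J : R -> OJ -> R)
  (CW CB : R)
  (lambda_ge0 : forall (x : R), x \in `[0, 1] -> 0 <= lambda x)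
  (lambda_Loo : (lambda \_ `[0, 1]) \in Lfun lebesgue_measure +oo%E)
  (h_ge0 : forall (s : R), 0 <= s -> 0 <= h s)
  (h_L1 : lebesgue_measure.-integrable `[0, +oo[ (EFin \o h))
  (W_meas : measurable_fun ((`[0, 1] : set R) `*` (`[0, 1] : set R)) (fun p : R * R => W p.1 p.2))
  (W_ge0 : forall (x y : R), x \in `[0, 1] -> y \in `[0, 1] -> 0 <= W x y)
  (CW_ge0 : 0 <= CW)
  (W_le : forall (x y : R), x \in `[0, 1] -> y \in `[0, 1] -> W x y <= CW)
  (B_meas : measurable_fun (((`[0, 1] : set R) `*` (`[0, 1] : set R)) `*` setT)
              (fun p : (R * R) * OB => B p.1.1 p.1.2 p.2))
  (B_ge0 : forall (x y : R) e, x \in `[0, 1] -> y \in `[0, 1] -> 0 <= B x y e)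
  (B_sep : separable_process PB ((`[0, 1] : set R) `*` (`[0, 1] : set R))
             (fun p : R * R => B p.1 p.2))
  (CB_ge0 : 0 <= CB)
  (B_le : forall (x y : R), x \in `[0, 1] -> y \in `[0, 1] ->
            ('E_PB[B x y] <= CB%:E)%E)
  (J_meas : forall (x : R), x \in `[0, 1] -> measurable_fun setT (J x))
  (J_ge0 : forall (x : R) e, x \in `[0, 1] -> 0 <= J x e)
  (J_sep : separable_process PJ (`[0, 1] : set R) J)
  (J_survival_meas : forall (r : R), 0 <= r ->
            measurable_fun (`[0, 1] : set R) (fun x => survival PJ J x r))
  (S : R -> bd_process R OS (seq nat)) (M : R -> seq nat -> OS -> OB)
  (S_cluster : forall (x : R), x \in `[0, 1] ->
            is_cluster h W PB B PJ J PS (S x) (M x) x)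
  (t : R) (t_ge0 : 0 <= t) :
  let eta : functional R := fun x f u => laplace PS (S x) f u in
  let Phi' : functional R -> functional R := Phi h W PB B PJ J in
  [/\ laplace_family eta,
      functional_eq (Phi' eta) eta,
      forall xi : functional R, laplace_family xi ->
        functional_eq (Phi' xi) xi -> functional_eq xi eta &
      forall xi0 : functional R, laplace_family xi0 ->
        forall (u : R) (f : R -> R) (x : R),
          0 <= u -> u <= t -> BMplus f -> x \in `[0, 1] ->
          (fun n : nat => iter n Phi' xi0 x f u) @ \oo --> eta x f u].
Proof.
move=> eta Phi'.
have [theta theta0 theta_small] := laplace_h_ext_small CW CB h_ge0 h_L1.
have mkap := measurable_hawkes_kernel h_L1 W_meas B_meas.
have kap0 := hawkes_kernel_ge0 h_ge0 W_ge0 B_ge0.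
have halving := mean_offspring_le h_ge0 h_L1 W_meas W_ge0 CW_ge0 W_le B_meas B_ge0 CB_ge0 B_le
  theta_small.
pose one : functional R := fun _ _ _ => 1.
pose zero : functional R := fun _ _ _ => 0.
have u1 : unit_functional one by move=> *; rewrite /one ler01 lexx.
have u0 : unit_functional zero by move=> *; rewrite /zero ler01 lexx.
have leP := le_Phi PB PJ h_ge0 h_L1 W_ge0 CW_ge0 W_le B_ge0 J_meas.
have le_iter n := le_iter_Phi PB PJ h_ge0 h_L1 W_ge0 CW_ge0 W_le B_ge0 J_meas n.
have unit_iter n := iter_Phi_unit PB PJ h_ge0 h_L1 W_ge0 CW_ge0 W_le B_ge0 J_meas n.
have unitP := Phi_unit PB PJ h_ge0 h_L1 W_ge0 CW_ge0 W_le B_ge0 J_meas.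
have eta_family : laplace_family eta.
  move=> x x01; exists dS, OS, PS, (seq nat), (S x); split => //.
    exact: (cluster_meas (S_cluster x x01)).
  exact: (locally_finite_cluster h_ge0 h_L1 W_meas W_ge0 B_meas B_ge0 (S_cluster x x01) theta0).
have u_eta := laplace_family_unit eta_family.
have extremes x f u : x \in `[0, 1] -> BMplus f -> 0 <= u ->
    (forall n, iter n Phi' one x f u <=
       iter n Phi' zero x f u + 2^-1 ^+ n * expR (theta * u)) /\
    (iter n Phi' one x f u @[n --> \oo] --> eta x f u).
  move=> x01 fB u_ge0; have [mf f0 _] := fB.
  (* [f] is only controlled on [0,1]; its zero extension is measurable and nonnegative on the whole
     line. *)
  pose F := f \_ `[0, 1]%classic.
  have mF : measurable_fun setT F by apply/(measurable_restrictT _ _).1.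
  have Ff (y : R) : y \in `[0, 1] -> F y = f y by move=> y01; rewrite /F patchE mem_set.
  have F0 y : 0 <= F y.
    by rewrite /F patchE; case: ifPn => // /set_mem y01; exact: f0.
  have mg := measurable_life_weight J_meas J_survival_meas u mF.
  have g01 := life_weight01 PJ J_meas u F0.
  have rep n q xi : represents f u q xi -> 
      iter n (branching PB (hawkes_kernel h W B) (life_weight PJ J u F)) q (0, x) =
      (iter n Phi' xi x f u)%:E.
    move=> r; have [_ _ H _] := represents_iter PB h_ge0 h_L1 W_meas W_ge0 CW_ge0 W_le B_meas
      B_ge0 J_meas J_survival_meas fB mF F0 Ff n r.
    by rewrite H// subr0.
  have rep1 n := rep n _ _ (represents1 f u).
  have rep0 n := rep n _ _ (represents0 f u).
  split=> [n|]; last first.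
    have := cvg_laplace_cluster h_ge0 h_L1 W_meas W_ge0 B_meas B_ge0 J_meas J_survival_meas
      (S_cluster x x01) u_ge0 fB mF F0 Ff.
    by under eq_fun do rewrite rep1/=.
  have [ul _ _ _] := represents0 f u; have [ur _ _ _] := represents1 f u.
  have [_ ul01] := ul.
  have := iter_branching_gap mkap kap0 halving mg g01 n ul ur.
  move=> /(_ u _ _ 0 x); rewrite rep1 rep0 -EFinD lee_fin subr0; apply.
    by move=> p; have /andP[] := ul01 p.
  (* The two starts differ only for s <= u, and there the weight is at least 1, so the initial gap
     is covered. *)
  move=> s z; rewrite /late/= indicE -EFinD lee_fin; case: (boolP (s \in _)) => [_|].
    by rewrite lerDl expR_ge0.
  rewrite notin_setE/= => /negP; rewrite -leNgt => su; rewrite add0r -[leLHS]expR0 ler_expR.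
  by rewrite mulr_ge0// subr_ge0.
have squeeze (a : nat -> R) x f u : x \in `[0, 1] -> BMplus f -> 0 <= u ->
    (forall n, iter n Phi' zero x f u <= a n <= iter n Phi' one x f u) ->
    a @ \oo --> eta x f u.
  move=> x01 fB u_ge0 sand; have [gap cvg1] := extremes x f u x01 fB u_ge0.
  pose lower n := iter n Phi' one x f u - 2^-1 ^+ n * expR (theta * u).
  have lower_a : \forall n \near \oo, lower n <= a n <= iter n Phi' one x f u.
    apply: nearW => n; have /andP[l r] := sand n; rewrite r andbT lerBlDr.
    by apply: le_trans (gap n) _; rewrite lerD2r.
  apply: (squeeze_cvgr lower_a) => //; rewrite /lower.
  rewrite -[X in _ --> X]subr0 -[X in _ --> _ - X](mul0r (expR (theta * u))).
  apply: cvgB => //; apply: cvgM; last exact: cvg_cst.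
  by apply: cvg_expr; rewrite ger0_norm ?invr_ge0// invf_lt1// ltr1n.
have cvg_iter xi x f u : unit_functional xi -> x \in `[0, 1] -> BMplus f -> 0 <= u ->
    iter n Phi' xi x f u @[n --> \oo] --> eta x f u.
  move=> uxi x01 fB u_ge0; apply: (squeeze _ x f u) => // n; apply/andP; split.
    by apply: le_iter => // y f' v y01 f'B v0; have /andP[] := uxi y f' v y01 f'B v0.
  by apply: le_iter => // y f' v y01 f'B v0; have /andP[] := uxi y f' v y01 f'B v0.
have iter_add n k xi : iter (n + k) Phi' xi = iter n Phi' (iter k Phi' xi) by exact: iterD.
have eta_le n : functional_le eta (iter n Phi' one).
  move=> x f u x01 fB u_ge0; apply: (cvgr_to_le (cvg_iter one x f u u1 x01 fB u_ge0)).
  (* For m >= n, the iterate m from 1 is the iterate n from a functional below 1, hence lies below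
     the iterate n from 1; the bound passes to the limit. *)
  exists n => // m /= nm; rewrite -(subnKC nm) iter_add; apply: le_iter => //.
    exact: unit_iter.
  by move=> y f' v y01 f'B v0; have /andP[] := unit_iter (m - n)%N _ u1 y f' v y01 f'B v0.
have eta_ge n : functional_le (iter n Phi' zero) eta.
  move=> x f u x01 fB u_ge0; apply: (cvgr_to_ge (cvg_iter zero x f u u0 x01 fB u_ge0)).
  exists n => // m /= nm; rewrite -(subnKC nm) iter_add; apply: le_iter => //.
    exact: unit_iter.
  by move=> y f' v y01 f'B v0; have /andP[] := unit_iter (m - n)%N _ u0 y f' v y01 f'B v0.
have eta_fix : functional_eq (Phi' eta) eta.
  move=> x f u x01 fB u_ge0.
  (* The constant sequence lies between the extreme ones: at index 0 because [Phi' eta] takes values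
     in [0,1], at n + 1 by applying [Phi'] to the bounds [eta_ge] and [eta_le] at n. *)
  have c : Phi' eta x f u @[_ --> \oo] --> eta x f u.
    apply: (squeeze _ x f u) => // -[|n]; first exact: unitP.
    rewrite !iterS; apply/andP; split; apply: leP => //; exact: unit_iter.
  exact: cvg_unique (cvg_cst _) c.
(* [functional_eq] only compares meaningful arguments, so [Phi'] does not respect it by rewriting.
   Monotonicity in both directions does the job. *)
have eqP xi zeta : unit_functional xi -> unit_functional zeta -> functional_eq xi zeta ->
    functional_eq (Phi' xi) (Phi' zeta).
  move=> uxi uz e x f u x01 fB u_ge0; apply/eqP; rewrite eq_le; apply/andP; split.
    by apply: leP => // y f' v y01 f'B v0; rewrite e.
  by apply: leP => // y f' v y01 f'B v0; rewrite e.
split => //.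
- move=> xi /laplace_family_unit uxi fix_xi x f u x01 fB u_ge0.
  have fix_iter n : functional_eq (iter n Phi' xi) xi.
    elim: n => [//|n IH] y f' v y01 f'B v0.
    by rewrite iterS (eqP _ _ (unit_iter n _ uxi) uxi IH)// fix_xi.
  have := cvg_iter xi x f u uxi x01 fB u_ge0; under eq_fun do rewrite fix_iter//.
  by move=> c; exact: cvg_unique (cvg_cst _) c.
- move=> xi0 /laplace_family_unit uxi u f x u_ge0 _ fB x01; exact: cvg_iter.
Qed.
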